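(* Let $\rho:\pi_1^{\mathrm{orb}}(T^8/\Gamma)\to SO(3)$ be a representation of the orbifold fundamental group whose image is a $\mathbb Z_2\times\mathbb Z_2$ subgroup of commuting involutions of $SO(3)$, satisfying $\rho(\tau_1)=\rho(\tau_2)=\rho(\tau_3)=\rho(\tau_7)=1$ and $\rho(\tau_5)=\rho(\tau_6)$, with $\rho(\alpha)=\rho(\beta)=1$, at least one of $\rho(\gamma)$ or $\rho(\delta)$ non-trivial, and with $\rho(\tau_4),\rho(\tau_5),\rho(\tau_8)$ generating the whole image of $\rho$. Then the flat connection associated with this representation is irreducible, infinitesimally rigid, and unobstructed.
   Context: $\pi_1^{\mathrm{orb}}(T^8/\Gamma)$ is the group of affine isometries of $\mathbb R^8$ generated by $\alpha:(x_1,\dots,x_8)\mapsto(-x_1,-x_2,-x_3,-x_4,x_5,x_6,x_7,x_8)$, $\beta:\ \mapsto(x_1,x_2,x_3,x_4,-x_5,-x_6,-x_7,-x_8)$, $\gamma:\ \mapsto(\frac12-x_1,\frac12-x_2,x_3,x_4,\frac12-x_5,\frac12-x_6,x_7,x_8)$, $\delta:\ \mapsto(-x_1,x_2,\frac12-x_3,x_4,\frac12-x_5,x_6,\frac12-x_7,x_8)$, and the unit translations $\tau_i:x_i\mapsto x_i+1$ ($i=1,\dots,8$). $\Gamma$ is the group generated by $\alpha,\beta,\gamma,\delta$ acting on $T^8=\mathbb R^8/\mathbb Z^8$. The flat $Spin(7)$-structure on $T^8/\Gamma$ is (with $dx_{ijkl}=dx_i\wedge dx_j\wedge dx_k\wedge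 dx_l$) $\Omega_0=dx_{1234}+dx_{1256}+dx_{1278}+dx_{1357}-dx_{1368}-dx_{1458}-dx_{1467}-dx_{2358}-dx_{2367}-dx_{2457}+dx_{2468}+dx_{3456}+dx_{3478}+dx_{5678}$; $\Lambda^2_7$ is the rank 7 eigenspace of $\omega\mapsto*(\Omega_0\wedge\omega)$ on 2-forms with eigenvalue $3$, and $\pi^2_7$ the orthogonal projection onto it. A homomorphism $\rho$ to $G$ determines an orbifold $G$-bundle $E_0=(\mathbb R^8\times G)/\pi_1^{\mathrm{orb}}(T^8/\Gamma)$ over $T^8/\Gamma$ with flat connection $\theta$, the flat connection associated with $\rho$. Let $\mathcal H^i_\theta$ be the cohomology of $0\to\Gamma(\mathrm{Ad}E_0)\xrightarrow{d_\theta}\Gamma(\Lambda^1\otimes\mathrm{Ad}E_0)\xrightarrow{\pi^2_7d_\theta}\Gamma(\Lambda^2_7\otimes\mathrm{Ad}E_0)\to0$ (sections on the orbifold are the equivariant ones upstairs). $\theta$ is irreducible if $\mathcal H^0_\theta=0$, infinitesimally rigid if $\mathcal H^1_\theta=0$, unobstructed if $\mathcal H^2_\theta=0$. *)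

(* Defs.v *)
From HB Require Import structures.
From mathcomp Require Import all_boot all_order all_algebra.
From mathcomp Require Import all_classical all_reals all_analysis.

Set Implicit Arguments.
Unset Strict Implicit.
Unset Printing Implicit Defensive.

Import Order.TTheory GRing.Theory Num.Theory.
Import numFieldNormedType.Exports.

Local Open Scope classical_set_scope.
Local Open Scope ring_scope.

(* The subgroup generated by S inside the group of invertible elements of the
   monoid (T, op, e); the constructor generated_inv adds two-sided inverses. *)
Inductive generated (T : Type) (op : T -> T -> T) (e : T) (S : set T) : set T :=
| generated_mem x : S x -> generated op e S x
| generated_one : generated op e S e
| generated_mul x y :
    generated op e S x -> generated op e S y -> generated op e S (op x y)
| generated_inv x y :
    generated op e S x -> op x y = e -> op y x = e -> generated op e S y.

Section OrbifoldGroup.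
Variable R : realType.

(* Coordinates are numbered from 1, as is customary: the indices 1, ..., 8
   correspond to the ordinals 0, ..., 7 of 'I_8. *)
Definition idx (k : nat) : 'I_8 := inord k.-1.
Definition coord8 (x : 'rV[R]_8) (k : nat) : R := x 0 (idx k).
Definition point8 (s : seq R) : 'rV[R]_8 := \row_(j < 8) nth 0 s j.

Definition alpha (x : 'rV[R]_8) : 'rV[R]_8 :=
  let c := coord8 x in
  point8 [:: - c 1; - c 2; - c 3; - c 4; c 5; c 6; c 7; c 8].
Definition beta (x : 'rV[R]_8) : 'rV[R]_8 :=
  let c := coord8 x in
  point8 [:: c 1; c 2; c 3; c 4; - c 5; - c 6; - c 7; - c 8].
Definition gamma (x : 'rV[R]_8) : 'rV[R]_8 :=
  let c := coord8 x in
  point8 [:: 1 / 2 - c 1; 1 / 2 - c 2; c 3; c 4;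
             1 / 2 - c 5; 1 / 2 - c 6; c 7; c 8].
Definition delta (x : 'rV[R]_8) : 'rV[R]_8 :=
  let c := coord8 x in
  point8 [:: - c 1; c 2; 1 / 2 - c 3; c 4;
             1 / 2 - c 5; c 6; 1 / 2 - c 7; c 8].
Definition tau (k : nat) (x : 'rV[R]_8) : 'rV[R]_8 := x + delta_mx 0 (idx k).

Definition orb_generators : set ('rV[R]_8 -> 'rV[R]_8) :=
  [set alpha; beta; gamma; delta] `|`
  [set tau k | k in [set k : nat | (1 <= k <= 8)%N]].

Definition pi1orb : set ('rV[R]_8 -> 'rV[R]_8) :=
  generated (fun g h : 'rV[R]_8 -> 'rV[R]_8 => g \o h) id orb_generators.

Definition SO3 : set 'M[R]_3 := [set A | A *m A^T = 1%:M /\ \det A = 1].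
Definition so3 : set 'M[R]_3 := [set X | X^T = - X].
Definition Ad (A X : 'M[R]_3) : 'M[R]_3 := A *m X *m invmx A.

(* The values of rho outside pi1orb are irrelevant. *)
Definition representation (rho : ('rV[R]_8 -> 'rV[R]_8) -> 'M[R]_3) : Prop :=
  (forall g, pi1orb g -> SO3 (rho g)) /\
  (forall g h, pi1orb g -> pi1orb h -> rho (g \o h) = rho g *m rho h).

Definition image_of (rho : ('rV[R]_8 -> 'rV[R]_8) -> 'M[R]_3) : set 'M[R]_3 :=
  rho @` pi1orb.

Definition klein_four (H : set 'M[R]_3) : Prop :=
  exists phi : 'Z_2 * 'Z_2 -> 'M[R]_3,
    [/\ injective phi, forall u v, phi (u + v) = phi u *m phi v
      & range phi = H].

End OrbifoldGroup.

Section ExteriorAlgebra.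
Variable R : realType.

(* The exterior algebra of the dual of R^8 with coefficients in V: the value
   of w at S is its coefficient along dx_{i_1} /\ ... /\ dx_{i_k}, where
   i_1 < ... < i_k are the elements of S. *)
Definition ext (V : Type) := {ffun {set 'I_8} -> V}.

(* e_S /\ e_T = shuffle_sign S T *: e_(S :|: T) for disjoint S and T. *)
Definition shuffle_sign (S T : {set 'I_8}) : R :=
  (-1) ^+ #|[set p : 'I_8 * 'I_8 | [&& p.1 \in S, p.2 \in T & (p.2 < p.1)%N]]%SET|.

Definition wedge (V : lmodType R) (a : ext R^o) (b : ext V) : ext V :=
  [ffun U : {set 'I_8} => \sum_(S : {set 'I_8} | S \subset U)
     shuffle_sign S (U :\: S) *: (a S *: b (U :\: S))].

Definition ext_one : ext R^o := [ffun S : {set 'I_8} => (S == finset.set0)%:R].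
Definition dx (i : 'I_8) : ext R^o :=
  [ffun S : {set 'I_8} => (S == [set i]%SET)%:R].

Definition has_degree (V : lmodType R) (k : nat) (w : ext V) : Prop :=
  forall S : {set 'I_8}, #|S| != k -> w S = 0.

(* Hodge star of the Euclidean metric and the orientation dx_1 ... dx_8:
   star e_T = shuffle_sign T (~: T) *: e_(~: T). *)
Definition hodge_star (V : lmodType R) (w : ext V) : ext V :=
  [ffun S : {set 'I_8} => shuffle_sign (~: S)%SET S *: w (~: S)%SET].

Definition ext_dot (v w : ext R^o) : R := \sum_(S : {set 'I_8}) v S * w S.

Definition dx4 (i j k l : nat) : ext R^o :=
  wedge (dx (idx i)) (wedge (dx (idx j)) (wedge (dx (idx k)) (dx (idx l)))).

Definition Omega0 : ext R^o :=
  dx4 1 2 3 4 + dx4 1 2 5 6 + dx4 1 2 7 8 + dx4 1 3 5 7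
  - dx4 1 3 6 8 - dx4 1 4 5 8 - dx4 1 4 6 7 - dx4 2 3 5 8
  - dx4 2 3 6 7 - dx4 2 4 5 7 + dx4 2 4 6 8
  + dx4 3 4 5 6 + dx4 3 4 7 8 + dx4 5 6 7 8.

Definition Lambda27 : set (ext R^o) :=
  [set w : ext R^o |
    has_degree 2 w /\ hodge_star (wedge Omega0 w) = (3 : R) *: w].

Definition pi27 (w : ext R^o) : ext R^o :=
  xget 0 [set p : ext R^o |
    Lambda27 p /\ forall q, Lambda27 q -> ext_dot (w - p) q = 0].

Definition entry (w : ext 'M[R]_3) (a b : 'I_3) : ext R^o :=
  [ffun S : {set 'I_8} => w S a b].

Definition Lambda27_mx : set (ext 'M[R]_3) :=
  [set w | forall a b, Lambda27 (entry w a b)].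

Definition pi27_mx (w : ext 'M[R]_3) : ext 'M[R]_3 :=
  [ffun S : {set 'I_8} => \matrix_(a, b) pi27 (entry w a b) S].

End ExteriorAlgebra.

Section FlatConnection.
Variable R : realType.

Definition form (V : Type) := 'rV[R]_8 -> ext V.

Definition partial (V : normedModType R) (i : 'I_8) (f : 'rV[R]_8 -> V) :
  'rV[R]_8 -> V := fun x => 'D_(delta_mx 0 i) f x.

Definition smooth (V : normedModType R) (f : 'rV[R]_8 -> V) : Prop :=
  forall (s : seq 'I_8) (x : 'rV[R]_8), differentiable (foldr (@partial V) f s) x.

Definition smooth_form (V : normedModType R) (w : form V) : Prop :=
  forall S : {set 'I_8}, smooth (fun x => w x S).

Definition ext_d (V : normedModType R) (w : form V) : form V :=
  fun x => \sum_(i < 8)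
    wedge (dx R i) [ffun S : {set 'I_8} => partial i (fun y => w y S) x].

(* The function f, regarded as a form of degree 0. *)
Definition fun_form (f : 'rV[R]_8 -> R) : form R^o :=
  fun x => f x *: ext_one R.

(* The pullback of dx_{i_1} /\ ... /\ dx_{i_k} by g is
   dg_{i_1} /\ ... /\ dg_{i_k}. *)
Definition pullback (V : normedModType R) (g : 'rV[R]_8 -> 'rV[R]_8)
    (w : form V) : form V :=
  fun x => [ffun T : {set 'I_8} => \sum_(S : {set 'I_8})
    (\big[@wedge R R^o / ext_one R]_(i <- enum S)
       ext_d (fun_form (fun y => g y 0 i)) x) T *: w (g x) S].

(* Sections over the orbifold of Lambda^k (x) Ad E_0.  Since pi1orb acts on
   R^8 * SO(3) by g (x, h) = (g x, rho g * h), they are the smooth so(3)-valued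
   k-forms w on R^8 with g^* w = Ad (rho g) w for all g in pi1orb. *)
Definition Ad_sections (rho : ('rV[R]_8 -> 'rV[R]_8) -> 'M[R]_3) (k : nat) :
    set (form 'M[R]_3) :=
  [set w | [/\ smooth_form w,
               forall x, has_degree k (w x),
               forall x S, so3 (w x S)
             & forall g, pi1orb g -> forall x S,
                 pullback g w x S = Ad (rho g) (w x S)]].

Definition Ad_sections27 (rho : ('rV[R]_8 -> 'rV[R]_8) -> 'M[R]_3) :
    set (form 'M[R]_3) :=
  Ad_sections rho 2 `&` [set w | forall x, Lambda27_mx (w x)].

(* The flat connection theta of rho is induced by the product connection on
   R^8 * SO(3), hence d_theta is the exterior derivative on equivariant forms. *)
Definition d_theta : form 'M[R]_3 -> form 'M[R]_3 := @ext_d 'M[R]_3.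

Definition pi27_d_theta : form 'M[R]_3 -> form 'M[R]_3 :=
  fun w x => pi27_mx (d_theta w x).

Definition zero_map : form 'M[R]_3 -> form 'M[R]_3 := fun _ _ => 0.

(* The cohomology at B of A --f--> B --g--> C, i.e. the quotient of
   B /\ ker g by f(A), is zero. *)
Definition cohomology_zero (A : set (form 'M[R]_3))
    (f : form 'M[R]_3 -> form 'M[R]_3) (B : set (form 'M[R]_3))
    (g : form 'M[R]_3 -> form 'M[R]_3) : Prop :=
  [set w | B w /\ g w = (fun _ => 0)] `<=` f @` A.

Definition irreducible (rho : ('rV[R]_8 -> 'rV[R]_8) -> 'M[R]_3) : Prop :=
  cohomology_zero [set (fun _ => 0)] zero_map (Ad_sections rho 0) d_theta.

Definition infinitesimally_rigid (rho : ('rV[R]_8 -> 'rV[R]_8) -> 'M[R]_3) :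
    Prop :=
  cohomology_zero (Ad_sections rho 0) d_theta (Ad_sections rho 1) pi27_d_theta.

Definition unobstructed (rho : ('rV[R]_8 -> 'rV[R]_8) -> 'M[R]_3) : Prop :=
  cohomology_zero (Ad_sections rho 1) pi27_d_theta (Ad_sections27 rho) zero_map.

End FlatConnection.

(* Main.v *)
Require Import Defs.
From HB Require Import structures.
From mathcomp Require Import all_boot all_order all_algebra.
From mathcomp Require Import all_classical all_reals all_analysis.
From mathcomp Require Import ring lra zify.

(* The values of rho on the translations tau_4, tau_5, tau_8 generate
   a Klein four-group, which fixes no non-zero vector of so(3); hence every
   coefficient of a section is 2-periodic in all coordinates and its sum over
   the translates by subsets of {e_4, e_5, e_8} vanishes.  On smooth functions
   with these two properties the Laplacian is bijective.  Splitting into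
   symmetric and antisymmetric parts reduces this to functions that are
   antiperiodic in one coordinate, where it follows from finite differences: a
   reflection-coupling maximum principle bounds u by sup |Delta_h u| / 8
   uniformly in the mesh h, so on a finite grid Delta_h has an inverse, which
   is a finite combination of translations and commutes with derivatives; these
   inverses converge, together with all derivatives, as h -> 0.

   Write J_1, ..., J_7 for the complex structures spanning Lambda^2_7.  Their
   Clifford relations give, for a one-form a with pi_7 (d a) = 0, the identity
   Delta a_l = d_l (div a), so that a = d u with Delta u = div a; and, for w in
   Lambda^2_7 with w = Delta W, they give w = pi_7 (d a) with
   a_l = 4 sum_k d_k W_kl.  Injectivity of the Laplacian transports
   equivariance and so(3)-valuedness to u and W. *)

Set Implicit Arguments.
Unset Strict Implicit.
Unset Printing Implicit Defensive.

Import Order.TTheory GRing.Theory Num.Theory.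
Import numFieldNormedType.Exports.
Local Open Scope classical_set_scope.
Local Open Scope ring_scope.

(** * Finite-difference Laplacians *)

(** The obstacle is to invert the Laplacian using only order, finite sums and mean values.
    Antiperiodicity makes this possible: it forces the difference [u (x + r v_j) - u (x - r v_j)] to
    vanish at both ends of an interval of [r], so a parabola bounds it whatever happens in the other
    directions. The height of that parabola depends on the antiperiod and not on the mesh.
    Regularity comes for free, since an inverse made of translations maps derivatives of [f] to
    derivatives of the solution and so inherits every bound from the right-hand side.

    The link with [Omega0] is the identity [star (Omega0 /\ .) = sum_b J_b (x) J_b - 1] on
    two-forms. The [J_b] are orthogonal of squared norm 4, so this operator is [4 - 1 = 3] on their
    span and [-1] on the orthogonal complement. This identity and the Clifford relations are
    statements about integer tables and are settled by evaluation. *)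

Definition second_diff (R : realType) (T : zmodType) (v : T) (u : T -> R) (x : T) : R :=
  u (x + v) + u (x - v) - 2 * u x.

Definition discrete_laplacian (R : realType) (T : zmodType) (n : nat)
    (v : 'I_n -> T) (u : T -> R) (x : T) : R :=
  \sum_(i < n) second_diff (v i) u x.

(** * Maximum principle by reflection coupling *)

Section MaximumPrinciple.
Variables (R : realType) (T : zmodType) (n : nat) (v : 'I_n -> T).
Variables (j : 'I_n) (N : nat).
Implicit Types (u : T -> R) (x : T).

(* Reflection coupling: [u] is sampled at the two points [x +- r v_j].  The
   difference vanishes for [r = 0] and, by antiperiodicity, for [r = 2 N], so
   that the parabola [r (2 N - r)] is a barrier. *)
Let W u x (r : nat) : R := u (x + v j *+ r) - u (x - v j *+ r).

Let W_laplacian u x (r : nat) :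
  discrete_laplacian v u (x + v j *+ r.+1) - discrete_laplacian v u (x - v j *+ r.+1) =
  (W u x r.+2 + W u x r - 2 * W u x r.+1) +
  \sum_(i < n | i != j) (W u (x + v i) r.+1 + W u (x - v i) r.+1 - 2 * W u x r.+1).
Proof.
rewrite /discrete_laplacian -sumrB (bigD1 j) //=; congr (_ + _).
  rewrite /second_diff /W.
  have -> : x + v j *+ r.+1 + v j = x + v j *+ r.+2 by rewrite -addrA -mulrSr.
  have -> : x + v j *+ r.+1 - v j = x + v j *+ r.
    by rewrite mulrSr addrA addrK.
  have -> : x - v j *+ r.+1 - v j = x - v j *+ r.+2.
    by rewrite -addrA -opprD -mulrSr.
  have -> : x - v j *+ r.+1 + v j = x - v j *+ r.
    by rewrite mulrSr opprD addrA addrNK.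
  by ring.
apply: eq_bigr => i _; rewrite /second_diff /W.
do 2![rewrite (addrAC x (v j *+ r.+1)) (addrAC x (- (v j *+ r.+1)))].
by ring.
Qed.

(** At an interior maximum of the excess of [W] over the parabola [F' r (2 N - r)], all second
    differences of the excess are at most 0 and the parabola contributes [- 2 F'], whereas the two
    Laplacians differ by at most [2 F < 2 F']. Since [T] may be infinite, the argument runs at a
    near-maximum. *)
Lemma antiperiodic_le (u : T -> R) (B F : R) :
  (forall x, `|u x| <= B) ->
  (forall x, u (x + v j *+ N.*2) = - u x) ->
  (forall x, `|discrete_laplacian v u x| <= F) ->
  forall x, u x <= F * N%:R ^+ 2 / 2.
Proof.
move=> uB uanti uF x0.
have F_ge0 : 0 <= F by exact: le_trans (normr_ge0 _) (uF x0).
(* A constant strictly above [F] leaves room for the error made at a near-maximum; letting [F'] tend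
   to [F] gives the claim. *)
suff key : forall F', F < F' -> u x0 <= F' * N%:R ^+ 2 / 2.
  apply/ler_addgt0Pr => e e0.
  apply: le_trans (key (F + e / (N%:R ^+ 2 + 1)) _) _.
    by rewrite ltrDl divr_gt0// ltr_wpDl.
  rewrite !mulrDl lerD2l.
  have : e / (N%:R ^+ 2 + 1) * N%:R ^+ 2 <= e.
    rewrite mulrAC ler_pdivrMr ?ltr_wpDl//.
    by rewrite ler_wpM2l ?(ltW e0) // lerDl.
  by lra.
move=> F' FF'.
pose V x (r : nat) := W u x r - F' * r%:R * ((N.*2)%:R - r%:R).
suff VP : forall x r, (r <= N.*2)%N -> V x r <= 0.
  (* Centering the pair at [x0 - N v_j] with [r = N] samples [u] at [x0] and [x0 - 2 N v_j], where
     [W] equals [2 u x0], at the top of the parabola. *)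
  have := VP (x0 - v j *+ N) N; rewrite -addnn leq_addr => /(_ isT).
  rewrite /V /W subrK.
  have -> : u (x0 - v j *+ N - v j *+ N) = - u x0.
    rewrite -[in RHS](subrK (v j *+ N.*2) x0) uanti opprK -addnn.
    by rewrite mulrnDr opprD addrA.
  by rewrite -addnn natrD expr2; lra.
pose S := [set y : R | exists x r, (r <= N.*2)%N /\ y = V x r].
have S0 : S !=set0 by exists (V x0 0%N), x0, 0%N.
have VB x r : (r <= N.*2)%N -> V x r <= B + B.
  move=> rN; rewrite /V /W.
  have h1 := le_trans (ler_norm _) (uB (x + v j *+ r)).
  have := le_trans (ler_norm _) (le_trans (lexx _) (uB (x - v j *+ r))).
  have := uB (x - v j *+ r); rewrite ler_norml => /andP[h2 _] _.
  have : 0 <= F' * r%:R * ((N.*2)%:R - r%:R).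
    by rewrite !mulr_ge0 ?subr_ge0 ?ler_nat// (le_trans F_ge0) // ltW.
  by lra.
have Sub : has_ubound S by exists (B + B) => _ [x [r [rN ->]]]; exact: VB.
have Vsup x r : (r <= N.*2)%N -> V x r <= sup S.
  by move=> rN; apply: ub_le_sup => //; exists x, r.
case: (ltP 0 (sup S)) => [s_gt0|s_le0]; last first.
  by move=> x r rN; exact: le_trans (Vsup _ _ rN) s_le0.
exfalso.
have n0 : 0 < n%:R :> R by rewrite ltr0n; case: (n) (j) => [[]|].
(* [d <= sup S] makes the excess positive at the near-maximum, which excludes [r = 0] and [r = 2 N];
   [d <= (F' - F) / n] keeps the total error [2 n d] of the [n] second differences below
   [2 (F' - F)]. *)
pose d := Num.min (sup S) ((F' - F) / n%:R).
have d0 : 0 < d by rewrite lt_min s_gt0 divr_gt0// subr_gt0.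
have [_ [x [r [rN ->]]] Vd] := sup_adherent d0 (conj S0 Sub).
have ds : d <= sup S by rewrite ge_min lexx.
have dF : d <= (F' - F) / n%:R by rewrite ge_min lexx orbT.
have V0 : 0 < V x r by lra.
have r0 : (0 < r)%N.
  by rewrite lt0n; apply/eqP => r0; move: V0; rewrite r0 /V /W mulr0n subr0 addr0; lra.
have rL : (r < N.*2)%N.
  rewrite ltn_neqAle rN andbT; apply/eqP => r0'; move: V0.
  rewrite r0' /V /W uanti.
  have -> : u (x - v j *+ N.*2) = - u x.
    by rewrite -[in RHS](subrK (v j *+ N.*2) x) uanti opprK.
  lra.
case: r r0 rN rL Vd V0 => // r _ rN rL Vd V0.
have := W_laplacian u x r.
under eq_bigr => i _.
  have -> : W u (x + v i) r.+1 + W u (x - v i) r.+1 - 2 * W u x r.+1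
    = V (x + v i) r.+1 + V (x - v i) r.+1 - 2 * V x r.+1 by rewrite /V; ring.
over.
have WV y k : W u y k = V y k + F' * k%:R * ((N.*2)%:R - k%:R) by rewrite /V; ring.
rewrite !WV.
have : \sum_(i < n | i != j) (V (x + v i) r.+1 + V (x - v i) r.+1 - 2 * V x r.+1)
    <= \sum_(i < n | i != j) (2 * d).
  apply: ler_sum => i _.
  have := Vsup (x + v i) _ rN; have := Vsup (x - v i) _ rN; lra.
have -> : \sum_(i < n | i != j) (2 * d) = 2 * d * n%:R - 2 * d.
  have : \sum_(i < n) (2 * d) = 2 * d * n%:R.
    by rewrite sumr_const card_ord mulr_natr.
  by rewrite (bigD1 j) //= => <-; rewrite addrAC subrr add0r.
have : d * n%:R <= F' - F by rewrite -ler_pdivlMr.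
have := Vsup x _ rL; have := Vsup x r (leqW (ltnW rL)).
have := uF (x + v j *+ r.+1); have := uF (x - v j *+ r.+1).
rewrite !ler_norml => /andP[a1 a2] /andP[a3 a4].
rewrite -(natr1 r.+1) -(natr1 r).
set A := \sum_(i < n | _) _.
set A1 := discrete_laplacian _ _ _ in a1 a2 *.
set A2 := discrete_laplacian _ _ _ in a3 a4 *.
set rr : R := r%:R; set LL : R := (N.*2)%:R.
have -> : V x r.+2 + F' * (rr + 1 + 1) * (LL - (rr + 1 + 1)) +
   (V x r + F' * rr * (LL - rr)) - 2 * (V x r.+1 + F' * (rr + 1) * (LL - (rr + 1)))
   = V x r.+2 + V x r - 2 * V x r.+1 - 2 * F' by ring.
move=> b1 b2 b3 b4 b5.
lra.
Qed.
End MaximumPrinciple.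

Lemma antiperiodic_bound (R : realType) (T : zmodType) (n : nat) (v : 'I_n -> T)
    (j : 'I_n) (N : nat) (u : T -> R) (B F : R) :
  (forall x, `|u x| <= B) ->
  (forall x, u (x + v j *+ N.*2) = - u x) ->
  (forall x, `|discrete_laplacian v u x| <= F) ->
  forall x, `|u x| <= F * N%:R ^+ 2 / 2.
Proof.
move=> uB ua uF x; rewrite ler_norml; apply/andP; split; last first.
  exact: (antiperiodic_le uB ua uF).
rewrite lerNl.
apply: (@antiperiodic_le R T n v j N (fun y => - u y) B F) => y.
- by rewrite normrN.
- by rewrite ua.
- suff -> : discrete_laplacian v (fun y => - u y) y = - discrete_laplacian v u y.
    by rewrite normrN.
  rewrite /discrete_laplacian -sumrN; apply: eq_bigr => i _.
  by rewrite /second_diff; ring.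
Qed.

(** * Discrete Green functions on a finite group *)

Section DiscreteGreen.
Variables (R : realType) (T : finZmodType) (n : nat) (v : 'I_n -> T).
Variables (j : 'I_n) (N : nat).
Hypothesis v_order : v j *+ N.*2 *+ 2 = 0.
Local Notation a := (v j *+ N.*2).
Local Notation E := {ffun T -> R^o}.

Definition ffun_laplacian (g : E) : E := [ffun k => discrete_laplacian v g k].
Definition ffun_symmetrization (g : E) : E := [ffun k => g k + g (k + a)].

Lemma ffun_laplacian_is_linear : linear ffun_laplacian.
Proof.
move=> r g h; apply/ffunP => k; rewrite !ffunE /discrete_laplacian scaler_sumr.
rewrite -big_split; apply: eq_bigr => i _.
by rewrite /second_diff !ffunE /GRing.scale/=; ring.
Qed.
HB.instance Definition _ :=
  GRing.isLinear.Build R E E _ ffun_laplacian ffun_laplacian_is_linear.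

Lemma ffun_symmetrization_is_linear : linear ffun_symmetrization.
Proof.
move=> r g h; apply/ffunP => k; rewrite !ffunE /GRing.scale/=; ring.
Qed.
HB.instance Definition _ :=
  GRing.isLinear.Build R E E _ ffun_symmetrization ffun_symmetrization_is_linear.

(** The bound with [F = 0] makes the Laplacian injective on the subspace [U] of antiperiodic
    functions, which it preserves; finite dimension makes it surjective there. The point mass at 0
    is not in [U], but its antisymmetrization is. *)
Lemma discrete_green : exists c : T -> R,
  (forall k, c (k + a) = - c k) /\
  (forall k, discrete_laplacian v c k = (k == 0)%:R - (k == a)%:R).
Proof.
pose L : 'End(E) := linfun ffun_laplacian.
pose U : {vspace E} := lker (linfun ffun_symmetrization).
have UE (g : E) : reflect (forall k, g (k + a) = - g k) (g \in U).
  rewrite memv_ker lfunE /=; apply: (iffP eqP) => [/ffunP h k|h].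
    by have := h k; rewrite !ffunE => /eqP; rewrite addrC addr_eq0 => /eqP.
  by apply/ffunP => k; rewrite !ffunE h subrr.
have LU : (L @: U <= U)%VS.
  apply/subvP => _ /memv_imgP[g /UE gU ->]; apply/UE => k.
  rewrite lfunE /= !ffunE /discrete_laplacian -sumrN; apply: eq_bigr => i _.
  by rewrite /second_diff 2![k + a + _]addrAC !gU; ring.
have kerL : (U :&: lker L = 0)%VS.
  apply/eqP; rewrite -subv0; apply/subvP => g.
  rewrite memv_cap => /andP[/UE gU].
  rewrite memv_ker lfunE /= => /eqP/ffunP gL.
  rewrite memv0; apply/eqP/ffunP => k; rewrite ffunE; apply/eqP.
  rewrite -normr_le0.
  have gB x : `|g x| <= \sum_k `|g k| by rewrite (bigD1 x) //= lerDl sumr_ge0.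
  have gL0 x : `|discrete_laplacian v g x| <= 0.
    by have := gL x; rewrite !ffunE => ->; rewrite normr0.
  have := antiperiodic_bound gB gU gL0 k; rewrite !mul0r => h; exact: h.
have LUE : (L @: U)%VS = U.
  by apply/eqP; rewrite eqEdim LU limg_dim_eq //=.
have aa : a + a = 0 by rewrite -mulr2n.
pose d : E := [ffun k => (k == 0)%:R - (k == a)%:R].
have : d \in U.
  have aN : - a = a by apply/eqP; rewrite eq_sym -addr_eq0 aa.
  apply/UE => k; rewrite !ffunE addr_eq0 aN -(subr_eq0 (k + a)) addrK.
  by rewrite opprB.
rewrite -LUE => /memv_imgP[c cU dE]; exists c; split; first exact/UE.
by move=> k; have /ffunP/(_ k) := dE; rewrite lfunE /= !ffunE => <-.
Qed.
End DiscreteGreen.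

(** * Smooth functions on R^8 *)

Section Smooth.
Variables (R : realType) (V : normedModType R).
Local Notation E := 'rV[R]_8.
Local Notation e_ i := (delta_mx 0 i : 'rV[R]_8).
Implicit Types (f g : E -> V) (i : 'I_8) (x : E).

(** [smooth] is the largest predicate that implies differentiability and is stable under partial
    derivatives. Closure properties are proved by exhibiting such a predicate, without induction on
    the list of directions. *)
Lemma smooth_coind (P : (E -> V) -> Prop) :
  (forall f, P f -> (forall x, differentiable f x) /\ forall i, P (partial i f)) ->
  forall f, P f -> smooth f.
Proof.
move=> PP f Pf s x; suff : P (foldr (@partial R V) f s) by move=> /PP[].
by elim: s => [//|i s /PP[_ h]]; exact: h.
Qed.

Lemma smooth_differentiable f x : smooth f -> differentiable f x.
Proof. exact: (fun h => h [::] x). Qed.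

Lemma smooth_partial f i : smooth f -> smooth (partial i f).
Proof. by move=> sf s x; rewrite -[partial i f]/(foldr _ f [:: i]) -foldr_cat. Qed.

Lemma smooth_partial_differentiable f i x : smooth f -> differentiable (partial i f) x.
Proof. by move=> sf; exact/smooth_differentiable/smooth_partial. Qed.

Lemma partialD f g i x : differentiable f x -> differentiable g x ->
  partial i (fun y => f y + g y) x = partial i f x + partial i g x.
Proof. by move=> df dg; rewrite /partial deriveD//; exact: diff_derivable. Qed.

Lemma partialZ (k : R) f i x : differentiable f x ->
  partial i (fun y => k *: f y) x = k *: partial i f x.
Proof. by move=> df; rewrite /partial deriveZ//; exact: diff_derivable. Qed.

Lemma smoothD f g : smooth f -> smooth g -> smooth (fun x => f x + g x).
Proof.
move=> sf sg; pose P (h : E -> V) := exists f g, [/\ smooth f, smooth g & h = (fun x => f x + g x)].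
apply: (@smooth_coind P); last by exists f, g.
move=> _ [f' [g' [sf' sg' ->]]]; split=> [x|i].
  by apply: differentiableD; exact: smooth_differentiable.
exists (partial i f'), (partial i g'); split; [exact: smooth_partial..|].
by apply/funext => x; rewrite partialD//; exact: smooth_differentiable.
Qed.

Lemma smoothZ (k : R) f : smooth f -> smooth (fun x => k *: f x).
Proof.
move=> sf; pose P (h : E -> V) := exists2 f, smooth f & h = (fun x => k *: f x).
apply: (@smooth_coind P); last by exists f.
move=> _ [f' sf' ->]; split=> [x|i].
  by apply: differentiableZ; exact: smooth_differentiable.
exists (partial i f'); first exact: smooth_partial.
by apply/funext => x; rewrite partialZ//; exact: smooth_differentiable.
Qed.

Lemma partial_cst (c : V) i : partial i (fun=> c) = (fun=> 0).
Proof. by apply/funext => x; rewrite /partial derive_cst. Qed.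

Lemma smooth_cst (c : V) : smooth (fun=> c : V).
Proof.
apply: (@smooth_coind (fun h => exists c, h = (fun=> c))); last by exists c.
move=> _ [c' ->]; split=> [x|i]; first exact: differentiable_cst.
by exists 0; exact: partial_cst.
Qed.

Lemma smooth_sum (I : Type) (r : seq I) (P : pred I) (F : I -> E -> V) :
  (forall k, P k -> smooth (F k)) -> smooth (fun x => \sum_(k <- r | P k) F k x).
Proof.
move=> sF; elim: r => [|k r IH].
  by under eq_fun do rewrite big_nil; exact: smooth_cst.
case Pk : (P k); under eq_fun do rewrite big_cons Pk; last by [].
by apply: smoothD => //; exact: sF.
Qed.

Lemma partial_sum (I : Type) (r : seq I) (P : pred I) (F : I -> E -> V) i x :
  (forall k, P k -> smooth (F k)) ->
  partial i (fun y => \sum_(k <- r | P k) F k y) x = \sum_(k <- r | P k) partial i (F k) x.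
Proof.
move=> sF; elim: r => [|k r IH].
  by under eq_fun do rewrite big_nil; rewrite partial_cst big_nil.
rewrite big_cons; case Pk : (P k); under eq_fun do rewrite big_cons Pk; last by [].
rewrite partialD ?IH//; apply: smooth_differentiable; first exact: sF.
exact: smooth_sum.
Qed.

Lemma partial_shift f (a : E) i x :
  partial i (fun y => f (y + a)) x = partial i f (x + a).
Proof.
rewrite /partial /derive /=.
by under eq_fun do rewrite -addrA.
Qed.

Lemma differentiable_shift f (a x : E) :
  differentiable f (x + a) -> differentiable (fun y => f (y + a)) x.
Proof.
move=> df; exact: (@differentiable_comp _ _ _ _ (fun y => y + a) f).
Qed.

Lemma smooth_shift f (a : E) : smooth f -> smooth (fun y => f (y + a)).
Proof.
move=> sf; pose P (h : E -> V) := exists2 f, smooth f & h = (fun x => f (x + a)).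
apply: (@smooth_coind P); last by exists f.
move=> _ [f' sf' ->]; split=> [x|i].
  by apply: differentiable_shift; exact: smooth_differentiable.
exists (partial i f'); first exact: smooth_partial.
by apply/funext => x; rewrite partial_shift.
Qed.

Lemma derive_partial f (v x : E) : differentiable f x ->
  'D_v f x = \sum_(i < 8) v 0 i *: partial i f x.
Proof.
move=> df; rewrite deriveE// [in LHS](row_sum_delta v) linear_sum.
by apply: eq_bigr => i _; rewrite linearZ /= /partial deriveE.
Qed.

Lemma is_derive_line f (x v : E) (t : R) : differentiable f (x + t *: v) ->
  is_derive t 1 (fun s : R => f (x + s *: v)) ('D_v f (x + t *: v)).
Proof.
move=> df; have := diff_derivable (v := v) df => dv.
have E1 : (fun h : R => h^-1 *: (f (x + (h *: (1 : R) + t) *: v) - f (x + t *: v)))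
   = (fun h : R => h^-1 *: (f (h *: v + (x + t *: v)) - f (x + t *: v))).
  apply/funext => h; congr (_ *: (f _ - _)).
  by rewrite scalerDl /GRing.scale/= mulr1 addrCA.
split; first by rewrite /derivable /= E1.
by rewrite /derive /= E1.
Qed.
End Smooth.

(** * Mean values and second differences *)

Section ScalarCalculus.
Variable R : realType.
Local Notation E := 'rV[R]_8.
Local Notation e_ i := (delta_mx 0 i : 'rV[R]_8).
Implicit Types (f g : E -> R^o) (i j : 'I_8) (x v : E).

Lemma MVT0 (p dp : R -> R) (h : R) : 0 <= h ->
  (forall t, is_derive t (1 : R) (p : R -> R^o) (dp t)) ->
  exists2 c, 0 <= c <= h & p h - p 0 = h * dp c.
Proof.
move=> h0 dpP.
have cp : {within `[0, h], continuous p}.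
  by apply: derivable_within_continuous => t _; exact: (@ex_derive _ _ _ _ _ _ _ (dpP t)).
have [c] := MVT_segment h0 (fun t _ => dpP t) cp.
by rewrite in_itv /= subr0 => ch ->; exists c => //; rewrite mulrC.
Qed.

Lemma mean_value f x v : (forall y, differentiable f y) ->
  exists2 c : R, 0 <= c <= 1 & f (x + v) - f x = 'D_v f (x + c *: v).
Proof.
move=> df.
have [c c01] := @MVT0 (fun t => f (x + t *: v)) (fun t => 'D_v f (x + t *: v)) 1 ler01
  (fun t => is_derive_line (df _)).
by rewrite scale1r scale0r addr0 mul1r => fE; exists c.
Qed.

Lemma partial_line_is_derive f i x (t : R) : differentiable f (x + t *: e_ i) ->
  is_derive t (1 : R) (fun s => f (x + s *: e_ i)) (partial i f (x + t *: e_ i)).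
Proof. exact: is_derive_line. Qed.

Lemma partial_lineN_is_derive f i x (t : R) : differentiable f (x - t *: e_ i) ->
  is_derive t (1 : R) (fun s => f (x - s *: e_ i)) (- partial i f (x - t *: e_ i)).
Proof.
move=> df.
have E1 (s : R) : x - s *: e_ i = x + s *: (- e_ i) by rewrite scalerN.
rewrite (_ : (fun s => _) = (fun s => f (x + s *: (- e_ i)))); last first.
  by apply/funext => s; rewrite E1.
have -> : - partial i f (x - t *: e_ i) = 'D_(- e_ i) f (x + t *: (- e_ i)).
  by rewrite E1 /partial !deriveE -?E1// linearN.
by apply: is_derive_line; rewrite -E1.
Qed.

Lemma taylor_algebra (F1 F2 F0 G1 G2 H1 H2 H0 K1 K2 h c b M : R) :
  0 <= c -> c <= h -> 0 <= b -> b <= c ->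
  F1 + F2 - h ^+ 2 * H0 - (F0 + F0) = h * (G1 - G2 - 2 * c * H0) ->
  G1 - G2 - 2 * c * H0 = c * (H1 - - H2 - 2 * H0) ->
  H1 - H0 = b * K1 -> H2 - H0 = b * - K2 -> `|K1| <= M -> `|K2| <= M ->
  `|F1 + F2 - 2 * F0 - h ^+ 2 * H0| <= 2 * M * h ^+ 3.
Proof.
move=> c0 ch b0 bc E1 E2 E3 E4 KM1 KM2.
have -> : F1 + F2 - 2 * F0 - h ^+ 2 * H0 = h * (c * (b * (K1 - K2))).
  have -> : b * (K1 - K2) = H1 - - H2 - 2 * H0 by lra.
  by rewrite -E2 -E1; ring.
have h0 := le_trans c0 ch.
rewrite !normrM (ger0_norm h0) (ger0_norm c0) (ger0_norm b0).
have -> : 2 * M * h ^+ 3 = h * (h * (h * (M + M))) by ring.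
have M0 : 0 <= M by exact: le_trans (normr_ge0 _) KM1.
apply: ler_wpM2l => //; apply: ler_pM => //; first by rewrite mulr_ge0.
apply: ler_pM => //; first exact: le_trans bc ch.
by rewrite (le_trans (ler_normB _ _))// lerD.
Qed.

(** The remainder, as a function of [h], vanishes at 0 together with its first derivative. Mean
    values at [h], then [c <= h], then for the second derivative at [b <= c], extract the factors
    [h], [c] and [b] and leave a difference of two third derivatives. *)
Lemma second_diff_estimate f i x (h M : R) : smooth f -> 0 <= h ->
  (forall y, `|partial i (partial i (partial i f)) y| <= M) ->
  `|f (x + h *: e_ i) + f (x - h *: e_ i) - 2 * f x - h ^+ 2 * partial i (partial i f) x|
  <= 2 * M * h ^+ 3.
Proof.
move=> sf h0 fM.
pose f1 := partial i f; pose f2 := partial i f1; pose f3 := partial i f2.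
have d0 y : differentiable f y by exact: smooth_differentiable.
have d1 y : differentiable f1 y by exact: smooth_partial_differentiable.
have sf1 : smooth f1 by exact: smooth_partial.
have d2 y : differentiable f2 y by exact: smooth_partial_differentiable.
have sq t : is_derive t (1 : R) (fun s : R => s ^+ 2 * f2 x) (2 * t * f2 x).
  have -> : (fun s : R => s ^+ 2 * f2 x) = (f2 x) \*: ((fun s : R => s) ^+ 2).
    by apply/funext => s /=; rewrite mulrC.
  by apply: is_derive_eq; rewrite /GRing.scale /=; ring.
have [c /andP[c0 ch]] := @MVT0
  (fun t => f (x + t *: e_ i) + f (x - t *: e_ i) - t ^+ 2 * f2 x)
  (fun t => f1 (x + t *: e_ i) - f1 (x - t *: e_ i) - 2 * t * f2 x) h h0
  (fun t => is_deriveB (is_deriveD (partial_line_is_derive (d0 _))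
     (partial_lineN_is_derive (d0 _))) (sq t)).
have li t : is_derive t (1 : R) (fun s : R => 2 * s * f2 x) (2 * f2 x).
  have -> : (fun s : R => 2 * s * f2 x) = (2 * f2 x) \*: (fun s : R => s).
    by apply/funext => s /=; rewrite mulrAC.
  by apply: is_derive_eq; rewrite /GRing.scale /=; ring.
have [b /andP[b0 bc]] := @MVT0
  (fun t => f1 (x + t *: e_ i) - f1 (x - t *: e_ i) - 2 * t * f2 x)
  (fun t => f2 (x + t *: e_ i) - - f2 (x - t *: e_ i) - 2 * f2 x) c c0
  (fun t => is_deriveB (is_deriveB (partial_line_is_derive (d1 _))
     (partial_lineN_is_derive (d1 _))) (li t)).
rewrite !scale0r !subr0 !addr0 !expr0n /= !mulr0 !mul0r !subr0 subrr subr0.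
move=> E2 E1.
have [a1 /andP[a10 a1b]] := @MVT0 (fun t => f2 (x + t *: e_ i)) (fun t => f3 (x + t *: e_ i)) b b0
  (fun t => partial_line_is_derive (d2 _)).
have [a2 /andP[a20 a2b]] := @MVT0 (fun t => f2 (x - t *: e_ i)) (fun t => - f3 (x - t *: e_ i)) b b0
  (fun t => partial_lineN_is_derive (d2 _)).
rewrite !scale0r !addr0 !subr0 => E4 E3.
rewrite -/f1 -/f2.
exact: (taylor_algebra c0 ch b0 bc E1 E2 E3 E4 (fM _) (fM _)).
Qed.
End ScalarCalculus.

(** * Taylor estimates, differentiability and mixed derivatives *)

Section Taylor.
Variable R : realType.
Local Notation E := 'rV[R]_8.
Local Notation e_ i := (delta_mx 0 i : 'rV[R]_8).
Implicit Types (f g : E -> R^o) (i j : 'I_8) (x v : E).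

Lemma coord_le_norm v i : `|v 0 i| <= `|v|.
Proof.
rewrite [leRHS]/Num.Def.normr/= mx_normrE.
exact: (le_bigmax _ (fun ij : 'I_1 * 'I_8 => `|v ij.1 ij.2|) (0, i)).
Qed.

Lemma norm_delta_le1 i : `|e_ i| <= 1.
Proof.
rewrite [leLHS]/Num.Def.normr/= mx_normrE; apply: bigmax_le => // k _.
by rewrite mxE; case: andP => _; rewrite ?normr1 ?normr0.
Qed.

Lemma norm_sum_coord_le v (a : 'I_8 -> R) (B : R) :
  (forall i, `|a i| <= B) -> `|\sum_(i < 8) v 0 i * a i| <= 8 * B * `|v|.
Proof.
move=> aB; apply: le_trans (ler_norm_sum _ _ _) _.
have -> : 8 * B * `|v| = \sum_(i < 8) `|v| * B.
  by rewrite sumr_const card_ord mulr_natl mulrnAl mulrC.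
apply: ler_sum => i _; rewrite normrM.
by apply: ler_pM => //; exact: coord_le_norm.
Qed.

Lemma lipschitz_partial f x v (B : R) : (forall y, differentiable f y) ->
  (forall i y, `|partial i f y| <= B) -> `|f (x + v) - f x| <= 8 * B * `|v|.
Proof.
move=> df fB; have [c _ ->] := mean_value x v df.
by rewrite derive_partial//; apply: norm_sum_coord_le => i; exact: fB.
Qed.

Lemma taylor_estimate f x v (B : R) : smooth f ->
  (forall i j y, `|partial j (partial i f) y| <= B) ->
  `|f (x + v) - f x - \sum_(i < 8) v 0 i * partial i f x| <= 64 * B * `|v| ^+ 2.
Proof.
move=> sf fB; have df y : differentiable f y by exact: smooth_differentiable.
have B0 : 0 <= B by exact: le_trans (normr_ge0 _) (fB 0 0 0).
have [c /andP[c0 c1] ->] := mean_value x v df.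
rewrite derive_partial// -sumrB.
under eq_bigr => i _ do rewrite /GRing.scale/= -mulrBr.
have -> : 64 * B * `|v| ^+ 2 = 8 * (8 * B * `|v|) * `|v| by ring.
apply: norm_sum_coord_le => i.
apply: le_trans (lipschitz_partial _ _ _ (fB i)) _.
  by move=> y; exact: smooth_partial_differentiable.
rewrite normrZ ger0_norm// ler_wpM2l ?mulr_ge0//.
by rewrite ler_piMl.
Qed.

(** The criterion by which differentiability passes to limits: the inequality involves only values
    of [f] and candidates [L] for its derivatives, so it survives pointwise convergence. *)
Lemma differentiable_of_estimate f (L : 'I_8 -> R) x (C : R) :
  (forall v, `|f (x + v) - f x - \sum_(i < 8) v 0 i * L i| <= C * `|v| ^+ 2) ->
  differentiable f x /\ forall i, partial i f x = L i.
Proof.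
move=> fL.
pose df (v : E) : R^o := \sum_(i < 8) v 0 i * L i.
have dfl : linear df.
  move=> k u v; rewrite /df scaler_sumr -big_split /=; apply: eq_bigr => i _.
  by rewrite !mxE mulrDl -mulrA.
pose dfM := GRing.isLinear.Build _ _ _ _ df dfl.
pose dfL : {linear E -> R^o} := HB.pack df dfM.
have dfc : continuous dfL.
  rewrite (_ : (dfL : E -> R^o) = (fun v => \sum_(i < 8) v 0 i * L i))//.
  apply: continuous_big; first exact: add_continuous.
  move=> i _ v.
  apply: (@continuousM R _ (fun v : E => v 0 i) (fun=> L i)).
    exact: coord_continuous.
  exact: cst_continuous.
have C0 : 0 <= `|C| + 1 by rewrite addr_ge0.
have [dfx dE] : differentiable f x /\ 'd f x = dfL :> (E -> R^o).
  have exp : f \o shift x = cst (f x) + (dfL : E -> R^o) +o_ (0 : E) id.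
  apply/eqaddoP => _/posnumP[e]; near=> v.
  rewrite /= [X in `|X|](_ : _ = f (x + v) - f x - df v); last first.
    by rewrite (addrC x v) -addrA -opprD.
  apply: le_trans (fL v) _.
  rewrite expr2 mulrA ler_wpM2r//.
  have : `|v| <= e%:num / (`|C| + 1).
    near: v; apply: (@pseudometric_normed_Zmodule.nbhs0_le R E).
    by rewrite divr_gt0// ltr_wpDl.
  rewrite ler_pdivlMr ?ltr_wpDl// => h; apply: le_trans h; rewrite mulrC.
  apply: ler_wpM2l => //; apply: le_trans (ler_norm C) _.
  by rewrite lerDl.
  have dE := diff_unique dfc exp.
  by split=> //; apply/diff_locallyP; rewrite dE; split.
split=> // i; rewrite /partial deriveE// dE /= /df (bigD1 i) //= big1 ?addr0 => [|j ji].
  by rewrite mxE !eqxx mul1r.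
by rewrite mxE eqxx (negbTE ji) mul0r.
Unshelve. all: by end_near. Qed.

Lemma halves_dist (a b c e : R) :
  `|a - c| <= e / 2 -> `|b - c| <= e / 2 -> `|a - b| <= e.
Proof. by rewrite !ler_norml => /andP[? ?] /andP[? ?]; apply/andP; split; lra. Qed.

(** The mixed difference over a square of side [h] is symmetric in the two directions. Two mean
    values, taken in either order, express it as [h ^+ 2] times one or the other mixed derivative at
    a point within [2 h] of [x]; continuity does the rest. *)
Lemma partialC f i j x : smooth f ->
  partial i (partial j f) x = partial j (partial i f) x.
Proof.
move=> sf.
have df y : differentiable f y by exact: smooth_differentiable.
have key k l (h : R) : 0 <= h -> exists p : E, `|p - x| <= 2 * h /\
  f (x + h *: e_ k + h *: e_ l) - f (x + h *: e_ k) - f (x + h *: e_ l) + f x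
   = h * (h * partial l (partial k f) p).
  move=> h0.
  have E1 (t : R) := is_deriveB
     (partial_line_is_derive (f := f) (i := k) (x := x + h *: e_ l) (t := t) (df _))
     (partial_line_is_derive (f := f) (i := k) (x := x) (t := t) (df _)).
  have [c /andP[c0 ch]] := MVT0 (p := (fun t => f (x + h *: e_ l + t *: e_ k) - f (x + t *: e_ k)))
     h0 E1.
  have [b /andP[b0 bh]] := MVT0 h0 (fun t => partial_line_is_derive (f := partial k f) (i := l)
    (x := x + c *: e_ k) (t := t) (smooth_partial_differentiable _ _ sf)).
  rewrite !scale0r !addr0 => E2 E3.
  exists (x + c *: e_ k + b *: e_ l); split.
    have -> : x + c *: e_ k + b *: e_ l - x = c *: e_ k + b *: e_ l.
      by rewrite -!addrA addrC -!addrA addNr addr0.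
    rewrite mulr_natl mulr2n.
    have ne (a : R) m : 0 <= a -> a <= h -> `|a *: e_ m| <= h.
      move=> a0 ah; rewrite normrZ ger0_norm//.
      by rewrite (le_trans _ ah)// ler_piMr// norm_delta_le1.
    by rewrite (le_trans (ler_normD _ _)) // lerD// ne.
  rewrite -E2 (addrAC x (c *: e_ k)) -E3 (addrAC x (h *: e_ l)).
  by rewrite opprB addrA addrAC.
apply/eqP; rewrite -subr_eq0 -normr_le0; apply/ler_addgt0Pr => e e0; rewrite add0r.
have cA k l := differentiable_continuous
  (smooth_partial_differentiable l x (smooth_partial k sf)).
have /cvgrPdist_le/(_ _ (divr_gt0 e0 (ltr0n _ 2))) := cA j i.
have /cvgrPdist_le/(_ _ (divr_gt0 e0 (ltr0n _ 2))) := cA i j.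
move=> /nbhs_normP[r1 /= r10 r1P] /nbhs_normP[r2 /= r20 r2P].
pose h := Num.min r1 r2 / 4.
have h0 : 0 < h by rewrite divr_gt0// lt_min r10.
have hr : 2 * h < Num.min r1 r2.
  have : 0 < Num.min r1 r2 by rewrite lt_min r10.
  by rewrite /h; move: (Num.min r1 r2) => r; clear; lra.
have [p [px pE]] := key i j h (ltW h0).
have [q [qx qE]] := key j i h (ltW h0).
have AB : partial j (partial i f) p = partial i (partial j f) q.
  have EE : h * (h * (partial j (partial i f) p : R)) = h * (h * (partial i (partial j f) q : R)).
    apply: etrans (esym pE) (etrans _ qE); rewrite (addrAC x (h *: e_ j)).
    by congr (_ + _); exact: addrAC.
  exact: (mulfI (lt0r_neq0 h0) (mulfI (lt0r_neq0 h0) EE)).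
move: hr; rewrite lt_min => /andP[hr1 hr2].
have P1 : `|x - p| < r1 by rewrite distrC (le_lt_trans px).
have P2 : `|x - q| < r2 by rewrite distrC (le_lt_trans qx).
have := r1P _ P1; have := r2P _ P2; rewrite /= AB => l1 l2.
exact: (halves_dist l1 l2).
Qed.
End Taylor.

(** * Functions of period 2 *)

Section Periodic.
Variable R : realType.
Local Notation E := 'rV[R]_8.
Local Notation e_ i := (delta_mx 0 i : 'rV[R]_8).

Definition periodic2 (V : Type) (f : E -> V) : Prop :=
  forall i x, f (x + 2 *: e_ i) = f x.

Lemma periodic2_int (V : Type) (f : E -> V) i (z : int) x : periodic2 f ->
  f (x + (2 * z%:~R) *: e_ i) = f x.
Proof.
move=> pf; have nat_case (n : nat) y : f (y + (2 * n%:R) *: e_ i) = f y.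
  elim: n y => [|n IH] y; first by rewrite mulr0 scale0r addr0.
  by rewrite -(natr1 n) mulrDr mulr1 scalerDl addrA pf IH.
case: z => n; first exact: nat_case.
by rewrite -[in RHS](subrK ((2 * n.+1%:R) *: e_ i) x) nat_case NegzE mulrNz mulrN scaleNr.
Qed.

Lemma periodic2_lattice (V : Type) (f : E -> V) (z : 'I_8 -> int) (s : seq 'I_8) x :
  periodic2 f -> f (x + \sum_(i <- s) (2 * (z i)%:~R) *: e_ i) = f x.
Proof.
move=> pf; elim: s x => [|i s IH] x; first by rewrite big_nil addr0.
by rewrite big_cons addrA IH periodic2_int.
Qed.

Lemma periodic2_bounded (f : E -> R^o) : continuous f -> periodic2 f ->
  exists B : R, forall x, `|f x| <= B.
Proof.
move=> cf pf.
pose A := [set v : E | forall i, `[(0 : R), 2]%classic (v 0 i)].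
have cA : compact A by apply: (@rV_compact _ _ (fun=> _)) => i; exact: segment_compact.
have A0 : A !=set0 by exists 0 => i /=; rewrite mxE in_itv /= lexx ler0n.
have [|c cAc cmax] := @EVT_max_rV R 8 (fun x => `|f x|) A A0 cA.
  apply: continuous_subspaceT => x.
  by apply: continuous_comp; [exact: cf|exact: norm_continuous].
exists `|f c| => x.
pose z i := - Num.floor (x 0 i / 2).
rewrite -(@periodic2_lattice _ f z (index_enum 'I_8) x pf).
apply: cmax; rewrite inE => i /=.
have -> : (x + \sum_i0 (2 * (z i0)%:~R) *: e_ i0) 0 i = x 0 i + 2 * (z i)%:~R.
  rewrite mxE summxE (bigD1 i) //= big1 ?addr0 => [|k ki].
    by rewrite !mxE !eqxx mulr1.
  by rewrite !mxE eq_sym (negbTE ki) andbF mulr0.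
have := floor_itv (x 0 i / 2); rewrite /z in_itv /= mulrNz.
rewrite intrD => /andP[h1 h2]; apply/andP; split.
  by move: h1 h2; move: (Num.floor _)%:~R => t; clear; lra.
by move: h1 h2; move: (Num.floor _)%:~R => t; clear; lra.
Qed.
End Periodic.

Section SmoothMatrix.
Variables (R : realType) (m n : nat).
Local Notation E := 'rV[R]_8.
Implicit Types f : E -> 'M[R]_(m, n).

Lemma differentiable_mxP f x :
  differentiable f x <-> forall a b, differentiable (fun y => f y a b : R^o) x.
Proof.
split=> [df a b|df].
  apply: (@differentiable_comp R E 'M[R]_(m, n) R^o f (fun M => M a b)) => //.
  exact: differentiable_coord.
have -> : f = \sum_(p : 'I_m * 'I_n) (fun y => f y p.1 p.2 *: (delta_mx p.1 p.2 : 'M[R]_(m, n))).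
  apply/funext => y; rewrite fct_sumE [LHS]matrix_sum_delta.
  by rewrite pair_bigA.
elim/big_ind : _ => [|g h dg dh|p _]; first exact: differentiable_cst.
  exact: differentiableD.
apply: differentiableZl; exact: df.
Qed.

Lemma partial_mx f i x a b : differentiable f x ->
  partial i f x a b = partial i (fun y => f y a b : R^o) x.
Proof.
by move=> df; rewrite /partial derive_mx ?mxE//; exact: diff_derivable.
Qed.

Lemma smooth_mxP f : smooth f <-> forall a b, smooth (fun y => f y a b : R^o).
Proof.
split=> [sf a b|sf].
  pose P (h : E -> R^o) := exists2 f : E -> 'M[R]_(m, n), smooth f & h = (fun y => f y a b : R^o).
  apply: (@smooth_coind R R^o P).
    move=> _ [f' sf' ->]; split=> [x|i].
      by have /differentiable_mxP := smooth_differentiable x sf'; exact.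
    exists (partial i f'); first exact: smooth_partial.
    by apply/funext => x; rewrite partial_mx//; exact: smooth_differentiable.
  by exists f.
pose P f := forall a b, smooth (fun y => f y a b : R^o).
apply: (@smooth_coind R 'M[R]_(m, n) P) => // g sg.
have dg x : differentiable g x.
  by apply/differentiable_mxP => a b; exact: smooth_differentiable.
split=> // i a b.
have -> : (fun y => partial i g y a b) = partial i (fun y => g y a b : R^o).
  by apply/funext => x; rewrite partial_mx.
exact: smooth_partial.
Qed.
End SmoothMatrix.

(** * The Poisson equation *)

Lemma Zp_val_addb (p : nat) (a : 'Z_p) (b : bool) : (1 < p)%N ->
  nat_of_ord (a + b%:R) = ((nat_of_ord a + b) %% p)%N.
Proof. by case: p a => [|[|p]] //= a _; case: b => //=; rewrite modn_small ?addn0. Qed.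

(** * Inverting the lattice Laplacian by translations *)

Section LatticeGreen.
Variable R : realType.
Local Notation E := 'rV[R]_8.
Local Notation e_ i := (delta_mx 0 i : 'rV[R]_8).

Definition antiperiodic (j : 'I_8) (f : E -> R^o) : Prop := forall x, f (x + e_ j) = - f x.

(** An even number of steps per antiperiod lets the barrier [r (2 N - r)] peak at the integer
    [N]. *)
Definition mesh (N : nat) : R := (N.*2)%:R^-1.
Definition lattice_laplacian (N : nat) : (E -> R) -> E -> R :=
  discrete_laplacian (fun i => mesh N *: e_ i).

(** For any weights, such operators commute with derivatives and preserve smoothness, periodicity
    and antiperiodicity. *)
Definition translates (K : finType) (w : K -> R) (t : K -> E) (f : E -> R^o) : E -> R^o :=
  fun x => \sum_(k : K) w k *: f (x + t k).

Section Grid.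
Variables (N : nat) (N_gt0 : (0 < N)%N).
Local Notation Nx := N.*2.*2.
Local Notation T := 'rV['Z_Nx]_8.
Local Notation v i := (delta_mx 0 i : 'rV['Z_Nx]_8).

(** The representatives lie in [[0, 2)]: [4 N] steps of length [1 / (2 N)] fill the period 2, that
    is, two antiperiods. *)
Definition grid_point (k : T) : E := \row_i (mesh N * (k 0 i : nat)%:R).

Lemma grid_size : (Zp_trunc Nx).+2 = Nx.
Proof. by rewrite Zp_cast //; lia. Qed.

Lemma mesh_double : mesh N * (N.*2)%:R = 1.
Proof. by rewrite mulVf// pnatr_eq0; lia. Qed.

Lemma mesh_step_double i : (mesh N *: e_ i) *+ N.*2 = e_ i.
Proof. by rewrite scalerMnl -mulr_natr mesh_double scale1r. Qed.

Lemma grid_delta_mulrn i k l : (v i *+ k) 0 l = if l == i then k%:R else 0.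
Proof. by rewrite mulmxnE mxE eqxx /=; case: eqP => //= _; rewrite mul0rn. Qed.

Lemma grid_order j : v j *+ N.*2 *+ 2 = 0.
Proof.
apply/rowP => l; rewrite -mulrnA mxE grid_delta_mulrn; case: eqP => // _.
rewrite muln2; apply/val_inj; rewrite /= val_Zp_nat ?modnn//; lia.
Qed.

Lemma grid_point_half j : grid_point (v j *+ N.*2) = e_ j.
Proof.
apply/rowP => l; rewrite !mxE grid_delta_mulrn eqxx /= ; case: eqP => _; last by rewrite mulr0.
rewrite val_Zp_nat ?modn_small ?mesh_double//; lia.
Qed.

Lemma grid_point0 : grid_point 0 = 0.
Proof. by apply/rowP => l; rewrite !mxE mulr0. Qed.

(** [grid_point] is additive only modulo 2. When the coordinate [i] wraps around, the two sides
    differ by [2 e_i], which periodicity absorbs. *)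
Lemma grid_pointD (f : E -> R^o) k i x : periodic2 f ->
  f (x - grid_point (k + v i)) = f (x - grid_point k - mesh N *: e_ i).
Proof.
move=> pf.
have kv l : nat_of_ord ((k + v i) 0 l) = ((nat_of_ord (k 0%R l) + (l == i)) %% Nx)%N.
  by rewrite mxE [X in _ + X]mxE eqxx andTb Zp_val_addb //; lia.
have kN l : (nat_of_ord (k 0%R l) < Nx)%N by have := ltn_ord (k 0 l); rewrite {2}grid_size.
have [lt|ge] := ltnP (nat_of_ord (k 0%R i) + 1)%N Nx.
  congr f; rewrite -addrA -opprD; congr (_ - _).
  apply/rowP => l; rewrite mxE kv !mxE eqxx /=; case: (l =P i) => [->|_] /=.
    by rewrite mulr1 modn_small// natrD mulrDr mulr1.
  by rewrite addn0 mulr0 addr0 modn_small.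
have kE : nat_of_ord (k 0 i) = Nx.-1 by have := kN i; lia.
rewrite -[RHS](pf i); congr f; rewrite -!addrA; congr (_ + _).
apply/rowP => l; rewrite !(mxE, kv) eqxx /=; case: (l =P i) => [->|_] /=.
  rewrite !mulr1 kE; have -> : (Nx.-1 + 1 = Nx)%N by lia.
  rewrite modnn mulr0 oppr0.
  have -> : (Nx.-1)%:R = (N.*2)%:R + (N.*2)%:R - 1 :> R.
    by apply/eqP; rewrite eq_sym subr_eq natr1 -natrD; apply/eqP; congr (_%:R); lia.
  by have := mesh_double; move: (mesh N) (N.*2)%:R => a b ab; nra.
by rewrite addn0 !mulr0 oppr0 !addr0 modn_small.
Qed.

(** Convolution with the discrete Green function: reindexing the sum moves the Laplacian from [f] to
    [c], and the two point masses leave [f x - f (x - e_j) = 2 f x], whence the factor 1/2 in the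
    weights. The factor [mesh N ^+ 2] compensates for second differences that are not divided by the
    squared step. *)
Lemma lattice_green (j : 'I_8) : exists (K : finType) (w : K -> R) (t : K -> E),
  forall f, periodic2 f -> antiperiodic j f ->
  forall x, lattice_laplacian N (translates w t f) x = mesh N ^+ 2 * f x.
Proof.
have [c [_ cP]] := @discrete_green R T 8 (fun i => v i) j N (grid_order j).
exists T, (fun k => mesh N ^+ 2 / 2 * c k), (fun k => - grid_point k).
move=> f pf af x.
have up i : \sum_(k : T) c k * f (x + mesh N *: e_ i - grid_point k) =
            \sum_(k : T) c (k + v i) * f (x - grid_point k).
  rewrite (reindex_inj (addIr (v i))); apply: eq_bigr => k _; congr (_ * _).
  by rewrite grid_pointD // addrAC addrK.
have down i : \sum_(k : T) c k * f (x - mesh N *: e_ i - grid_point k) =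
            \sum_(k : T) c (k - v i) * f (x - grid_point k).
  rewrite [RHS](reindex_inj (addIr (v i))); apply: eq_bigr => k _; rewrite addrK; congr (_ * _).
  by rewrite grid_pointD // addrAC.
have UE y : translates (fun k : T => mesh N ^+ 2 / 2 * c k) (fun k => - grid_point k) f y
   = mesh N ^+ 2 / 2 * (\sum_(k : T) c k * f (y - grid_point k) : R).
  by rewrite /translates mulr_sumr; apply: eq_bigr => k _; rewrite mulrA.
have dirac (b : T) : \sum_(k : T) ((k == b)%:R : R) * (f (x - grid_point k) : R) = f (x - grid_point b).
  rewrite (bigD1 b) //= eqxx mul1r big1 ?addr0 // => k /negbTE ->.
  by rewrite mul0r.
rewrite /lattice_laplacian /discrete_laplacian.
transitivity (mesh N ^+ 2 / 2 * \sum_(k : T) discrete_laplacian (fun i => v i) c k * (f (x - grid_point k) : R)).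
  rewrite /discrete_laplacian.
  under [in RHS]eq_bigr do rewrite mulr_suml.
  rewrite exchange_big mulr_sumr; apply: eq_bigr => i _.
  rewrite /second_diff !UE up down mulrCA -!mulrDr -mulrBr; congr (_ * _).
  rewrite mulr_sumr -big_split -sumrB /=; apply: eq_bigr => k _.
  by rewrite [RHS]mulrBl -(mulrA 2) (mulrDl (c _)).
under eq_bigr do rewrite cP mulrBl.
rewrite sumrB !dirac grid_point0 grid_point_half subr0.
have -> : f (x - e_ j) = - f x by rewrite -[in RHS](subrK (e_ j) x) af opprK.
by move: (f x : R) => y; rewrite opprK; field.
Qed.
End Grid.
End LatticeGreen.

Section Limits.
Variable R : realType.

(** The limit is the supremum of the lower bounds [a n - C / (n + 1)]. The explicit rate, with [C]
    unchanged, makes limits of functions uniform in the point. *)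
Lemma inv_succ_limit (a : nat -> R) (C : R) :
  (forall n m, `|a n - a m| <= C * (n.+1%:R^-1 + m.+1%:R^-1)) ->
  exists l, forall n, `|a n - l| <= C * n.+1%:R^-1.
Proof.
move=> aC; pose S := range (fun n => a n - C * n.+1%:R^-1).
have ub m : ubound S (a m + C * m.+1%:R^-1).
  move=> _ [n _ <-] /=; have := aC n m.
  rewrite ler_norml mulrDr => /andP[_].
  by move: (C * _) (C * _) => p q; lra.
have S0 : S !=set0 by exists (a 0%N - C * 1%:R^-1), 0%N.
exists (sup S) => n.
have l1 := ge_sup S0 (ub n).
have l2 : a n - C * n.+1%:R^-1 <= sup S.
  by apply: ub_le_sup; [exists (a 0%N + C * 1%:R^-1); exact: ub | exists n].
move: l1 l2; move: (C * _) (sup S) (a n) => p q r.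
by rewrite ler_norml => l1 l2; apply/andP; split; lra.
Qed.

Lemma le_of_inv_succ (a b K : R) :
  (forall n : nat, a <= b + K * n.+1%:R^-1) -> a <= b.
Proof.
move=> h; have K0 : 0 < `|K| + 1 by rewrite ltr_wpDl.
apply/ler_addgt0Pr => e e0.
pose n := Num.bound ((`|K| + 1) / e).
have ne : (`|K| + 1) / e < n%:R by apply: archi_boundP; exact: ltW (divr_gt0 K0 e0).
apply: le_trans (h n) _; rewrite lerD2l.
rewrite ler_pdivrMr ?ltr0n//.
have : `|K| + 1 <= e * n%:R by rewrite -ler_pdivrMl // mulrC ltW.
have := ler_norm K; rewrite -(natr1 n) mulrDr mulr1; lra.
Qed.

Lemma bounded_family (I : finType) (T : Type) (f : I -> T -> R) :
  (forall i, exists B, forall x, `|f i x| <= B) ->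
  exists B, 0 <= B /\ forall i x, `|f i x| <= B.
Proof.
move=> /choice[B fB]; exists (\sum_i `|B i|); split; first exact: sumr_ge0.
move=> i x; apply: le_trans (fB i x) _; apply: le_trans (ler_norm _) _.
by rewrite (bigD1 i) //= lerDl sumr_ge0.
Qed.
End Limits.

(** * Stability and consistency of the lattice Laplacian *)

Section Poisson.
Variable R : realType.
Local Notation E := 'rV[R]_8.
Local Notation e_ i := (delta_mx 0 i : 'rV[R]_8).

Definition laplacian (V : normedModType R) (f : E -> V) (x : E) : V :=
  \sum_(i < 8) partial i (partial i f) x.

Lemma periodic2_partial (V : normedModType R) (f : E -> V) i :
  periodic2 f -> periodic2 (partial i f).
Proof.
move=> pf j x; rewrite -partial_shift.
by congr (partial i _ x); apply/funext => y; exact: pf.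
Qed.

Lemma antiperiodic_partial j (f : E -> R^o) i : (forall x, differentiable f x) ->
  antiperiodic j f -> antiperiodic j (partial i f).
Proof.
move=> df af x; rewrite -partial_shift.
have -> : (fun y => f (y + e_ j)) = (fun y => (-1) *: f y).
  by apply/funext => y; rewrite scaleN1r; exact: af.
by rewrite partialZ // scaleN1r.
Qed.

Definition twisted (j : 'I_8) (f : E -> R^o) : Prop :=
  [/\ smooth f, periodic2 f & antiperiodic j f].

Lemma twisted_partial j f i : twisted j f -> twisted j (partial i f).
Proof.
case=> sf pf af; split; [exact: smooth_partial|exact: periodic2_partial|].
by apply: antiperiodic_partial => // x; exact: smooth_differentiable.
Qed.

Lemma twisted_bounded j f : twisted j f -> exists B : R, forall x, `|f x| <= B.
Proof.
case=> sf pf _; apply: periodic2_bounded => // x.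
exact: differentiable_continuous (smooth_differentiable x sf).
Qed.

Section Translates.
Variables (K : finType) (w : K -> R) (t : K -> E).
Local Notation U := (translates w t).

Lemma twisted_translates j f : twisted j f -> twisted j (U f).
Proof.
case=> sf pf af; split.
- by apply: smooth_sum => k _; apply: smoothZ; exact: smooth_shift.
- by move=> i x; apply: eq_bigr => k _; rewrite addrAC pf.
- move=> x; rewrite /translates -sumrN; apply: eq_bigr => k _.
  by rewrite addrAC af scalerN.
Qed.

Lemma partial_translates f i : smooth f -> partial i (U f) = U (partial i f).
Proof.
move=> sf; apply/funext => x; rewrite /translates partial_sum; last first.
  by move=> k _; apply: smoothZ; exact: smooth_shift.
apply: eq_bigr => k _; rewrite partialZ ?partial_shift//.
exact/smooth_differentiable/smooth_shift.
Qed.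
End Translates.

Lemma mesh_gt0 n : 0 < mesh R n.+1.
Proof. by rewrite invr_gt0 ltr0n. Qed.

Lemma mesh_succ n : mesh R n.+1 = n.+1%:R^-1 / 2.
Proof. by rewrite /mesh -muln2 natrM invfM. Qed.

(** The mesh cancels: [2 N h = 1] turns the bound [h ^+ 2 * F * N ^+ 2 / 2] into [F / 8]. *)
Lemma lattice_stability j n (g : E -> R^o) (F : R) : twisted j g ->
  (forall x, `|lattice_laplacian n.+1 g x| <= mesh R n.+1 ^+ 2 * F) ->
  forall x, `|g x| <= F / 8.
Proof.
move=> tg gF x; have [B gB] := twisted_bounded tg; case: tg => _ _ ag.
have anti y : (g : E -> R) (y + (mesh R n.+1 *: e_ j) *+ (n.+1).*2) = - g y.
  by rewrite mesh_step_double.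
apply: le_trans (antiperiodic_bound gB anti gF x) _.
have := @mesh_double R n.+1 isT; rewrite -muln2 natrM.
move: (mesh R n.+1) (n.+1%:R) => h N hN.
have -> : h ^+ 2 * F * N ^+ 2 / 2 = (h * (N * 2)) ^+ 2 * F / 8 by field.
by rewrite hN expr1n mul1r.
Qed.

Lemma lattice_consistency n (g : E -> R^o) (M : R) : smooth g ->
  (forall i x, `|partial i (partial i (partial i g)) x| <= M) ->
  forall x, `|lattice_laplacian n.+1 g x - mesh R n.+1 ^+ 2 * laplacian g x|
    <= 16 * M * mesh R n.+1 ^+ 3.
Proof.
move=> sg gM x; rewrite /lattice_laplacian /discrete_laplacian /laplacian.
rewrite mulr_sumr -sumrB; apply: le_trans (ler_norm_sum _ _ _) _.
have -> : 16 * M * mesh R n.+1 ^+ 3 = \sum_(i < 8) (2 * M * mesh R n.+1 ^+ 3).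
  by rewrite sumr_const card_ord -[RHS]mulr_natl; ring.
apply: ler_sum => i _.
exact: second_diff_estimate (sg) (ltW (mesh_gt0 n)) (gM i).
Qed.
End Poisson.

Lemma taylor_limit_algebra (R : realType) (Uv Ux uv ux S s a p q : R) :
  `|S - s| <= q -> `|Uv - uv| <= p -> `|Ux - ux| <= p -> `|Uv - Ux - S| <= a ->
  `|uv - ux - s| <= a + (p + p + q).
Proof.
rewrite !ler_norml => /andP[? ?] /andP[? ?] /andP[? ?] /andP[? ?].
by apply/andP; split; lra.
Qed.

(** * Passage to the limit of vanishing mesh *)

Section GreenLimit.
Variables (R : realType) (j : 'I_8).
Local Notation E := 'rV[R]_8.
Local Notation e_ i := (delta_mx 0 i : 'rV[R]_8).
Variable U : nat -> (E -> R^o) -> E -> R^o.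
Hypothesis U_twisted : forall n f, twisted j f -> twisted j (U n f).
Hypothesis U_partial : forall n f i, twisted j f -> partial i (U n f) = U n (partial i f).
Hypothesis U_laplacian : forall n f, twisted j f ->
  forall x, lattice_laplacian n.+1 (U n f) x = mesh R n.+1 ^+ 2 * f x.
Implicit Types f : E -> R^o.

Lemma green_bound n f (B : R) : twisted j f -> (forall x, `|f x| <= B) ->
  forall x, `|U n f x| <= B / 8.
Proof.
move=> tf fB; apply: (lattice_stability (n := n) (U_twisted n tf)) => x.
by rewrite U_laplacian // normrM ger0_norm ?sqr_ge0// ler_wpM2l ?sqr_ge0.
Qed.

(** Third derivatives of [U n f] are [U n] of third derivatives of [f], so stability bounds them
    independently of [n]. *)
Lemma green_third f : twisted j f ->
  exists B : R, forall n i x, `|partial i (partial i (partial i (U n f))) x| <= B.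
Proof.
move=> tf.
have [B [_ fB]] : exists B : R, 0 <= B /\
    forall i x, `|partial i (partial i (partial i f)) x| <= B.
  apply: bounded_family => i; apply: (@twisted_bounded _ j).
  by do 3![apply: twisted_partial].
exists (B / 8) => n i x; have t1 := twisted_partial i tf.
have t2 := twisted_partial i t1; rewrite !U_partial//.
by apply: green_bound; [exact: twisted_partial|exact: fB].
Qed.

Lemma green_residual f : twisted j f -> exists C : R,
  forall n x, `|laplacian (U n f) x - f x| <= C * mesh R n.+1.
Proof.
move=> tf; have [B UB] := green_third tf; exists (16 * B) => n x.
have sU : smooth (U n f) by case: (U_twisted n tf).
have := lattice_consistency n sU (UB n) x.
rewrite U_laplacian //.
rewrite -mulrBr normrM ger0_norm ?sqr_ge0 // distrC.
have h0 := mesh_gt0 R n.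
move: (mesh R n.+1) h0 `|_ - _| => h h0 d.
have -> : 16 * B * h ^+ 3 = h ^+ 2 * (16 * B * h) by ring.
by rewrite ler_pM2l // exprn_gt0.
Qed.

Lemma twistedB f g : twisted j f -> twisted j g -> twisted j (fun x => f x + (-1) *: g x).
Proof.
case=> sf pf af [sg pg ag]; split.
- by apply: smoothD => //; exact: smoothZ.
- by move=> i x; rewrite pf pg.
- by move=> x; rewrite af ag scalerN opprD.
Qed.

(** Stability at mesh [n] is applied to [U n f - U m f]. Inserting [U m f] into the equation of mesh
    [n] costs its consistency error there, plus the distance from its true Laplacian to [f], which
    is of the order of mesh [m]. *)
Lemma green_cauchy f : twisted j f -> exists C : R,
  forall x n m, `|U n f x - U m f x| <= C * (n.+1%:R^-1 + m.+1%:R^-1).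
Proof.
move=> tf; have [B UB] := green_third tf; have [C UC] := green_residual tf.
pose D := 16 * `|B| + `|C|.
(* 16 is the 8 of the stability bound times the 2 in [mesh = 1 / (2 (n + 1))]. *)
exists (D / 16) => x n m.
have tB := twistedB (U_twisted n tf) (U_twisted m tf).
have D0 : 0 <= D by rewrite addr_ge0// mulr_ge0.
have -> : D / 16 * (n.+1%:R^-1 + m.+1%:R^-1) = D * (mesh R n.+1 + mesh R m.+1) / 8.
  by rewrite !mesh_succ; move: (n.+1%:R^-1 : R) (m.+1%:R^-1 : R) => p q; field.
rewrite -[X in `|_ + X|]scaleN1r.
apply: (lattice_stability (n := n) tB) => {}x.
have -> : lattice_laplacian n.+1 (fun x0 : E => U n f x0 + -1 *: U m f x0) x =
   lattice_laplacian n.+1 (U n f) x - lattice_laplacian n.+1 (U m f) x.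
  rewrite /lattice_laplacian /discrete_laplacian -sumrB; apply: eq_bigr => i _.
  rewrite /second_diff !scaleN1r.
  move: (U n f _ : R) (U n f _ : R) (U n f _ : R) (U m f _ : R) (U m f _ : R) (U m f _ : R).
  by move=> a b c a' b' c'; rewrite /GRing.scale/=; ring.
have sU : smooth (U m f) by case: (U_twisted m tf).
have := lattice_consistency n sU (UB m) x; have := UC m x.
rewrite U_laplacian //.
have h0 := mesh_gt0 R n; have k0 := mesh_gt0 R m.
move: h0 k0; rewrite /D; move: (mesh R n.+1) (mesh R m.+1) => h k h0 k0.
move: (lattice_laplacian _ _ _) (laplacian _ _ : R) (f x : R) => L l y.
have -> : h ^+ 2 * y - L = h ^+ 2 * (y - l) - (L - h ^+ 2 * l) by ring.
move=> b1 b2; apply: le_trans (ler_normB _ _) _.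
rewrite normrM (ger0_norm (sqr_ge0 h)) distrC.
have h2 : 0 <= h ^+ 2 by exact: sqr_ge0.
have e1 : h ^+ 2 * `|l - y| <= h ^+ 2 * (`|C| * k).
  apply: ler_wpM2l => //; apply: le_trans b1 _.
  by rewrite ler_wpM2r ?(ltW k0)// ler_norm.
have e2 : `|L - h ^+ 2 * l| <= h ^+ 2 * (16 * `|B| * h).
  apply: le_trans b2 _; have -> : 16 * B * h ^+ 3 = h ^+ 2 * (16 * B * h) by ring.
  by apply: ler_wpM2l => //; rewrite ler_wpM2r ?(ltW h0)// ler_wpM2l// ler_norm.
apply: le_trans (lerD e1 e2) _; rewrite -mulrDr ler_wpM2l //.
rewrite -subr_ge0.
have -> : (16 * `|B| + `|C|) * (h + k) - (`|C| * k + 16 * `|B| * h)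
  = `|C| * h + 16 * (`|B| * k) by ring.
by rewrite addr_ge0 // !mulr_ge0 // ltW.
Qed.

Definition is_green (f u : E -> R^o) : Prop :=
  exists C : R, forall n x, `|U n f x - u x| <= C * n.+1%:R^-1.

Lemma green_exists f : twisted j f -> exists u, is_green f u.
Proof.
move=> tf; have [C UC] := green_cauchy tf.
have /choice[u uP] x := inv_succ_limit (UC x).
by exists u, C => n x; exact: uP.
Qed.

Lemma green_unique f (u u' : E -> R^o) : is_green f u -> is_green f u' -> u = u'.
Proof.
move=> [C uC] [C' uC']; apply/funext => x; apply/eqP.
rewrite -subr_eq0 -normr_le0; apply: (@le_of_inv_succ _ _ _ (C + C')) => n.
have := uC n x; have := uC' n x; rewrite add0r mulrDl.
move: (C * _) (C' * _) (U n f x : R) (u x : R) (u' x : R) => p q a b c h1 h2.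
have -> : b - c = (a - c) - (a - b) by ring.
by apply: le_trans (ler_normB _ _) _; rewrite addrC lerD.
Qed.

(** The approximations to [partial i f] converge to some [L i] by the same construction. The Taylor
    inequality for [U n f] has a constant independent of [n], so it survives the limit and
    identifies [L i] with [partial i u]. The conclusion reproduces the hypothesis for [partial i f],
    which is what coinduction needs for smoothness. *)
Lemma green_derivable f (u : E -> R^o) : twisted j f -> is_green f u ->
  (forall x, differentiable u x) /\ forall i, is_green (partial i f) (partial i u).
Proof.
move=> tf [C uC].
have /choice[L LP] : forall i, exists u', is_green (partial i f) u'.
  by move=> i; apply: green_exists; exact: twisted_partial.
have /choice[D DP] := LP.
have [B [_ fB]] : exists B : R, 0 <= B /\
    forall (p : 'I_8 * 'I_8) x, `|partial p.2 (partial p.1 f) x| <= B.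
  apply: bounded_family => p; apply: (@twisted_bounded _ j).
  by do 2![apply: twisted_partial].
have key x : differentiable u x /\ forall i, partial i u x = L i x.
  apply: (@differentiable_of_estimate _ _ _ _ (64 * (B / 8))) => v.
  pose K := C + C + \sum_i `|v 0 i| * D i.
  apply: (@le_of_inv_succ _ _ _ K) => n.
  have sU : smooth (U n f) by case: (U_twisted n tf).
  have UB i k y : `|partial k (partial i (U n f)) y| <= B / 8.
    rewrite U_partial // U_partial; last exact: twisted_partial.
    by apply: green_bound => [|z]; [do 2![apply: twisted_partial]|exact: (fB (i, k))].
  have := taylor_estimate x v sU UB.
  under eq_bigr => i _ do rewrite U_partial //.
  have b3 : `|\sum_i (v 0 i * (U n (partial i f) x : R)) - \sum_i (v 0 i * (L i x : R))|
     <= (\sum_i `|v 0 i| * D i) * n.+1%:R^-1.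
    rewrite -sumrB mulr_suml; apply: le_trans (ler_norm_sum _ _ _) _.
    by apply: ler_sum => i _; rewrite -mulrBr normrM -mulrA ler_wpM2l.
  have := uC n x; have := uC n (x + v); move: b3; rewrite /K !mulrDl.
  exact: taylor_limit_algebra.
split=> [x|i]; first by case: (key x).
have -> : partial i u = L i by apply/funext => x; case: (key x).
exact: LP.
Qed.

Lemma green_smooth f u : twisted j f -> is_green f u -> smooth u.
Proof.
move=> tf gu; apply: (@smooth_coind R R^o (fun u => exists2 f, twisted j f & is_green f u)).
  move=> {gu}u [{tf}f tf gu]; have [du gi] := green_derivable tf gu; split=> // i.
  by exists (partial i f); [exact: twisted_partial|exact: gi].
by exists f.
Qed.

Lemma green_twisted f u : twisted j f -> is_green f u -> twisted j u.
Proof.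
move=> tf gu; split; first exact: green_smooth gu.
  move=> i x; suff uE : u = (fun y => u (y + 2 *: e_ i)) by rewrite [in RHS]uE.
  apply: (green_unique gu); case: gu => C uC; exists C => n y.
  have [_ pU _] := U_twisted n tf.
  by rewrite -(pU i y); exact: uC.
move=> x; suff uE : u = (fun y => - u (y + e_ j)) by rewrite [in RHS]uE opprK.
apply: (green_unique gu); case: gu => C uC; exists C => n y.
have [_ _ aU] := U_twisted n tf.
have := uC n (y + e_ j); rewrite aU.
move: (U n f y : R) (u (y + e_ j) : R) => a b.
by rewrite -normrN opprD !opprK.
Qed.

Lemma green_laplacian f u : twisted j f -> is_green f u -> laplacian u = f.
Proof.
move=> tf gu; apply/funext => x; apply/eqP; rewrite -subr_eq0 -normr_le0.
have [_ gi] := green_derivable tf gu.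
have /choice[D DP] : forall i, is_green (partial i (partial i f)) (partial i (partial i u)).
  by move=> i; have [_] := green_derivable (twisted_partial i tf) (gi i); exact.
have [C UC] := green_residual tf.
apply: (@le_of_inv_succ _ _ _ (C / 2 + \sum_i D i)) => n; rewrite add0r mulrDl.
have := UC n x; rewrite mesh_succ mulrA mulrAC => b1.
have b2 : `|(laplacian (U n f) x : R) - laplacian u x| <= (\sum_i D i) * n.+1%:R^-1.
  rewrite /laplacian -sumrB mulr_suml; apply: le_trans (ler_norm_sum _ _ _) _.
  apply: ler_sum => i _; rewrite U_partial // U_partial; last exact: twisted_partial.
  exact: DP.
move: b1 b2; move: (laplacian (U n f) x : R) (laplacian u x : R) (f x : R) => a b c b1 b2.
have -> : b - c = (a - c) - (a - b) by ring.
by apply: le_trans (ler_normB _ _) _; rewrite lerD.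
Qed.
End GreenLimit.

(** * The Poisson equation for antiperiodic functions *)

Section TwistedPoisson.
Variables (R : realType) (j : 'I_8).

Lemma twisted_poisson (f : 'rV[R]_8 -> R^o) : twisted j f ->
  exists u : 'rV[R]_8 -> R^o, twisted j u /\ laplacian u = f.
Proof.
move=> tf.
have /choice[U UP] (n : nat) : exists U : ('rV[R]_8 -> R^o) -> 'rV[R]_8 -> R^o,
    [/\ forall f, twisted j f -> twisted j (U f),
     forall f i, twisted j f -> partial i (U f) = U (partial i f) &
     forall f, twisted j f ->
       forall x, lattice_laplacian n.+1 (U f) x = mesh R n.+1 ^+ 2 * f x].
  have [K [w [t wt]]] := @lattice_green R n.+1 isT j.
  exists (translates w t); split=> [g|g i [sg _ _]|g [_ pg ag]].
  - exact: twisted_translates.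
  - exact: partial_translates.
  - exact: wt.
have U1 n g : twisted j g -> twisted j (U n g) by have [h _ _] := UP n; exact: h.
have U2 n g i : twisted j g -> partial i (U n g) = U n (partial i g).
  by have [_ h _] := UP n; exact: h.
have U3 n g : twisted j g ->
    forall x, lattice_laplacian n.+1 (U n g) x = mesh R n.+1 ^+ 2 * g x.
  by have [_ _ h] := UP n; exact: h.
have [u gu] := green_exists U1 U2 U3 tf.
by exists u; split; [exact: (green_twisted U1 U2 U3 tf gu)|exact: (green_laplacian U1 U2 U3 tf gu)].
Qed.

(** The lattice Laplacian of a harmonic function is pure consistency error, of order [h ^+ 3];
    stability divides by [h ^+ 2] and leaves a bound of order [h] on [u]. *)
Lemma twisted_harmonic (u : 'rV[R]_8 -> R^o) :
  twisted j u -> laplacian u = (fun=> 0) -> u = (fun=> 0).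
Proof.
move=> tu u0.
have [B [_ uB]] : exists B : R, 0 <= B /\
    forall i x, `|partial i (partial i (partial i u)) x| <= B.
  apply: bounded_family => i; apply: (@twisted_bounded _ j).
  by do 3![apply: twisted_partial].
have su : smooth u by case: tu.
apply/funext => x; apply/eqP; rewrite -normr_le0.
apply: (@le_of_inv_succ _ _ _ B) => n; rewrite add0r.
have -> : B * n.+1%:R^-1 = 16 * B * mesh R n.+1 / 8.
  by rewrite mesh_succ; move: (n.+1%:R^-1 : R) => p; field.
apply: (lattice_stability (n := n) tu) => y.
have := lattice_consistency n su uB y; rewrite u0 mulr0 subr0 => h.
apply: le_trans h _; move: (mesh R n.+1) => m.
have -> : m ^+ 2 * (16 * B * m) = 16 * B * m ^+ 3 by ring.
by [].
Qed.
End TwistedPoisson.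

(** * From antiperiodicity to vanishing symmetrization *)

Section Tame.
Variables (R : realType) (V : normedModType R).
Local Notation E := 'rV[R]_8.
Local Notation e_ i := (delta_mx 0 i : 'rV[R]_8).
Implicit Types (f g : E -> V) (i j : 'I_8) (J : seq 'I_8).

Definition symmetrize j f : E -> V := fun x => f x + f (x + e_ j).
Definition symmetrizes J f : E -> V := foldr symmetrize f J.
(** An equivariant function with values in so(3) need not be antiperiodic in any fixed direction.
    The vanishing of its total symmetrization can be read off entry by entry, without diagonalizing
    the commuting involutions. *)
Definition tame J f : Prop :=
  [/\ smooth f, periodic2 f & forall x, symmetrizes J f x = 0].

Lemma symmetrizesD J f g x :
  symmetrizes J (fun y => f y + g y) x = symmetrizes J f x + symmetrizes J g x.
Proof. by elim: J x => [//|j J IH] x; rewrite /= /symmetrize !IH addrACA. Qed.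

Lemma symmetrizesZ J (k : R) f x :
  symmetrizes J (fun y => k *: f y) x = k *: symmetrizes J f x.
Proof. by elim: J x => [//|j J IH] x; rewrite /= /symmetrize !IH scalerDr. Qed.

Lemma symmetrizes_shift J f a x :
  symmetrizes J (fun y => f (y + a)) x = symmetrizes J f (x + a).
Proof. by elim: J x => [//|j J IH] x; rewrite /= /symmetrize !IH (addrAC x (e_ j)). Qed.

Lemma symmetrizesC J f j x :
  symmetrizes J (symmetrize j f) x = symmetrize j (symmetrizes J f) x.
Proof. by rewrite /symmetrize -symmetrizes_shift -symmetrizesD. Qed.

(** A shift by [e_j] permutes the summed translates, because [e_j + e_j] is a period. *)
Lemma symmetrizes_shift_mem J f j x : periodic2 f -> j \in J ->
  symmetrizes J f (x + e_ j) = symmetrizes J f x.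
Proof.
move=> pf; elim: J x => [//|k J IH] x; rewrite inE => /predU1P[<-|jJ] /=.
  rewrite /symmetrize -addrA.
  have -> : e_ j + e_ j = 2 *: e_ j by rewrite scaler_nat mulr2n.
  rewrite [LHS]addrC; congr (_ + _); rewrite -(symmetrizes_shift J f (2 *: e_ j)).
  by congr (symmetrizes J _ x); apply/funext => y; exact: pf.
by rewrite /symmetrize (addrAC x) !IH.
Qed.

Lemma symmetrizes_partial J f i x : smooth f ->
  symmetrizes J (partial i f) x = partial i (symmetrizes J f) x.
Proof.
move=> sf; have sJ : smooth (symmetrizes J f).
  by elim: J => //= j J IH; apply: smoothD => //; exact: smooth_shift.
elim: J x sJ => [//|j J IH] x /= sJ.
have sJ' : smooth (symmetrizes J f).
  by elim: (J) => //= k L IH'; apply: smoothD => //; exact: smooth_shift.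
rewrite /symmetrize !IH // partialD ?partial_shift //; apply: smooth_differentiable => //.
exact: smooth_shift.
Qed.

Lemma laplacianD f g x : smooth f -> smooth g ->
  laplacian (fun y => f y + g y) x = laplacian f x + laplacian g x.
Proof.
move=> sf sg; rewrite /laplacian -big_split; apply: eq_bigr => i _ /=.
have -> : partial i (fun y => f y + g y) = (fun y => partial i f y + partial i g y).
  by apply/funext => y; rewrite partialD //; exact: smooth_differentiable.
by rewrite partialD //; exact: smooth_partial_differentiable.
Qed.

Lemma laplacianZ (k : R) f x : smooth f ->
  laplacian (fun y => k *: f y) x = k *: laplacian f x.
Proof.
move=> sf; rewrite /laplacian scaler_sumr; apply: eq_bigr => i _ /=.
have -> : partial i (fun y => k *: f y) = (fun y => k *: partial i f y).
  by apply/funext => y; rewrite partialZ //; exact: smooth_differentiable.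
by rewrite partialZ //; exact: smooth_partial_differentiable.
Qed.

Lemma laplacian_shift f a x : laplacian (fun y => f (y + a)) x = laplacian f (x + a).
Proof.
apply: eq_bigr => i _.
have -> : partial i (fun y => f (y + a)) = (fun y => partial i f (y + a)).
  by apply/funext => y; rewrite partial_shift.
by rewrite partial_shift.
Qed.

Lemma laplacian_sum (I : Type) (r : seq I) (P : pred I) (c : I -> R) (F : I -> E -> V) x :
  (forall k, P k -> smooth (F k)) ->
  laplacian (fun y => \sum_(k <- r | P k) c k *: F k y) x =
  \sum_(k <- r | P k) c k *: laplacian (F k) x.
Proof.
move=> sF; have scF k : P k -> smooth (fun y => c k *: F k y).
  by move=> Pk; apply: smoothZ; exact: sF.
elim: r => [|k r IH].
  under eq_fun do rewrite big_nil.
  by rewrite big_nil /laplacian big1 // => i _; rewrite !partial_cst.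
rewrite big_cons; case Pk : (P k); under eq_fun do rewrite big_cons Pk; last by [].
rewrite (laplacianD x (scF k Pk) (smooth_sum r scF)) IH.
by rewrite (laplacianZ (c k) x (sF k Pk)).
Qed.

Lemma tameD J f g : tame J f -> tame J g -> tame J (fun x => f x + g x).
Proof.
case=> sf pf Jf [sg pg Jg]; split; first exact: smoothD.
  by move=> i x; rewrite pf pg.
by move=> x; rewrite symmetrizesD Jf Jg addr0.
Qed.

Lemma tameZ J (k : R) f : tame J f -> tame J (fun x => k *: f x).
Proof.
case=> sf pf Jf; split; first exact: smoothZ.
  by move=> i x; rewrite pf.
by move=> x; rewrite symmetrizesZ Jf scaler0.
Qed.

Lemma tame0 J : tame J (fun=> 0 : V).
Proof.
split=> //; first exact: smooth_cst.
by elim: J => //= j J IH x; rewrite /symmetrize !IH addr0.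
Qed.

Lemma tame_sum (I : Type) (r : seq I) (P : pred I) J (F : I -> E -> V) :
  (forall k, P k -> tame J (F k)) -> tame J (fun x => \sum_(k <- r | P k) F k x).
Proof.
move=> tF; elim: r => [|k r IH].
  by under eq_fun do rewrite big_nil; exact: tame0.
case Pk : (P k); under eq_fun do rewrite big_cons Pk; last by [].
by apply: tameD => //; exact: tF.
Qed.

Lemma tame_partial J f i : tame J f -> tame J (partial i f).
Proof.
case=> sf pf Jf; split; [exact: smooth_partial|exact: periodic2_partial|].
move=> x; rewrite symmetrizes_partial //.
have -> : symmetrizes J f = (fun=> 0) by apply/funext => y; exact: Jf.
by rewrite partial_cst.
Qed.

(** The inductive step on [J]: symmetrizing in [j] uses up this direction, while the antisymmetric
    half is antiperiodic in [e_j] since [2 e_j] is a period. *)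
Lemma tame_cons_split J j f : tame (j :: J) f ->
  tame J (fun x => 2^-1 *: symmetrize j f x) /\
  tame [:: j] (fun x => 2^-1 *: (f x - f (x + e_ j))).
Proof.
case=> sf pf Jf; have sj := smooth_shift (e_ j) sf; split; split.
- by apply: smoothZ; exact: smoothD.
- by move=> i x; rewrite /symmetrize pf addrAC pf.
- by move=> x; rewrite symmetrizesZ symmetrizesC [symmetrize _ _ _](Jf x) scaler0.
- apply: smoothZ; rewrite (_ : (fun _ => _) = (fun x => f x + (-1) *: f (x + e_ j))).
    by apply: smoothD => //; exact: smoothZ.
  by apply/funext => x; rewrite scaleN1r.
- by move=> i x; rewrite pf addrAC pf.
- move=> x; rewrite /= /symmetrize -scalerDr -(addrA x).
  have -> : e_ j + e_ j = 2 *: e_ j by rewrite scaler_nat mulr2n.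
  by rewrite pf subrKA subrr scaler0.
Qed.
End Tame.

Section ScalarPoisson.
Variable R : realType.
Local Notation E := 'rV[R]_8.
Local Notation e_ i := (delta_mx 0 i : 'rV[R]_8).

Lemma twisted_tame j (f : E -> R^o) : twisted j f <-> tame [:: j] f.
Proof.
split=> [[sf pf af]|[sf pf Jf]]; split=> // x.
  by rewrite /= /symmetrize af subrr.
by apply/eqP; rewrite -addr_eq0 addrC; apply/eqP; exact: Jf.
Qed.

Lemma tame_cons J j (f : E -> R^o) : tame [:: j] f -> tame (j :: J) f.
Proof.
case=> sf pf Jf; split=> // x; change (symmetrize j (symmetrizes J f) x = 0).
rewrite -symmetrizesC (_ : symmetrize j f = (fun=> 0)); first by case: (tame0 R^o J).
by apply/funext => y; exact: Jf.
Qed.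

Lemma tame_cons_mem J j (f : E -> R^o) : tame J f -> tame (j :: J) f.
Proof.
by case=> sf pf Jf; split=> // x; rewrite /= /symmetrize !Jf addr0.
Qed.

Lemma half_split (V : lmodType R) (a b : V) :
  a = 2^-1 *: (a + b) + 2^-1 *: (a - b).
Proof.
rewrite -scalerDr addrACA subrr addr0 -mulr2n -(scaler_nat 2 a) scalerA mulVf ?scale1r//.
Qed.

Lemma tame_poisson J (f : E -> R^o) : tame J f ->
  exists u : E -> R^o, tame J u /\ laplacian u = f.
Proof.
elim: J f => [|j J IH] f tf.
  (* For the empty list the symmetrization is [f] itself, so [f] is zero. *)
  exists f; split=> //; case: tf => sf pf f0.
  have -> : f = (fun=> 0) by apply/funext => x; exact: f0.
  apply/funext => x; rewrite /laplacian big1 // => i _.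
  by rewrite !partial_cst.
have [t1 /twisted_tame t2] := tame_cons_split tf.
have [u1 [tu1 lu1]] := IH _ t1.
have [u2 [/twisted_tame tu2 lu2]] := twisted_poisson t2.
exists (fun x => u1 x + u2 x); split.
  by apply: tameD; [exact: tame_cons_mem|exact: tame_cons].
apply/funext => x; rewrite laplacianD; [|by case: tu1|by case: tu2].
by rewrite lu1 lu2 [RHS](half_split _ (f (x + e_ j))).
Qed.

Lemma tame_harmonic J (u : E -> R^o) :
  tame J u -> laplacian u = (fun=> 0) -> u = (fun=> 0).
Proof.
elim: J u => [|j J IH] u tu lu.
  by case: tu => _ _ u0; apply/funext => x; exact: u0.
have [t1 /twisted_tame t2] := tame_cons_split tu.
have su : smooth u by case: tu.
have l1 : laplacian (fun x => 2^-1 *: symmetrize j u x) = (fun=> 0).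
  apply/funext => x; rewrite laplacianZ; last by apply: smoothD => //; exact: smooth_shift.
  by rewrite laplacianD ?laplacian_shift ?lu ?addr0 ?scaler0 //; exact: smooth_shift.
have l2 : laplacian (fun x => 2^-1 *: (u x - u (x + e_ j))) = (fun=> 0).
  apply/funext => x.
  have -> : (fun x => 2^-1 *: (u x - u (x + e_ j))) = (fun x => 2^-1 *: (u x + (-1) *: u (x + e_ j))).
    by apply/funext => y; rewrite scaleN1r.
  have sj := smooth_shift (e_ j) su.
  rewrite laplacianZ; last by apply: smoothD => //; exact: smoothZ.
  rewrite laplacianD //; last exact: smoothZ.
  by rewrite laplacianZ // laplacian_shift lu scaler0 addr0 scaler0.
apply/funext => x; rewrite (half_split (u x) (u (x + e_ j))).
have /(congr1 (fun h => h x)) /= := IH _ t1 l1; rewrite /symmetrize => ->.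
by have /(congr1 (fun h => h x)) /= := twisted_harmonic t2 l2 => ->; rewrite addr0.
Qed.
End ScalarPoisson.

(** * Matrix-valued functions *)

Section MatrixPoisson.
Variables (R : realType) (m n : nat).
Local Notation E := 'rV[R]_8.
Local Notation e_ i := (delta_mx 0 i : 'rV[R]_8).
Implicit Types (f : E -> 'M[R]_(m, n)).

Lemma symmetrizes_mx J f x a b :
  symmetrizes J f x a b = symmetrizes J (fun y => f y a b : R^o) x.
Proof. by elim: J x => //= j J IH x; rewrite /symmetrize mxE !IH. Qed.

Lemma laplacian_mx f x a b : smooth f ->
  laplacian f x a b = laplacian (fun y => f y a b : R^o) x.
Proof.
move=> sf; rewrite /laplacian summxE; apply: eq_bigr => i _.
rewrite partial_mx; last exact: smooth_partial_differentiable.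
congr (partial i _ x); apply/funext => y.
by rewrite partial_mx //; exact: smooth_differentiable.
Qed.

Lemma partialC_mx f i j x : smooth f ->
  partial i (partial j f) x = partial j (partial i f) x.
Proof.
move=> sf; apply/matrixP => a b.
have E1 k : (fun y => partial k f y a b : R^o) = partial k (fun y => f y a b : R^o).
  by apply/funext => y; rewrite partial_mx //; exact: smooth_differentiable.
have E2 k l : partial l (partial k f) x a b = partial l (fun y => partial k f y a b : R^o) x.
  by apply: partial_mx; exact: smooth_partial_differentiable.
apply: (etrans (E2 j i)).
rewrite (E1 j).
apply: esym.
apply: (etrans (E2 i j)).
rewrite (E1 i).
have sab : smooth (fun y => f y a b : R^o) by move/smooth_mxP : sf; exact.
exact: (partialC j i x sab).
Qed.

Lemma partial_laplacian f i x : smooth f ->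
  partial i (laplacian f) x = laplacian (partial i f) x.
Proof.
move=> sf; rewrite partial_sum; last by move=> k _; do 2!apply: smooth_partial.
apply: eq_bigr => k _; apply: etrans (partialC_mx i k x (smooth_partial k sf)) _.
have -> : partial i (partial k f) = partial k (partial i f); last by [].
by apply/funext => y; exact: (partialC_mx i k y sf).
Qed.

Lemma tame_mxP J f : tame J f <-> forall a b, tame J (fun y => f y a b : R^o).
Proof.
split=> [[sf pf Jf] a b|tf].
  split=> [|i x|x]; first by move/smooth_mxP : sf; exact.
    by rewrite pf.
  by rewrite -symmetrizes_mx Jf mxE.
split=> [|i x|x].
- by apply/smooth_mxP => a b; case: (tf a b).
- by apply/matrixP => a b; case: (tf a b) => _ pf _; exact: pf.
- by apply/matrixP => a b; rewrite symmetrizes_mx mxE; case: (tf a b).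
Qed.

Lemma tame_mx_poisson J f : tame J f -> exists u : E -> 'M[R]_(m, n), tame J u /\ laplacian u = f.
Proof.
move=> /tame_mxP tf.
have /choice[u uP] (p : 'I_m * 'I_n) : exists u : E -> R^o, tame J u /\ laplacian u = (fun y => f y p.1 p.2).
  exact: tame_poisson.
have tu : tame J (fun x => \matrix_(a, b) u (a, b) x).
  apply/tame_mxP => a b; have [tu _] := uP (a, b).
  by under eq_fun do rewrite mxE.
exists (fun x => \matrix_(a, b) u (a, b) x); split=> //.
apply/funext => x; apply/matrixP => a b; rewrite laplacian_mx; last by case: tu.
have -> : (fun y => (\matrix_(c, d) u (c, d) y) a b : R^o) = u (a, b).
  by apply/funext => y; rewrite mxE.
by have [_ ->] := uP (a, b).
Qed.

Lemma tame_mx_harmonic J f : tame J f -> laplacian f = (fun=> 0) -> f = (fun=> 0).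
Proof.
move=> tf lf; apply/funext => x; apply/matrixP => a b; rewrite mxE.
have /tame_mxP/(_ a b) tab := tf.
have lab : laplacian (fun y => f y a b : R^o) = (fun=> 0).
  by apply/funext => y; rewrite -laplacian_mx ?lf ?mxE //; case: tf.
exact: (congr1 (fun h => h x) (tame_harmonic tab lab)).
Qed.
End MatrixPoisson.

Section MatrixLinear.
Variables (R : realType) (m n p q : nat).
Local Notation E := 'rV[R]_8.
Local Notation e_ i := (delta_mx 0 i : 'rV[R]_8).
Variable L : {linear 'M[R]_(m, n) -> 'M[R]_(p, q)}.
Implicit Types f : E -> 'M[R]_(m, n).

Lemma linear_mx_differentiable M : differentiable L M.
Proof.
have -> : (L : _ -> _) = (fun M : 'M[R]_(m, n) => \sum_(k : 'I_m * 'I_n) M k.1 k.2 *: L (delta_mx k.1 k.2)).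
  apply/funext => N; rewrite [in LHS](matrix_sum_delta N) pair_bigA linear_sum.
  by apply: eq_bigr => k _; rewrite linearZ.
have -> : (fun M : 'M[R]_(m, n) => \sum_(k : 'I_m * 'I_n) M k.1 k.2 *: L (delta_mx k.1 k.2)) =
   \sum_(k : 'I_m * 'I_n) (fun M : 'M[R]_(m, n) => M k.1 k.2 *: L (delta_mx k.1 k.2)).
  by apply/funext => N; rewrite fct_sumE.
elim/big_ind : _ => [|g h dg dh|k _]; first exact: differentiable_cst.
  exact: differentiableD.
by apply: differentiableZl; exact: differentiable_coord.
Qed.

Lemma partial_linear f i x : differentiable f x ->
  partial i (fun y => L (f y)) x = L (partial i f x).
Proof.
move=> df; have dL := linear_mx_differentiable.
have cL : continuous L by move=> M; exact: differentiable_continuous.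
rewrite /partial !deriveE //; last exact: (@differentiable_comp _ _ _ _ f L).
by rewrite (@diff_comp _ _ _ _ f L) //= diff_lin.
Qed.

Lemma smooth_linear f : smooth f -> smooth (fun y => L (f y)).
Proof.
move=> sf; pose P (h : E -> 'M[R]_(p, q)) := exists2 f, smooth f & h = (fun y => L (f y)).
apply: (@smooth_coind _ _ P); last by exists f.
move=> _ [g sg ->]; split=> [x|i].
  apply: (@differentiable_comp _ _ _ _ g L); last exact: linear_mx_differentiable.
  exact: smooth_differentiable.
exists (partial i g); first exact: smooth_partial.
by apply/funext => x; rewrite partial_linear //; exact: smooth_differentiable.
Qed.

Lemma laplacian_linear f x : smooth f ->
  laplacian (fun y => L (f y)) x = L (laplacian f x).
Proof.
move=> sf; rewrite /laplacian linear_sum; apply: eq_bigr => i _.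
have -> : partial i (fun y => L (f y)) = (fun y => L (partial i f y)).
  by apply/funext => y; rewrite partial_linear //; exact: smooth_differentiable.
by rewrite partial_linear //; exact: smooth_partial_differentiable.
Qed.

Lemma symmetrizes_linear J f x : symmetrizes J (fun y => L (f y)) x = L (symmetrizes J f x).
Proof. by elim: J x => //= j J IH x; rewrite /symmetrize linearD !IH. Qed.

Lemma tame_linear J f : tame J f -> tame J (fun y => L (f y)).
Proof.
case=> sf pf Jf; split; first exact: smooth_linear.
  by move=> i x; rewrite pf.
by move=> x; rewrite symmetrizes_linear Jf linear0.
Qed.
End MatrixLinear.

(** * Diagonal affine isometries *)

Section DiagonalAffine.
Variables (R : realType) (V : normedModType R).
Local Notation E := 'rV[R]_8.
Local Notation e_ i := (delta_mx 0 i : 'rV[R]_8).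
Implicit Types (f : E -> V) (g : E -> E) (s : 'I_8 -> R).

(** Every element of the orbifold group has this form. Its pullback multiplies each [dx_S] by a
    sign, so equivariance can be tested coefficient by coefficient. *)
Definition signed_affine g s : Prop :=
  (forall i, s i ^+ 2 = 1) /\ exists t : E, forall x i, g x 0 i = s i * x 0 i + t 0 i.

Lemma signed_affine_add g s x i (h : R) : signed_affine g s ->
  g (x + h *: e_ i) = g x + (h * s i) *: e_ i.
Proof.
case=> _ [t gE]; apply/rowP => k; rewrite !(gE, mxE) eqxx /=.
by case: (k =P i) => [->|_]; rewrite ?mulr1 ?mulr0 ?addr0 //; ring.
Qed.

Lemma signed_affine_differentiable g s x : signed_affine g s -> differentiable g x.
Proof.
case=> _ [t gE]; apply/differentiable_mxP => a b; rewrite (ord1 a).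
under eq_fun do rewrite gE.
apply: differentiableD; last exact: differentiable_cst.
by apply: (@differentiableZ R E R^o (fun y => y 0 b : R^o)); exact: differentiable_coord.
Qed.

Lemma partial_signed_affine f g s i x : signed_affine g s -> differentiable f (g x) ->
  partial i (fun y => f (g y)) x = s i *: partial i f (g x).
Proof.
move=> gs df.
have -> : s i *: partial i f (g x) = 'D_(s i *: e_ i) f (g x).
  by rewrite /partial !deriveE // linearZ.
rewrite /partial /derive /=.
have -> // : (fun h : R => h^-1 *: (f (g (h *: e_ i + x)) - f (g x))) =
  (fun h : R => h^-1 *: (f (h *: (s i *: e_ i) + g x) - f (g x))).
apply/funext => h.
by rewrite (addrC _ x) (signed_affine_add _ _ _ gs) (addrC (g x)) scalerA.
Qed.

Lemma smooth_signed_affine f g s : signed_affine g s -> smooth f -> smooth (fun y => f (g y)).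
Proof.
move=> gs sf; pose P (h : E -> V) := exists2 f, smooth f & h = (fun y => f (g y)).
apply: (@smooth_coind _ _ P); last by exists f.
move=> _ [k sk ->]; split=> [x|i].
  apply: (@differentiable_comp _ _ _ _ g k); last exact: smooth_differentiable.
  exact: signed_affine_differentiable gs.
exists (fun y => s i *: partial i k y); first by apply: smoothZ; exact: smooth_partial.
by apply/funext => x; rewrite (partial_signed_affine _ gs) //; exact: smooth_differentiable.
Qed.

Lemma laplacian_signed_affine f g s x : signed_affine g s -> smooth f ->
  laplacian (fun y => f (g y)) x = laplacian f (g x).
Proof.
move=> gs sf; apply: eq_bigr => i _.
have -> : partial i (fun y => f (g y)) = (fun y => s i *: partial i f (g y)).
  by apply/funext => y; rewrite (partial_signed_affine _ gs) //; exact: smooth_differentiable.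
rewrite partialZ; last first.
  by apply: smooth_differentiable; apply: (smooth_signed_affine gs); exact: smooth_partial.
rewrite (partial_signed_affine _ gs) //; last exact: smooth_partial_differentiable.
by rewrite scalerA -expr2; case: gs => -> _; rewrite scale1r.
Qed.

Lemma sqr_eq1_cases (s : R) : s ^+ 2 = 1 -> s = 1 \/ s = -1.
Proof. by move/eqP; rewrite sqrf_eq1 => /orP[] /eqP ->; [left|right]. Qed.

(** A reflected direction turns the shift [e_j] into [- e_j], which is the same modulo the period
    [2 e_j]. *)
Lemma symmetrizes_signed_affine J f g s x : signed_affine g s -> periodic2 f ->
  symmetrizes J (fun y => f (g y)) x = symmetrizes J f (g x).
Proof.
move=> gs; elim: J x f => [//|j J IH] x f pf /=; rewrite /symmetrize !IH //; congr (_ + _).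
rewrite -[X in x + X]scale1r (signed_affine_add _ _ _ gs) mul1r.
case: gs => /(_ j)/sqr_eq1_cases[] -> _; first by rewrite scale1r.
have pJ : periodic2 (symmetrizes J f).
  by elim: (J) => //= k K IHK i y; rewrite /symmetrize IHK addrAC IHK.
rewrite -[LHS](pJ j) -addrA -scalerDl; congr (symmetrizes J f (_ + _)).
by rewrite addrC [2]mulr2n addrK scale1r.
Qed.

Lemma tame_signed_affine J f g s : signed_affine g s -> tame J f -> tame J (fun y => f (g y)).
Proof.
move=> gs [sf pf Jf]; split; first exact: (smooth_signed_affine gs sf).
  move=> i x; rewrite (signed_affine_add _ _ _ gs).
  case: gs => /(_ i)/sqr_eq1_cases[] -> _; first by rewrite mulr1 pf.
  by rewrite mulrN1 scaleNr -[in RHS](subrK (2 *: e_ i) (g x)) pf.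
by move=> x; rewrite (symmetrizes_signed_affine _ _ gs).
Qed.
End DiagonalAffine.

(** * Exterior algebra and Lambda27 *)

Section Wedge.
Variable R : realType.
Implicit Types (i j k l : 'I_8) (S T U : {set 'I_8}).

Lemma shuffle_sign1 i T :
  shuffle_sign R [set i]%SET T = (-1) ^+ #|[set b in T | (b < i)%N]%SET|.
Proof.
congr (_ ^+ _); have pinj : injective (fun b : 'I_8 => (i, b)) by move=> a b [].
rewrite -(card_imset _ pinj); apply: eq_card => -[a b]; rewrite !inE /=.
apply/idP/imsetP => [/and3P[/eqP -> bT bi]|[c]]; first by exists b; rewrite ?inE ?bT.
by rewrite inE => /andP[cT ci] [-> ->]; rewrite eqxx cT ci.
Qed.

Lemma shuffle_sign1_lt i T : (forall b, b \in T -> (i < b)%N) ->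
  shuffle_sign R [set i]%SET T = 1.
Proof.
move=> iT; rewrite shuffle_sign1 (_ : [set b in T | _]%SET = finset.set0) ?cards0 //.
apply/setP => b; rewrite !inE; apply/negP => /andP[/iT h1 h2].
by have := ltn_trans h1 h2; rewrite ltnn.
Qed.

Lemma shuffle_sign1_gt i j : (j < i)%N -> shuffle_sign R [set i]%SET [set j]%SET = -1.
Proof.
move=> ji; rewrite shuffle_sign1 (_ : [set b in _ | _]%SET = [set j]%SET) ?cards1 //.
by apply/setP => b; rewrite !inE; case: eqP => //= ->.
Qed.

Lemma wedge_dx (V : lmodType R) i (b : ext V) U :
  wedge (dx R i) b U =
  if i \in U then shuffle_sign R [set i]%SET (U :\ i)%SET *: b (U :\ i)%SET else 0.
Proof.
rewrite ffunE; case: ifP => [iU|niU].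
  have iU' : ([set i]%SET \subset U) by rewrite finset.sub1set.
  rewrite (bigD1 [set i]%SET) //= big1 ?addr0 => [|S /andP[_ /negbTE Si]].
    by rewrite ffunE eqxx scale1r.
  by rewrite ffunE Si scale0r scaler0.
rewrite big1 // => S SU; rewrite ffunE; case: eqP => [Si|_]; last by rewrite scale0r scaler0.
by move: SU; rewrite Si finset.sub1set niU.
Qed.

Definition basis_form T : ext R^o := [ffun S : {set 'I_8} => (S == T)%:R].

Lemma wedge_dx_basis i T (c : R) : (forall b, b \in T -> (i < b)%N) ->
  wedge (dx R i) (c *: basis_form T) = c *: basis_form (i |: T)%SET.
Proof.
move=> iT; have iNT : i \notin T by apply/negP => /iT; rewrite ltnn.
apply/ffunP => U; rewrite wedge_dx !ffunE.
case: ifP => [iU|niU]; last first.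
  by case: eqP => [UE|_]; [move: niU; rewrite UE finset.setU11|rewrite scaler0].
have -> : (U == i |: T)%SET = (U :\ i == T)%SET.
  apply/eqP/eqP => [->|<-]; last by rewrite finset.setD1K.
  by rewrite finset.setU1K.
case: (U :\ i =P T)%SET => [->|_]; last by rewrite !scaler0.
by rewrite shuffle_sign1_lt // scale1r.
Qed.

Lemma wedgeZl (V : lmodType R) (c : R) (a : ext R^o) (b : ext V) :
  wedge (c *: a) b = c *: wedge a b.
Proof.
apply/ffunP => U; rewrite !ffunE scaler_sumr; apply: eq_bigr => S _.
by rewrite ffunE !scalerA; congr (_ *: _); rewrite /GRing.scale /=; ring.
Qed.

Lemma ext_one_basis : ext_one R = basis_form finset.set0.
Proof. by []. Qed.

Lemma dx4_basis (i j k l : 'I_8) : (i < j)%N -> (j < k)%N -> (k < l)%N ->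
  wedge (dx R i) (wedge (dx R j) (wedge (dx R k) (dx R l))) =
  basis_form (i |: (j |: (k |: [set l])))%SET.
Proof.
move=> ij jk kl; have jl := ltn_trans jk kl.
have H (a : 'I_8) (T : {set 'I_8}) : (forall b, b \in T -> (a < b)%N) ->
    wedge (dx R a) (basis_form T) = basis_form (a |: T)%SET.
  by move=> /(wedge_dx_basis (1 : R)); rewrite !scale1r.
rewrite -[dx R l]/(basis_form [set l]%SET) !H // => b; rewrite !inE.
- by case/or3P=> /eqP-> //; rewrite (ltn_trans ij).
- by case/orP=> /eqP->.
- by move/eqP->.
Qed.

Lemma sum_card2 (V : nmodType) (F : {set 'I_8} -> V) :
  \sum_(T : {set 'I_8} | #|T| == 2%N) F T =
  \sum_(p : 'I_8 * 'I_8 | (p.1 < p.2)%N) F [set p.1; p.2]%SET.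
Proof.
rewrite -(big_imset F (h := fun p : 'I_8 * 'I_8 => [set p.1; p.2]%SET) (A := [pred p : 'I_8 * 'I_8 | (p.1 < p.2)%N])).
  apply: eq_bigl => T; apply/idP/imsetP => [/cards2P[a [b] [ab ->]]|[[a b]]].
    case: (ltngtP a b) => [lt|gt|/val_inj e]; last by rewrite e eqxx in ab.
      by exists (a, b).
    by exists (b, a) => //=; rewrite finset.setUC.
  by rewrite inE /= => lt ->; rewrite cards2 (_ : a != b) // -(inj_eq val_inj) neq_ltn lt.
move=> [a b] [c d]; rewrite !inE /= => ab cd e.
have : a \in [set c; d]%SET by rewrite -e !inE eqxx.
have : b \in [set c; d]%SET by rewrite -e !inE eqxx orbT.
rewrite !inE => /orP[]/eqP eb /orP[]/eqP ea; subst => //.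
- by rewrite ltnn in ab.
- by have := ltn_trans ab cd; rewrite ltnn.
- by rewrite ltnn in ab.
Qed.
End Wedge.

(** * Integer tables for [Omega0] and the complex structures *)

Definition parity_sign (b : bool) : int := if b then -1 else 1.

(* The monomials of [Omega0], with indices shifted to start from 0; the boolean
   marks a minus sign. *)
Definition omega_terms : seq (bool * seq nat) :=
  [:: (false, [:: 0; 1; 2; 3]); (false, [:: 0; 1; 4; 5]); (false, [:: 0; 1; 6; 7]);
      (false, [:: 0; 2; 4; 6]); (true, [:: 0; 2; 5; 7]); (true, [:: 0; 3; 4; 7]);
      (true, [:: 0; 3; 5; 6]); (true, [:: 1; 2; 4; 7]); (true, [:: 1; 2; 5; 6]);
      (true, [:: 1; 3; 4; 6]); (false, [:: 1; 3; 5; 7]); (false, [:: 2; 3; 4; 5]);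
      (false, [:: 2; 3; 6; 7]); (false, [:: 4; 5; 6; 7])]%N.

(** Bitwise exclusive or: the index set is viewed as the group of three-bit words, and [J_b] sends
    each basis vector [e_i] to plus or minus [e_(b xor i)]. *)
Definition xor8 (i j : nat) : nat :=
  nth 0 (nth [::] [:: [:: 0; 1; 2; 3; 4; 5; 6; 7]; [:: 1; 0; 3; 2; 5; 4; 7; 6];
                      [:: 2; 3; 0; 1; 6; 7; 4; 5]; [:: 3; 2; 1; 0; 7; 6; 5; 4];
                      [:: 4; 5; 6; 7; 0; 1; 2; 3]; [:: 5; 4; 7; 6; 1; 0; 3; 2];
                      [:: 6; 7; 4; 5; 2; 3; 0; 1]; [:: 7; 6; 5; 4; 3; 2; 1; 0]] i) j.

(** Row 0 is empty since [J_coef] vanishes for [b = 0]; with this convention sums over the seven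
    structures run over all of ['I_8]. *)
Definition J_negative (b i : nat) : bool :=
  nth false (nth [::]
   [:: [::]; [:: false; true; false; true; false; true; false; true];
       [:: false; true; true; false; false; true; true; false];
       [:: false; false; true; true; true; true; false; false];
       [:: false; true; true; false; true; false; false; true];
       [:: false; false; false; false; true; true; true; true];
       [:: false; true; false; true; true; false; true; false];
       [:: false; false; true; true; false; false; true; true]] b) i.

(* The signed permutation matrices [J_coef b], [0 < b], are the anticommuting
   complex structures of R^8 whose associated two-forms span [Lambda27]. *)
Definition J_coef (b i j : nat) : int :=
  if (0 < b)%N && (j == xor8 b i) then parity_sign (J_negative b i) else 0.

(** Closed form of [sum_b J_b(i,j) J_b(k,l)]: at most one summand survives, the one with
    [b = i xor j]. In [J_product] it is likewise [l = b xor k] that survives. These forms can be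
    compared by evaluation over all indices. *)
Definition J_contract_index (i j k l : nat) : int :=
  if (i != j) && (xor8 i j == xor8 k l) then
    parity_sign (J_negative (xor8 i j) i (+) J_negative (xor8 i j) k) else 0.

Definition J_product (b c k m : nat) : int :=
  if [&& (0 < b)%N, (0 < c)%N & xor8 b k == xor8 c m] then
    parity_sign (J_negative b k (+) J_negative c m) else 0.

Definition kron (i j : nat) : int := if i == j then 1 else 0.

Definition all8 (P : nat -> bool) : bool := all P (iota 0 8).

Lemma all8P (P : nat -> bool) : all8 P -> forall i : 'I_8, P i.
Proof. by move=> /allP h i; apply: h; rewrite mem_iota /=. Qed.

Lemma parity_signM a b : parity_sign a * parity_sign b = parity_sign (a (+) b).
Proof. by case: a; case: b. Qed.

Lemma xor8_lt (i j : 'I_8) : (xor8 i j < 8)%N.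
Proof.
have : all8 (fun i => all8 (fun j => (xor8 i j < 8)%N)) by vm_compute.
by move=> /all8P/(_ i)/all8P/(_ j).
Qed.

Lemma xor8_eq (b i j : 'I_8) : ((j : nat) == xor8 b i) = ((b : nat) == xor8 i j).
Proof.
have : all8 (fun b => all8 (fun i => all8 (fun j => (j == xor8 b i) == (b == xor8 i j)))).
  by vm_compute.
by move=> /all8P/(_ b)/all8P/(_ i)/all8P/(_ j)/eqP.
Qed.

Lemma xor8_gt0 (i j : 'I_8) : (0 < xor8 i j)%N = ((i : nat) != j).
Proof.
have : all8 (fun i => all8 (fun j => (0 < xor8 i j)%N == (i != j))) by vm_compute.
by move=> /all8P/(_ i)/all8P/(_ j)/eqP.
Qed.

Lemma J_coef_skew (b i j : 'I_8) : J_coef b i j = - J_coef b j i.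
Proof.
have : all8 (fun b => all8 (fun i => all8 (fun j => J_coef b i j == - J_coef b j i))).
  by vm_compute.
by move=> /all8P/(_ b)/all8P/(_ i)/all8P/(_ j)/eqP.
Qed.

Lemma J_contract_indexE (i j k l : 'I_8) :
  \sum_(b < 8) J_coef b i j * J_coef b k l = J_contract_index i j k l.
Proof.
pose b0 := Ordinal (xor8_lt i j).
rewrite (bigD1 b0) //= big1 ?addr0 => [|b bb0]; last first.
  rewrite /J_coef xor8_eq; case: eqP => [e|_]; last by rewrite andbF mul0r.
  by case/eqP: bb0; exact: val_inj.
rewrite /J_coef (xor8_eq b0 i j) /= eqxx andbT (xor8_eq b0 k l) /= xor8_gt0.
rewrite /J_contract_index; case: (i =P j :> nat) => _ /=; first by rewrite mul0r.
by case: ifP => _ /=; rewrite ?mulr0 // parity_signM.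
Qed.

Lemma J_productE (b c k m : 'I_8) :
  \sum_(l < 8) J_coef b k l * J_coef c m l = J_product b c k m.
Proof.
rewrite /J_product; pose l0 := Ordinal (xor8_lt b k).
rewrite (bigD1 l0) //= big1 ?addr0 => [|l ll0]; last first.
  rewrite /J_coef; case: eqP => [e|_]; last by rewrite andbF mul0r.
  by case/eqP: ll0; exact: val_inj.
rewrite /J_coef eqxx andbT; case: (0 < b)%N; last by rewrite mul0r.
by case: (0 < c)%N; case: (xor8 b k == xor8 c m); rewrite /= ?mulr0 // parity_signM.
Qed.

(** The polarization, in a vector [v] carrying the indices [i] and [k], of the fact that
    [v, J_1 v, ..., J_7 v] are orthogonal of length [|v|]; the two Kronecker products on the left
    come from [v] itself. *)
Lemma J_clifford_left (i j k l : 'I_8) :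
  \sum_(b < 8) J_coef b k l * J_coef b i j + \sum_(b < 8) J_coef b i l * J_coef b k j
  + kron k l * kron i j + kron i l * kron k j = kron k i * kron l j *+ 2.
Proof.
rewrite !J_contract_indexE.
have : all8 (fun i => all8 (fun j => all8 (fun k => all8 (fun l =>
  J_contract_index k l i j + J_contract_index i l k j
  + kron k l * kron i j + kron i l * kron k j == kron k i * kron l j *+ 2)))).
  by vm_compute.
by move=> /all8P/(_ i)/all8P/(_ j)/all8P/(_ k)/all8P/(_ l)/eqP.
Qed.

(** The entries of [J_b J_c^T + J_c J_b^T = 2 delta_bc]. The relation fails for [b = c = 0], where
    the left side is zero. *)
Lemma J_clifford_right (b c k m : 'I_8) : (0 < b)%N ->
  \sum_(l < 8) J_coef b k l * J_coef c m l + \sum_(l < 8) J_coef b m l * J_coef c k l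
  = kron b c * kron k m *+ 2.
Proof.
move=> b0; rewrite !J_productE.
have : all8 (fun b => all8 (fun c => all8 (fun k => all8 (fun m =>
  (0 < b)%N ==> (J_product b c k m + J_product b c m k == kron b c * kron k m *+ 2))))).
  by vm_compute.
by move=> /all8P/(_ b)/all8P/(_ c)/all8P/(_ k)/all8P/(_ m); rewrite b0 => /eqP.
Qed.

Definition compl8 (l : seq nat) : seq nat := [seq i <- iota 0 8 | i \notin l].
Definition inversions (l m : seq nat) : nat := sumn [seq count (fun b => b < a)%N m | a <- l].
Definition omega_coef (l : seq nat) : int :=
  foldr (fun (t : bool * seq nat) acc =>
    (if l == t.2 then parity_sign t.1 else 0) + acc) 0 omega_terms.

(* Coefficient of [w {k, l}] in [star (Omega0 /\ w)] at [{i, j}]. *)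
Definition star_coef (i j k l : nat) : int :=
  if (k \in [:: i; j]) || (l \in [:: i; j]) then 0 else
  let c := compl8 [:: i; j; k; l] in
  parity_sign (odd (inversions (compl8 [:: i; j]) [:: i; j] + inversions c [:: k; l]))
  * omega_coef c.

(** Here the geometry of [Omega0] enters: on two-forms, [star (Omega0 /\ .)] is [sum_b J_b (x) J_b]
    minus the identity. *)
Lemma star_coefE (i j k l : 'I_8) : (i < j)%N -> (k < l)%N ->
  star_coef i j k l = \sum_(b < 8) J_coef b i j * J_coef b k l - kron i k * kron j l.
Proof.
rewrite J_contract_indexE.
have : all8 (fun i => all8 (fun j => (i < j)%N ==> all8 (fun k => all8 (fun l =>
  (k < l)%N ==> (star_coef i j k l == J_contract_index i j k l - kron i k * kron j l))))).
  by vm_compute.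
move=> /all8P/(_ i)/all8P/(_ j) h ij kl; move: h; rewrite ij => /all8P/(_ k)/all8P/(_ l).
by rewrite kl => /eqP.
Qed.

(** * Signs and coefficients computed on lists *)

Section OmegaSets.
Variable R : realType.
Implicit Types (l m : seq nat) (S T : {set 'I_8}).

Definition set8 l : {set 'I_8} := [set i : 'I_8 | (i : nat) \in l]%SET.

Lemma sum_set8 l (F : nat -> nat) : uniq l -> all (fun i => i < 8)%N l ->
  (\sum_(i in set8 l) F i = \sum_(i <- l) F i)%N.
Proof.
move=> ul l8; rewrite (eq_bigl (fun i : 'I_8 => (i : nat) \in l)); last by move=> i; rewrite inE.
rewrite -(big_mkord (fun i => i \in l) F) -big_filter; apply: perm_big.
apply: uniq_perm => // [|i]; first by rewrite filter_uniq // iota_uniq.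
rewrite mem_filter mem_index_iota /=; case il : (i \in l) => //=.
exact: (allP l8).
Qed.

Lemma parity_signE n : (parity_sign (odd n))%:~R = (-1) ^+ n :> R.
Proof. by rewrite -[in RHS]signr_odd /parity_sign; case: odd. Qed.

Lemma shuffle_sign_set8 l m : uniq l -> uniq m ->
  all (fun i => i < 8)%N l -> all (fun i => i < 8)%N m ->
  shuffle_sign R (set8 l) (set8 m) = (-1) ^+ inversions l m.
Proof.
move=> ul um l8 m8; congr (_ ^+ _); rewrite /inversions sumnE big_map.
rewrite -(sum_set8 (fun a => count (fun b => b < a)%N m) ul l8).
rewrite -sum1dep_card -(pair_big_dep (fun a : 'I_8 => a \in set8 l)
   (fun a b : 'I_8 => (b \in set8 m) && (b < a)%N) (fun _ _ => 1%N)) /=.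
apply: eq_bigr => a _; rewrite -sum1_count [RHS]big_mkcond /=.
apply: etrans _ (sum_set8 (fun b => if (b < a)%N then 1%N else 0%N) um m8).
by rewrite big_mkcondr.
Qed.

Lemma set8C l : (~: set8 l)%SET = set8 (compl8 l).
Proof.
by apply/setP => i; rewrite !inE mem_filter mem_iota /= ltn_ord andbT.
Qed.

Lemma dx4_set8 (i j k l : nat) : (0 < i)%N -> (i < j)%N -> (j < k)%N -> (k < l)%N -> (l <= 8)%N ->
  dx4 R i j k l = basis_form R (set8 [:: i.-1; j.-1; k.-1; l.-1]).
Proof.
move=> i0 ij jk kl l8; rewrite /dx4 /idx dx4_basis ?inordK; try lia.
congr basis_form; apply/setP => a; rewrite !inE.
by rewrite -!(inj_eq val_inj) /= !inordK; lia.
Qed.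

(** The hypotheses single out the increasing lists with entries below 8, which are determined by
    their sets. *)
Lemma set8_eq l m : compl8 (compl8 l) = l -> compl8 (compl8 m) = m ->
  (set8 l == set8 m) = (l == m).
Proof.
move=> <- <-; apply/eqP/eqP => [/setP e|-> //].
apply: eq_in_filter => i; rewrite mem_iota /= => i8.
have G x : (i \in compl8 x) = (i \notin x) by rewrite mem_filter mem_iota /= i8 andbT.
by have := e (Ordinal i8); rewrite !inE /= !G.
Qed.

Lemma Omega0_set8 l : compl8 (compl8 l) = l -> Omega0 R (set8 l) = (omega_coef l)%:~R.
Proof.
move=> ll; rewrite /Omega0 !dx4_set8 // !ffunE !set8_eq //.
rewrite /omega_coef /omega_terms /= /parity_sign /=.
have E (b : bool) (c : int) : (if b then c else 0)%:~R = c%:~R * b%:R :> R.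
  by case: b; rewrite ?mulr1 ?mulr0.
rewrite !intrD !E /= !mul1r !mulrN1z !mulN1r !addrA addr0.
by [].
Qed.

Definition two_form (V : lmodType R) (w : ext V) (p : 'I_8 * 'I_8) : V :=
  w [set p.1; p.2]%SET.

Lemma star_wedge_Omega0 (w : ext R^o) S : has_degree 2 w ->
  hodge_star (wedge (Omega0 R) w) S =
  \sum_(T : {set 'I_8} | #|T| == 2%N)
     if T \subset (~: S)%SET then
       shuffle_sign R (~: S)%SET S * shuffle_sign R (~: S :\: T)%SET T
       * (Omega0 R (~: S :\: T)%SET) * w T else 0.
Proof.
move=> w2; rewrite !ffunE /GRing.scale /= mulr_sumr.
(* Relative complement in [~: S] is an involution on the subsets of [~: S]; it makes the argument of
   [w] the summation variable. *)
rewrite (reindex_onto (fun T => ~: S :\: T)%SET (fun T => ~: S :\: T)%SET) /=; last first.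
  by move=> T TS; rewrite finset.setDDr finset.setDv finset.set0U; apply/finset.setIidPr.
rewrite [RHS]big_mkcond [LHS]big_mkcond /=; apply: eq_bigr => T _.
rewrite finset.subsetDl /= finset.setDDr finset.setDv finset.set0U.
rewrite (sameP eqP finset.setIidPr).
case: ifP => TS; last by case: ifP.
rewrite (finset.setIidPr TS); case: ifP => T2; first by rewrite !mulrA.
by rewrite w2 ?T2 // !mulr0.
Qed.

Lemma star_wedge_Omega0_pair (w : ext R^o) (i j : 'I_8) : has_degree 2 w -> (i < j)%N ->
  hodge_star (wedge (Omega0 R) w) [set i; j]%SET =
  \sum_(p : 'I_8 * 'I_8 | (p.1 < p.2)%N) (star_coef i j p.1 p.2)%:~R * (two_form w p : R).
Proof.
move=> w2 ij; rewrite star_wedge_Omega0 // sum_card2; apply: eq_bigr => -[k l] /= kl.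
have S2 (a b : 'I_8) : [set a; b]%SET = set8 [:: a : nat; b : nat].
  by apply/setP => c; rewrite !inE -!(inj_eq val_inj).
have sub : ([set k; l]%SET \subset ~: [set i; j]%SET) =
    ~~ (((k : nat) \in [:: i : nat; j : nat]) || ((l : nat) \in [:: i : nat; j : nat])).
  rewrite finset.subUset !finset.sub1set !inE -!(inj_eq val_inj); by rewrite -negb_or.
rewrite sub /star_coef; case: ifP => [/negbTE -> | /negbFE -> ]; last by rewrite mulr0z mul0r.
rewrite /two_form /=; congr (_ * _).
have -> : (~: [set i; j] :\: [set k; l])%SET = set8 (compl8 [:: i : nat; j : nat; k : nat; l : nat]).
  rewrite -set8C; apply/setP => c; rewrite !inE -!(inj_eq val_inj) /=.
  by case: ((c : nat) == i); case: ((c : nat) == j); case: ((c : nat) == k); case: ((c : nat) == l).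
rewrite S2 set8C (S2 k l).
have cu x : uniq (compl8 x) by rewrite filter_uniq // iota_uniq.
have c8 x : all (fun i => i < 8)%N (compl8 x).
  by apply/allP => a; rewrite mem_filter mem_iota => /andP[].
rewrite !shuffle_sign_set8 //; try by rewrite /= ?ltn_ord // inE andbT; lia.
rewrite Omega0_set8; last first.
  rewrite {1}/compl8 [in RHS]/compl8; apply: eq_in_filter => a a8.
  by rewrite mem_filter a8 andbT negbK [in LHS]mem_filter a8 andbT.
by rewrite -exprD -parity_signE -intrM.
Qed.
End OmegaSets.

Lemma sum_lt_pairs (V : nmodType) (F : 'I_8 -> 'I_8 -> V) : (forall k, F k k = 0) ->
  \sum_(k < 8) \sum_(l < 8) F k l = \sum_(p : 'I_8 * 'I_8 | (p.1 < p.2)%N) (F p.1 p.2 + F p.2 p.1).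
Proof.
move=> F0; rewrite pair_bigA big_split /= (bigID (fun p : 'I_8 * 'I_8 => (p.1 < p.2)%N)) /=; congr (_ + _).
rewrite (bigID (fun p : 'I_8 * 'I_8 => p.1 == p.2)) /= big1 ?add0r => [|[k l] /=]; last first.
  by case/andP => _ /eqP ->.
rewrite (reindex_inj (h := fun p : 'I_8 * 'I_8 => (p.2, p.1))) /=; last by move=> [a b] [c d] [-> ->].
apply: eq_bigl => -[k l] /=; rewrite -leqNgt leq_eqVlt.
by rewrite -(inj_eq val_inj) /= eq_sym; case: ltngtP.
Qed.

Lemma card2_ordered_pair (S : {set 'I_8}) : #|S| == 2%N ->
  exists2 p : 'I_8 * 'I_8, (p.1 < p.2)%N & S = [set p.1; p.2]%SET.
Proof.
case/cards2P=> a [b] [ab ->].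
case: (ltngtP a b) => [lt|gt|/val_inj e]; last by rewrite e eqxx in ab.
  by exists (a, b).
by exists (b, a) => //=; rewrite finset.setUC.
Qed.

(** * [Lambda27] as the span of an orthogonal frame *)

Section Lambda27Frame.
Variable R : realType.

Definition J (b i j : 'I_8) : R := (J_coef b i j)%:~R.

Lemma J_skew b i j : J b i j = - J b j i.
Proof. by rewrite /J J_coef_skew mulrNz. Qed.

Lemma J_diag b i : J b i i = 0.
Proof. by have := J_skew b i i; move: (J b i i) => x; lra. Qed.

Lemma kronE (a b : 'I_8) : (kron a b)%:~R = (a == b)%:R :> R.
Proof. by rewrite /kron -(inj_eq val_inj); case: eqP. Qed.

Lemma J_left (i j k l : 'I_8) :
  \sum_(b < 8) J b k l * J b i j + \sum_(b < 8) J b i l * J b k j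
  + (k == l)%:R * (i == j)%:R + (i == l)%:R * (k == j)%:R = 2 * ((k == i)%:R * (l == j)%:R).
Proof.
have S (a c d e : 'I_8) : \sum_(b < 8) J b a c * J b d e = (\sum_(b < 8) J_coef b a c * J_coef b d e)%:~R.
  by rewrite (rmorph_sum intr) /=; apply: eq_bigr => b _; rewrite /J intrM.
by rewrite !S -!kronE -!intrM -!intrD J_clifford_left -mulr_natl intrM.
Qed.

Lemma J_right (b c k m : 'I_8) : (0 < b)%N ->
  \sum_(l < 8) J b k l * J c m l + \sum_(l < 8) J b m l * J c k l
  = 2 * ((b == c)%:R * (k == m)%:R).
Proof.
move=> b0.
have S (a d : 'I_8) : \sum_(l < 8) J b a l * J c d l = (\sum_(l < 8) J_coef b a l * J_coef c d l)%:~R.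
  by rewrite (rmorph_sum intr) /=; apply: eq_bigr => l _; rewrite /J intrM.
by rewrite !S -!kronE -!intrM -!intrD J_clifford_right // -mulr_natl intrM.
Qed.

Lemma J0 i j : J ord0 i j = 0.
Proof. by []. Qed.

Lemma J_orthogonal (b c : 'I_8) : (0 < b)%N ->
  \sum_(p : 'I_8 * 'I_8 | (p.1 < p.2)%N) J b p.1 p.2 * J c p.1 p.2 = 4 * (b == c)%:R.
Proof.
move=> b0; have row k : \sum_(l < 8) J b k l * J c k l = (b == c)%:R.
  by have := J_right c k k b0; rewrite eqxx mulr1; lra.
have F0 k : J b k k * J c k k = 0 by rewrite J_diag mul0r.
have := sum_lt_pairs (F := fun k l => J b k l * J c k l) F0; rewrite (eq_bigr _ (fun k _ => row k)) sumr_const card_ord.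
have -> : \sum_(p : 'I_8 * 'I_8 | (p.1 < p.2)%N) (J b p.1 p.2 * J c p.1 p.2 + J b p.2 p.1 * J c p.2 p.1) =
    (\sum_(p : 'I_8 * 'I_8 | (p.1 < p.2)%N) J b p.1 p.2 * J c p.1 p.2) *+ 2.
  rewrite -sumrMnl; apply: eq_bigr => p _.
  by rewrite (J_skew b p.2) (J_skew c p.2) mulrNN mulr2n.
by rewrite -[_ *+ 8]mulr_natl -[_ *+ 2]mulr_natl; lra.
Qed.

Lemma star_coef_J (i j k l : 'I_8) : (i < j)%N -> (k < l)%N ->
  (star_coef i j k l)%:~R = \sum_(b < 8) J b i j * J b k l - ((i, j) == (k, l))%:R :> R.
Proof.
move=> ij kl; rewrite star_coefE // intrB intrM !kronE -natrM mulnb -xpair_eqE.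
by rewrite (rmorph_sum intr) /=; congr (_ - _); apply: eq_bigr => b _; rewrite /J intrM.
Qed.

(** The inner product of [w] with the two-form of [J_b]. That two-form has squared norm 4, whence
    the [4^-1] in [frame_form]. *)
Definition frame_coord (V : lmodType R) (b : 'I_8) (w : ext V) : V :=
  \sum_(p : 'I_8 * 'I_8 | (p.1 < p.2)%N) J b p.1 p.2 *: two_form w p.

Lemma frame_coord0 (V : lmodType R) (w : ext V) : frame_coord ord0 w = 0.
Proof. by rewrite /frame_coord big1 // => p _; rewrite J0 scale0r. Qed.

Definition frame_form (V : lmodType R) (c : 'I_8 -> V) : ext V :=
  [ffun S : {set 'I_8} => \sum_(p : 'I_8 * 'I_8 | (p.1 < p.2)%N && (S == [set p.1; p.2]%SET))
     4^-1 *: \sum_(b < 8) J b p.1 p.2 *: c b].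

Lemma pair_set_inj (p r : 'I_8 * 'I_8) : (p.1 < p.2)%N -> (r.1 < r.2)%N ->
  ([set p.1; p.2] == [set r.1; r.2])%SET = (p == r).
Proof.
case: p r => [a b] [c d] /= ab cd; apply/eqP/eqP => [e|[-> ->] //].
have : a \in [set c; d]%SET by rewrite -e !inE eqxx.
have : b \in [set c; d]%SET by rewrite -e !inE eqxx orbT.
rewrite !inE => /orP[]/eqP eb /orP[]/eqP ea; subst => //.
- by rewrite ltnn in ab.
- by have := ltn_trans ab cd; rewrite ltnn.
- by rewrite ltnn in ab.
Qed.

Lemma two_form_frame_form (V : lmodType R) (c : 'I_8 -> V) (p : 'I_8 * 'I_8) : (p.1 < p.2)%N ->
  two_form (frame_form c) p = 4^-1 *: \sum_(b < 8) J b p.1 p.2 *: c b.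
Proof.
move=> lp; rewrite /two_form ffunE (big_pred1 p) // => r.
case lr : (r.1 < r.2)%N; last by apply/esym/negP => /eqP rp; rewrite rp lp in lr.
by rewrite pair_set_inj //= eq_sym.
Qed.

Lemma frame_form_degree (V : lmodType R) (c : 'I_8 -> V) : has_degree 2 (frame_form c).
Proof.
move=> S S2; rewrite ffunE big_pred0 // => p; apply/negP => /andP[lp /eqP SE].
by case/eqP: S2; rewrite SE cards2 -(inj_eq val_inj) neq_ltn lp.
Qed.

Lemma frame_coord_frame_form (V : lmodType R) (c : 'I_8 -> V) (b : 'I_8) : (0 < b)%N ->
  frame_coord b (frame_form c) = c b.
Proof.
move=> b0; rewrite /frame_coord.
under eq_bigr => p lp do rewrite two_form_frame_form // !scaler_sumr.
rewrite exchange_big /=.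
rewrite (eq_bigr (fun d => (b == d)%:R *: c d)) => [|d _].
  rewrite (bigD1 b) //= eqxx scale1r big1 ?addr0 // => d db.
  by rewrite eq_sym (negbTE db) scale0r.
under eq_bigr do rewrite !scalerA.
rewrite -scaler_suml; congr (_ *: _).
have := J_orthogonal d b0 => e.
transitivity (4^-1 * \sum_(p : 'I_8 * 'I_8 | (p.1 < p.2)%N) J b p.1 p.2 * J d p.1 p.2).
  by rewrite mulr_sumr; apply: eq_bigr => p _; rewrite mulrCA mulrA.
by rewrite e mulrA mulVf ?mul1r.
Qed.

Lemma Omega0_degree : has_degree 4 (Omega0 R).
Proof.
move=> U U4; rewrite /Omega0 !dx4_set8 // !ffunE.
have c4 (l : seq nat) : uniq l -> all (fun i => i < 8)%N l -> size l = 4%N -> (U == set8 l) = false.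
  move=> ul l8 l4; apply/negP => /eqP UE; case/eqP: U4.
  by rewrite UE -sum1_card (sum_set8 (fun _ => 1%N) ul l8) sum1_size.
by rewrite !c4 // !addr0 !subr0.
Qed.

Lemma frame_expansion (w : ext R^o) (p : 'I_8 * 'I_8) : (p.1 < p.2)%N -> has_degree 2 w ->
  hodge_star (wedge (Omega0 R) w) [set p.1; p.2]%SET =
  \sum_(b < 8) J b p.1 p.2 * (frame_coord b w : R) - (two_form w p : R).
Proof.
move=> lp w2; rewrite star_wedge_Omega0_pair //.
rewrite (eq_bigr (fun r : 'I_8 * 'I_8 => \sum_(b < 8) J b p.1 p.2 * (J b r.1 r.2 * (two_form w r : R))
   - (p == r)%:R * (two_form w r : R))); last first.
  move=> r lr; rewrite star_coef_J // mulrBl mulr_suml -!surjective_pairing.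
  by congr (_ - _); apply: eq_bigr => b _; rewrite mulrA.
rewrite sumrB exchange_big /=; congr (_ - _).
  by apply: eq_bigr => b _; rewrite -mulr_sumr.
rewrite (bigD1 p) //= eqxx mul1r big1 ?addr0 // => r /andP[_ rp].
by rewrite eq_sym (negbTE rp) mul0r.
Qed.

(** Since [star (Omega0 /\ w) = sum_b <w, J_b> J_b - w], the eigenvalue equation for 3 reads
    [4 w = sum_b <w, J_b> J_b]. *)
Lemma Lambda27P (w : ext R^o) : Lambda27 w <-> has_degree 2 w /\
  forall p : 'I_8 * 'I_8, (p.1 < p.2)%N ->
    two_form w p = 4^-1 *: \sum_(b < 8) J b p.1 p.2 *: frame_coord b w.
Proof.
split=> [[w2 ws]|[w2 wf]]; split=> //.
  move=> p lp; have := frame_expansion lp w2; rewrite ws ffunE /GRing.scale /= -/(two_form w p).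
  move: (two_form w p : R) (\sum_(b < 8) _ : R) => x y e.
  have exy : 4 * x = y by lra.
  by rewrite -exy; field.
apply/ffunP => S; rewrite [RHS]ffunE.
have [/card2_ordered_pair[p lp SE]|S2] := boolP (#|S| == 2%N); last first.
  (* A nonzero term would need a pair [T] inside [~: S] with four elements left over for [Omega0],
     which forces [S] to have two elements. *)
  rewrite w2 // scaler0 star_wedge_Omega0 // big1 // => T /eqP T2; case: ifP => // TS.
  rewrite (_ : Omega0 R _ = 0) ?mulr0 ?mul0r //; apply: Omega0_degree; apply/eqP => c4.
  case/eqP: S2; have := cardsC S; rewrite card_ord.
  by have := cardsD (~: S) T; rewrite c4 (finset.setIidPr TS) T2; have := subset_leq_card TS; lia.
rewrite SE frame_expansion // -/(two_form w p); have := wf p lp.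
rewrite /GRing.scale /=.
move: (two_form w p : R) (\sum_(b < 8) _ : R) => x y ->.
by field.
Qed.

Lemma Lambda27_frame_form (c : 'I_8 -> R^o) : Lambda27 (frame_form c).
Proof.
apply/Lambda27P; split; first exact: frame_form_degree.
move=> p lp; rewrite two_form_frame_form //; congr (_ *: _); apply: eq_bigr => b _.
have [b0|] := boolP (0 < b)%N; first by rewrite frame_coord_frame_form.
rewrite -eqn0Ngt => /eqP b0; have -> : b = ord0 by exact: val_inj.
by rewrite J0 !scale0r.
Qed.

Lemma ext_dot_two_form (v w : ext R^o) : has_degree 2 w ->
  ext_dot v w = \sum_(p : 'I_8 * 'I_8 | (p.1 < p.2)%N) (two_form v p : R) * two_form w p.
Proof.
move=> w2; rewrite -(sum_card2 (fun S => (v S : R) * w S)) /ext_dot (bigID (fun S : {set 'I_8} => #|S| == 2%N)) /=.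
by rewrite [X in _ + X]big1 ?addr0 // => S S2; rewrite w2 // mulr0.
Qed.

Lemma ext_dot_Lambda27 (v w : ext R^o) : Lambda27 w ->
  ext_dot v w = 4^-1 * \sum_(b < 8) (frame_coord b w : R) * frame_coord b v.
Proof.
move=> /Lambda27P[w2 wf]; rewrite ext_dot_two_form //.
rewrite (eq_bigr (fun p : 'I_8 * 'I_8 => \sum_(b < 8) 4^-1 * ((frame_coord b w : R) * (J b p.1 p.2 * (two_form v p : R))))).
  rewrite exchange_big mulr_sumr; apply: eq_bigr => b _.
  by rewrite -!mulr_sumr.
move=> p lp; rewrite wf // /GRing.scale /= mulrCA !mulr_sumr; apply: eq_bigr => b _.
move: (J b p.1 p.2) (frame_coord b w : R) (two_form v p : R) => x y z.
by clear; ring.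
Qed.

Lemma frame_coordB (V : lmodType R) b (v w : ext V) :
  frame_coord b (v - w) = frame_coord b v - frame_coord b w.
Proof.
rewrite /frame_coord -sumrB; apply: eq_bigr => p _.
by rewrite /two_form !ffunE scalerBr.
Qed.

(** [pi27] is a choice, known only through its defining property. That [w] has this property rules
    out the default value 0, and orthogonality to the frame then fixes all coordinates of the chosen
    form. *)
Lemma pi27_eq (x w : ext R^o) : Lambda27 w ->
  (forall b, frame_coord b x = frame_coord b w) -> pi27 x = w.
Proof.
move=> wL xw.
pose P := [set p : ext R^o | Lambda27 p /\ forall q, Lambda27 q -> ext_dot (x - p) q = 0].
have Pw : P w.
  split=> // q qL; rewrite ext_dot_Lambda27 // big1 ?mulr0 // => b _.
  by rewrite frame_coordB xw subrr mulr0.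
have [pL pq] : P (pi27 x) by rewrite /pi27; apply: (xgetPex 0); exists w.
have cE b : frame_coord b (pi27 x) = frame_coord b w.
  have [b0|] := boolP (0 < b)%N; last first.
    rewrite -eqn0Ngt => /eqP b0; have -> : b = ord0 by exact: val_inj.
    by rewrite !frame_coord0.
  (* Testing against the form whose only nonzero coordinate is the one at [b] isolates that
     coordinate of the error. *)
  pose c (d : 'I_8) : R^o := (b == d)%:R.
  have e0 := pq _ (Lambda27_frame_form c).
  have := e0; rewrite ext_dot_Lambda27; last exact: Lambda27_frame_form.
  rewrite (bigD1 b) //= big1 ?addr0 => [|d db]; last first.
    have [d0|] := boolP (0 < d)%N.
      by rewrite frame_coord_frame_form // /c eq_sym (negbTE db) mul0r.
    rewrite -eqn0Ngt => /eqP d0; have -> : d = ord0 by exact: val_inj.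
    by rewrite frame_coord0 mul0r.
  rewrite frame_coord_frame_form // /c eqxx mul1r frame_coordB xw => /eqP.
  by rewrite mulf_eq0 invr_eq0 pnatr_eq0 /= subr_eq0 => /eqP.
have [p2 pf] := (Lambda27P _).1 pL; have [w2 wf] := (Lambda27P _).1 wL.
apply/ffunP => S; have [/card2_ordered_pair[p lp SE]|S2] := boolP (#|S| == 2%N); last first.
  by rewrite p2 // w2.
rewrite SE; apply: etrans (pf p lp) _; apply: etrans _ (esym (wf p lp)).
by congr (_ *: _); apply: eq_bigr => d _; rewrite cE.
Qed.

Lemma frame_coord_pi27 (x : ext R^o) b : frame_coord b (pi27 x) = frame_coord b x.
Proof.
pose w := frame_form (fun d => frame_coord d x).
have xw d : frame_coord d x = frame_coord d w.
  have [d0|] := boolP (0 < d)%N; first by rewrite frame_coord_frame_form.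
  rewrite -eqn0Ngt => /eqP d0; have -> : d = ord0 by exact: val_inj.
  by rewrite !frame_coord0.
by rewrite (pi27_eq (Lambda27_frame_form _) xw) xw.
Qed.
End Lambda27Frame.

Section MatrixLambda27.
Variable R : realType.
Implicit Types (x w : ext 'M[R]_3).

Lemma frame_coord_entry w b a c : frame_coord b (entry w a c) = frame_coord b w a c.
Proof.
rewrite /frame_coord summxE; apply: eq_bigr => p _.
by rewrite /two_form ffunE mxE.
Qed.

Lemma Lambda27_mxP w : Lambda27_mx w <-> has_degree 2 w /\
  forall p : 'I_8 * 'I_8, (p.1 < p.2)%N ->
    two_form w p = 4^-1 *: \sum_(b < 8) J R b p.1 p.2 *: frame_coord b w.
Proof.
have E p a c : (4^-1 *: \sum_(b < 8) J R b p.1 p.2 *: frame_coord b w) a c =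
   4^-1 *: \sum_(b < 8) J R b p.1 p.2 *: frame_coord b (entry w a c) :> R^o.
  rewrite mxE summxE; congr (_ * _); apply: eq_bigr => b _.
  by rewrite frame_coord_entry mxE.
split=> [wL|[w2 wf] a c].
  split=> [S S2|p lp]; apply/matrixP => a c.
    by have /Lambda27P[/(_ S S2) + _] := wL a c; rewrite ffunE mxE.
  have /Lambda27P[_ /(_ p lp)] := wL a c; rewrite {1}/two_form ffunE => h.
  by rewrite E -h.
apply/Lambda27P; split=> [S S2|p lp]; first by rewrite ffunE w2 // mxE.
by rewrite -E -wf // /two_form ffunE.
Qed.

Lemma pi27_mx_eq x w : Lambda27_mx w ->
  (forall b, frame_coord b x = frame_coord b w) -> pi27_mx x = w.
Proof.
move=> wL xw; apply/ffunP => S; rewrite ffunE; apply/matrixP => a c; rewrite mxE.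
rewrite (@pi27_eq _ _ (entry w a c)) ?ffunE // => b.
by rewrite !frame_coord_entry xw.
Qed.

Lemma frame_coord_pi27_mx x b : frame_coord b (pi27_mx x) = frame_coord b x.
Proof.
apply/matrixP => a c; rewrite -!frame_coord_entry -(frame_coord_pi27 (entry x a c)).
congr frame_coord; apply/ffunP => S; by rewrite !ffunE mxE.
Qed.
End MatrixLambda27.

(** * Exterior derivatives in coordinates *)

Section ExteriorDerivative.
Variables (R : realType) (V : normedModType R).
Local Notation E := 'rV[R]_8.
Local Notation e_ i := (delta_mx 0 i : 'rV[R]_8).
Implicit Types (w : Defs.form R V) (x : E) (i j k l : 'I_8).

Lemma ext_dE w x U : ext_d w x U = \sum_(i < 8)
  if i \in U then shuffle_sign R [set i]%SET (U :\ i)%SET *: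
    partial i (fun y => w y (U :\ i)%SET) x else 0.
Proof.
rewrite /ext_d sum_ffunE; apply: eq_bigr => i _.
by rewrite wedge_dx; case: ifP => // iU; rewrite ffunE.
Qed.

Lemma ext_d_degree w x n : (forall y, has_degree n (w y)) -> has_degree n.+1 (ext_d w x).
Proof.
move=> wn U Un; rewrite ext_dE big1 // => i _; case: ifP => // iU.
rewrite (_ : (fun y => w y (U :\ i)%SET) = (fun=> 0)) ?partial_cst ?scaler0 //.
apply/funext => y; apply: wn; apply: contraNneq Un.
by rewrite (cardsD1 i U) iU => ->.
Qed.

Lemma ext_d_function w x k :
  ext_d w x [set k]%SET = partial k (fun y => w y finset.set0) x.
Proof.
rewrite ext_dE (bigD1 k) //= big1 ?addr0 => [|i ik].
  rewrite inE eqxx finset.setDv shuffle_sign1_lt ?scale1r // => b.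
  by rewrite inE.
by rewrite inE (negbTE ik).
Qed.

Lemma ext_d_two_form w x (p : 'I_8 * 'I_8) : (p.1 < p.2)%N ->
  two_form (ext_d w x) p =
  partial p.1 (fun y => w y [set p.2]%SET) x - partial p.2 (fun y => w y [set p.1]%SET) x.
Proof.
case: p => k l /= kl; have kNl : k != l by rewrite -(inj_eq val_inj) neq_ltn kl.
rewrite /two_form /= ext_dE (bigD1 k) //= (bigD1 l) /=; last by rewrite eq_sym.
rewrite big1 ?addr0 => [|i /andP[ik il]]; last by rewrite !inE (negbTE ik) (negbTE il).
have E1 : ([set k; l] :\ k)%SET = [set l]%SET.
  by rewrite finset.setU1K // inE.
have E2 : ([set k; l] :\ l)%SET = [set k]%SET.
  by rewrite finset.setUC finset.setU1K // inE eq_sym.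
rewrite !inE !eqxx orbT /= E1 E2 shuffle_sign1_lt ?scale1r => [|b]; last first.
  by rewrite inE => /eqP ->.
by rewrite shuffle_sign1_gt // scaleN1r.
Qed.

Lemma frame_coord_ext_d w x b :
  frame_coord b (ext_d w x) =
  \sum_(k < 8) \sum_(l < 8) J R b k l *: partial k (fun y => w y [set l]%SET) x.
Proof.
rewrite sum_lt_pairs => [|k]; last by rewrite J_diag scale0r.
apply: eq_bigr => p lp; rewrite ext_d_two_form // (J_skew _ b p.2) scaleNr.
by rewrite scalerBr.
Qed.

End ExteriorDerivative.

(** * Pullback by diagonal isometries *)

Section Pullback.
Variable R : realType.
Local Notation E := 'rV[R]_8.
Local Notation e_ i := (delta_mx 0 i : 'rV[R]_8).
Implicit Types (x : E) (i j k l : 'I_8).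

Lemma partial_affine_coord (g : E -> E) (s : 'I_8 -> R) x i k (c : R) : signed_affine g s ->
  partial k (fun y => g y 0 i *: (c : R^o) : R^o) x = c * (s i * (k == i)%:R).
Proof.
move=> [_ [t gE]].
have gd : (fun y => g y 0 i *: (c : R^o) : R^o) =
    (fun y => (c * s i) *: (y 0 i : R^o) + (c * t 0 i)).
  by apply/funext => y; rewrite gE /GRing.scale /= mulrC mulrDr mulrA.
have dc : differentiable (fun y : E => y 0 i : R^o) x by exact: differentiable_coord.
rewrite gd (@partialD R R^o (fun y => (c * s i) *: (y 0 i : R^o)) (fun=> c * t 0 i)); last first.
- exact: differentiable_cst.
- exact: differentiableZ.
rewrite partial_cst addr0 partialZ // /GRing.scale /= -mulrA; congr (_ * (_ * _)).
have := @partial_mx R 1 8 id k x 0 i.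
rewrite /partial derive_id mxE eqxx /= eq_sym => <- //.
Qed.

Lemma ext_d_affine_coord (g : E -> E) (s : 'I_8 -> R) x i : signed_affine g s ->
  ext_d (fun_form (fun y => g y 0 i)) x = s i *: basis_form R [set i]%SET.
Proof.
move=> gs; apply/ffunP => U; rewrite ext_dE !ffunE.
rewrite (eq_bigr (fun k => if k == i then s i * (U == [set i]%SET)%:R else 0)); last first.
  move=> k _; rewrite /fun_form.
  under eq_fun do rewrite ffunE /ext_one ffunE.
  rewrite (partial_affine_coord _ _ _ _ gs).
  case: (k =P i) => [->|_]; last by rewrite !mulr0 scaler0; case: ifP.
  case iU : (i \in U); last first.
    by case: eqP => [UE|_]; [move: iU; rewrite UE inE eqxx|rewrite mulr0].
  have -> : (U == [set i]%SET) = (U :\ i == finset.set0)%SET.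
    apply/eqP/eqP => [->|U0]; first by rewrite finset.setDv.
    by rewrite -(finset.setD1K iU) U0 finset.setU0.
  case: (U :\ i =P finset.set0)%SET => [->|_]; last by rewrite mul0r scaler0 mulr0.
  rewrite shuffle_sign1_lt => [|b]; last by rewrite inE.
  by rewrite scale1r mul1r.
by rewrite -big_mkcond big_pred1_eq.
Qed.

(** [enum S] is increasing, so every factor is wedged in front of larger indices and no reordering
    sign arises. *)
Lemma wedge_affine_coords (g : E -> E) (s : 'I_8 -> R) x (S : {set 'I_8}) : signed_affine g s ->
  \big[@wedge R R^o / ext_one R]_(i <- enum S) ext_d (fun_form (fun y => g y 0 i)) x =
  (\prod_(i in S) s i) *: basis_form R S.
Proof.
move=> gs.
have srt : sorted (fun i j : 'I_8 => (i < j)%N) (enum S).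
  rewrite /enum_mem -enumT; apply: sorted_filter => [a b c|]; first exact: ltn_trans.
  have := iota_ltn_sorted 0 8; rewrite -val_enum_ord sorted_map.
  by [].
have -> : basis_form R S = basis_form R [set i in enum S]%SET.
  by congr basis_form; apply/setP => i; rewrite inE mem_enum.
rewrite -big_enum; elim: (enum S) srt => [_|a l IH /= al].
  rewrite !big_nil scale1r ext_one_basis; congr basis_form.
rewrite !big_cons IH; last exact: path_sorted al.
rewrite (ext_d_affine_coord _ _ gs) -scalerA wedgeZl; congr (_ *: _).
have la b : b \in [set i in l]%SET -> (a < b)%N.
  rewrite inE => bl; have tr : transitive (fun i j : 'I_8 => (i < j)%N).
    by move=> c d e; exact: ltn_trans.
  by have /allP := order_path_min tr al; apply.
rewrite -[basis_form R [set a]%SET]/(dx R a) wedge_dx_basis //; congr (_ *: basis_form _ _).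
by apply/setP => i; rewrite !inE.
Qed.

Lemma pullback_signed_affine (V : normedModType R) (g : E -> E) (s : 'I_8 -> R) (w : Defs.form R V) x T :
  signed_affine g s -> pullback g w x T = (\prod_(i in T) s i) *: w (g x) T.
Proof.
move=> gs; rewrite ffunE (bigD1 T) //= big1 ?addr0 => [|S ST].
  by rewrite (wedge_affine_coords _ _ gs) !ffunE eqxx /GRing.scale /= mulr1.
rewrite (wedge_affine_coords _ _ gs) !ffunE eq_sym (negbTE ST).
by rewrite mulr0n scaler0 scale0r.
Qed.
End Pullback.

(** * The orbifold group and so(3) *)

Section OrbifoldGroup.
Variable R : realType.
Local Notation E := 'rV[R]_8.

Lemma signed_affine_comp (g h : E -> E) s s' : signed_affine g s -> signed_affine h s' ->
  signed_affine (g \o h) (fun i => s i * s' i).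
Proof.
move=> [s1 [t gE]] [s1' [t' hE]]; split=> [i|]; first by rewrite exprMn s1 s1' mulr1.
exists (\row_i (s i * t' 0 i + t 0 i)) => x i /=.
by rewrite gE hE mxE mulrDr addrA mulrA.
Qed.

Lemma signed_affine_inv (g h : E -> E) s : signed_affine g s -> g \o h = id ->
  signed_affine h s.
Proof.
move=> [s1 [t gE]] gh; split=> //; exists (\row_i (- s i * t 0 i)) => x i.
have : g (h x) 0 i = x 0 i by rewrite -[g (h x)]/((g \o h) x) gh.
rewrite gE mxE => <-; rewrite mulrDr mulrA -expr2 s1 mul1r mulNr.
by rewrite addrK.
Qed.

Lemma signed_affine_generator (g : E -> E) : @orb_generators R g ->
  exists s, signed_affine g s.
Proof.
have sgn (P : 'I_8 -> bool) i : ((-1) ^+ (P i) : R) ^+ 2 = 1 by rewrite sqrr_sign.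
have X x k (i : 'I_8) : k.-1 = i -> coord8 x k = x 0 i :> R.
  by move=> ki; rewrite /coord8 /idx ki inord_val.
pose shift (P : 'I_8 -> bool) : E := \row_i (if P i then 1 / 2 else 0).
case=> [[[[->|->]|->]|->]|[k _ <-]].
- exists (fun i : 'I_8 => (-1) ^+ (i < 4)%N); split; first exact: sgn.
  exists 0 => x [i i8]; rewrite /alpha /point8 !mxE addr0.
  by do 8?[case: i i8 => [|i] i8 //=; first by rewrite (X _ _ (Ordinal i8)) // ?expr0 ?expr1 ?mul1r ?mulN1r].
- exists (fun i : 'I_8 => (-1) ^+ (4 <= i)%N); split; first exact: sgn.
  exists 0 => x [i i8]; rewrite /beta /point8 !mxE addr0.
  by do 8?[case: i i8 => [|i] i8 //=; first by rewrite (X _ _ (Ordinal i8)) // ?expr0 ?expr1 ?mul1r ?mulN1r].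
- pose P (i : 'I_8) := (i : nat) \in [:: 0; 1; 4; 5]%N.
  exists (fun i : 'I_8 => (-1) ^+ (P i)); split; first exact: sgn.
  exists (shift P) => x [i i8]; rewrite /gamma /point8 !mxE /P /=.
  by do 8?[case: i i8 => [|i] i8 //=; first by rewrite (X _ _ (Ordinal i8)) // ?expr0 ?expr1 ?mul1r ?mulN1r ?addr0 // addrC].
- pose P (i : 'I_8) := (i : nat) \in [:: 0; 2; 4; 6]%N.
  pose Q (i : 'I_8) := (i : nat) \in [:: 2; 4; 6]%N.
  exists (fun i : 'I_8 => (-1) ^+ (P i)); split; first exact: sgn.
  exists (shift Q) => x [i i8]; rewrite /delta /point8 !mxE /P /Q /=.
  by do 8?[case: i i8 => [|i] i8 //=; first by rewrite (X _ _ (Ordinal i8)) // ?expr0 ?expr1 ?mul1r ?mulN1r ?addr0 // addrC].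
- exists (fun=> 1); split=> [i|]; first by rewrite expr1n.
  by exists (delta_mx 0 (idx k)) => x i; rewrite /tau mxE mul1r.
Qed.

Lemma signed_affine_pi1orb (g : E -> E) : @pi1orb R g -> exists s, signed_affine g s.
Proof.
elim=> {g} [g /signed_affine_generator//||g h _ [s gs] _ [s' hs]|g h _ [s gs] gh _].
- exists (fun=> 1); split=> [i|]; first by rewrite expr1n.
  by exists 0 => x i; rewrite mxE mul1r addr0.
- by exists (fun i => s i * s' i); exact: signed_affine_comp.
- by exists s; exact: signed_affine_inv gs gh.
Qed.

Lemma pi1orb_tau k : (1 <= k <= 8)%N -> @pi1orb R (tau k).
Proof. by move=> k8; apply: generated_mem; right; exists k. Qed.
End OrbifoldGroup.

(** * Rotations, involutions and the Klein four-group *)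

Section Rotations.
Variable R : realType.
Implicit Types (A B X : 'M[R]_3).

Lemma SO3_inv A : SO3 A -> invmx A = A^T.
Proof.
case=> AT _; have [uA _] := mulmx1_unit AT.
by rewrite -[RHS](mulKmx uA) AT mulmx1.
Qed.

Lemma SO3_unit A : SO3 A -> A \in unitmx.
Proof. by case=> AT _; case: (mulmx1_unit AT). Qed.

Lemma SO3_adj A : SO3 A -> \adj A = A^T.
Proof.
case=> AT dA; have := mul_adj_mx A; rewrite dA => e.
by rewrite -[LHS]mulmx1 -AT mulmxA e mul1mx.
Qed.

Lemma det2 (M : 'M[R]_2) : \det M = M 0 0 * M 1 1 - M 0 1 * M 1 0.
Proof.
rewrite (expand_det_row _ 0) !big_ord_recl big_ord0 addr0 /cofactor !det_mx11 !mxE /=.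
rewrite expr0 expr1 mul1r mulN1r mulrN.
by congr (_ * M _ _ - M _ _ * M _ _); apply/val_inj.
Qed.

Definition at3 (m n : nat) (A : 'M[R]_(m.+1, n.+1)) (i j : nat) : R := A (inord i) (inord j).

Lemma at3E m n (A : 'M[R]_(m.+1, n.+1)) i j : A i j = at3 A i j.
Proof. by rewrite /at3 !inord_val. Qed.

Definition minor3 (f : nat -> nat -> R) (i j k l : nat) : R := f i k * f j l - f i l * f j k.

(** The adjugate of a rotation is its transpose, so its cofactor matrix is [A] itself. Taking the
    index pairs in cyclic order absorbs the signs of the cofactors. *)
Lemma SO3_cofactors A : SO3 A -> let f := at3 A in
  [/\ [/\ minor3 f 1 2 1 2 = f 0 0, minor3 f 1 2 2 0 = f 0 1 & minor3 f 1 2 0 1 = f 0 2],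
      [/\ minor3 f 2 0 1 2 = f 1 0, minor3 f 2 0 2 0 = f 1 1 & minor3 f 2 0 0 1 = f 1 2] &
      [/\ minor3 f 0 1 1 2 = f 2 0, minor3 f 0 1 2 0 = f 2 1 & minor3 f 0 1 0 1 = f 2 2]]%N.
Proof.
move=> AS f; have adj := SO3_adj AS.
have cE (i j : 'I_3) : cofactor A i j = f i j.
  by have /matrixP/(_ j i) := adj; rewrite !mxE => ->; exact: at3E.
have c (i j : 'I_3) := cE i j.
rewrite /minor3; do 2!split; [move: (c 0 0)|move: (c 0 1)|move: (c 0 (inord 2))|
  move: (c 1 0)|move: (c 1 1)|move: (c 1 (inord 2))|
  move: (c (inord 2) 0)|move: (c (inord 2) 1)|move: (c (inord 2) (inord 2))];
rewrite /cofactor det2 !mxE !at3E /= ?inordK // /bump /= => <-; rewrite -/f /=; ring.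
Qed.

Lemma sum3 (F : 'I_3 -> R) : \sum_i F i = F 0 + F 1 + F (inord 2).
Proof.
rewrite !big_ord_recl big_ord0 addr0 addrA.
by congr (F _ + F _ + F _); apply/val_inj; rewrite //= inordK.
Qed.

Lemma at3_sym A i j : A^T = A -> at3 A i j = at3 A j i.
Proof. by move=> AA; rewrite /at3 -[in LHS]AA mxE. Qed.

Lemma mxtrace_mul_tr_eq0 (M : 'M[R]_3) : \tr (M *m M^T) = 0 -> M = 0.
Proof.
have E : \tr (M *m M^T) = \sum_i \sum_j M i j ^+ 2.
  rewrite /mxtrace; apply: eq_bigr => i _; rewrite mxE; apply: eq_bigr => j _.
  by rewrite mxE.
move/eqP; rewrite E psumr_eq0 => [/allP M0|i _]; last by apply: sumr_ge0 => j _; exact: sqr_ge0.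
apply/matrixP => i j; rewrite mxE; have := M0 i (mem_index_enum i).
rewrite /= psumr_eq0 => [/allP/(_ j (mem_index_enum j))|k _]; last exact: sqr_ge0.
by rewrite /= sqrf_eq0 => /eqP.
Qed.

Lemma SO3_involution_sym A : SO3 A -> A *m A = 1%:M -> A^T = A.
Proof.
by move=> AS AA; rewrite -(SO3_inv AS) -[LHS]mulmx1 -AA mulmxA mulVmx ?mul1mx // SO3_unit.
Qed.

(** [(tr A)^2 - tr (A^2)] is twice the sum of the principal minors of order 2, which is [2 tr A] by
    the cofactor identities. With [tr (A^2) = 3] this leaves the traces 3 and -1, and trace 3 would
    give [A - 1] norm zero. *)
Lemma SO3_involution_trace A : SO3 A -> A *m A = 1%:M -> A != 1%:M -> \tr A = -1.
Proof.
move=> AS AA A1; have AT := SO3_involution_sym AS AA.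
have t3 : \tr (1%:M : 'M[R]_3) = 3 by rewrite mxtrace1.
have tA : \tr A = at3 A 0 0 + at3 A 1 1 + at3 A 2 2.
  by rewrite /mxtrace sum3 !at3E /= inordK.
have t2 : \tr (A *m A) = 3 by rewrite AA.
have q : \tr A ^+ 2 = 3 + 2 * \tr A.
  have := t2; rewrite tA /mxtrace sum3 !mxE !sum3 !at3E /= !inordK //.
  have [[c00 _ _] [_ c11 _] [_ _ c22]] := SO3_cofactors AS.
  move: c00 c11 c22; rewrite /minor3 (at3_sym 1 0 AT) (at3_sym 2 0 AT) (at3_sym 2 1 AT).
  move: (at3 A 0 0) (at3 A 0 1) (at3 A 0 2) (at3 A 1 1) (at3 A 1 2) (at3 A 2 2).
  by clear; move=> a b c d e f; lra.
have /eqP : (\tr A - 3) * (\tr A + 1) = 0.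
  by move: q; move: (\tr A) => t q; rewrite mulrDr mulrBl mulrBl mulr1 -expr2 q; ring.
rewrite mulf_eq0 subr_eq0 addr_eq0 => /orP[/eqP tr3|/eqP //].
case/eqP: A1; apply/eqP; rewrite -subr_eq0; apply/eqP; apply: mxtrace_mul_tr_eq0.
rewrite linearB /= AT trmx1 mulmxBr mulmxBl AA mulmx1 mul1mx.
by rewrite !linearB /= t3 tr3; ring.
Qed.

(** The vector [(X_21, X_02, X_10)]: the isomorphism of so(3) with R^3 that turns the adjoint action
    into the standard one. *)
Definition axial X : 'cV[R]_3 := \col_(i < 3) at3 X ((i + 2) %% 3)%N ((i + 1) %% 3)%N.

Lemma so3_at3 X i j : so3 X -> at3 X j i = - at3 X i j.
Proof. by move=> /matrixP/(_ (inord i) (inord j)); rewrite !mxE. Qed.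

Lemma so3_at3_diag X i : so3 X -> at3 X i i = 0.
Proof. by move=> Xs; have := so3_at3 i i Xs; move: (at3 X i i) => x; lra. Qed.

Lemma axial_eq0 X : so3 X -> axial X = 0 -> X = 0.
Proof.
move=> Xs /matrixP ax.
have := ax (inord 0) 0; have := ax (inord 1) 0; have := ax (inord 2) 0.
rewrite !mxE !inordK //= => a2 a1 a0.
have b2 := so3_at3 1 0 Xs; have b1 := so3_at3 0 2 Xs; have b0 := so3_at3 2 1 Xs.
rewrite a2 oppr0 in b2; rewrite a1 oppr0 in b1; rewrite a0 oppr0 in b0.
apply/matrixP => i j; rewrite [RHS]mxE at3E.
case: i => [[|[|[|i]]] i3] //; case: j => [[|[|[|j]]] j3] //=; by rewrite ?so3_at3_diag.
Qed.

(* The cofactor matrix of [A] is [A] itself, and the entries of [A X A^T] are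
   the cofactors of [A] applied to the axial vector of [X]. *)
Lemma Ad_axial A X : SO3 A -> so3 X -> Ad A X = X -> A *m axial X = axial X.
Proof.
move=> AS Xs; rewrite /Ad (SO3_inv AS) => AX.
have AXe (u v : 'I_3) : X u v = \sum_l (\sum_k A u k * X k l) * A v l.
  rewrite -[in LHS]AX mxE; apply: eq_bigr => l _; rewrite !mxE; congr (_ * _).
have e21 := AXe (inord 2) (inord 1).
have e02 := AXe (inord 0) (inord 2).
have e10 := AXe (inord 1) (inord 0).
rewrite !sum3 !at3E /= ?inordK // !(so3_at3_diag _ Xs) in e21 e02 e10.
rewrite (so3_at3 2 1 Xs) (so3_at3 0 2 Xs) (so3_at3 1 0 Xs) in e21 e02 e10.
have [[c00 c01 c02] [c10 c11 c12] [c20 c21 c22]] := SO3_cofactors AS.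
rewrite /minor3 in c00 c01 c02 c10 c11 c12 c20 c21 c22.
apply/matrixP => i j; rewrite !mxE sum3 !mxE !at3E /= ?inordK //=.
case: i => [[|[|[|i]]] i3] //=.
- rewrite -c00 -c01 -c02 [in RHS]e21; ring.
- rewrite -c10 -c11 -c12 [in RHS]e02; ring.
- rewrite -c20 -c21 -c22 [in RHS]e10; ring.
Qed.

Lemma klein_four_one (H : set 'M[R]_3) (phi : 'Z_2 * 'Z_2 -> 'M[R]_3) : H `<=` @SO3 R ->
  (forall u v, phi (u + v) = phi u *m phi v) -> range phi = H -> phi 0 = 1%:M.
Proof.
move=> HS phiD phiH; have uphi : phi 0 \in unitmx.
  by apply: SO3_unit; apply: HS; rewrite -phiH; exists 0.
by have := phiD 0 0; rewrite addr0 => e; rewrite -[LHS](mulKmx uphi) -e mulVmx.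
Qed.

Lemma klein_four_involution (H : set 'M[R]_3) A : H `<=` @SO3 R -> klein_four H -> H A ->
  A *m A = 1%:M.
Proof.
move=> HS [phi [_ phiD phiH]]; rewrite -{1}phiH => -[u _ <-].
rewrite -phiD -(klein_four_one HS phiD phiH); congr phi; apply/eqP.
by case: u => [[[|[|a]] a2] [[|[|b]] b2]].
Qed.

(** The sum [S] of the four elements is symmetric with [S^2 = 4 S] and trace [3 - 1 - 1 - 1 = 0], so
    [tr (S S^T) = 0] and [S = 0]. A fixed vector satisfies [S v = 4 v], hence vanishes. *)
Lemma klein_four_fixed_so3 (H : set 'M[R]_3) X : H `<=` @SO3 R -> klein_four H -> so3 X ->
  (forall A, H A -> Ad A X = X) -> X = 0.
Proof.
move=> HS H4 Xs HX; have [phi [phi_inj phiD phiH]] := H4.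
have Hphi u : H (phi u) by rewrite -phiH; exists u.
have phiS u : SO3 (phi u) by exact: HS.
have phi0 : phi 0 = 1%:M by exact: klein_four_one phiD phiH.
have phi2 u : phi u *m phi u = 1%:M by exact: klein_four_involution H4 _.
pose S := \sum_u phi u.
have trS : \tr S = 0.
  rewrite /S linear_sum /= (bigD1 (0 : 'Z_2 * 'Z_2)) //= phi0 mxtrace1.
  rewrite (eq_bigr (fun=> -1)) => [|u u0]; last first.
    apply: SO3_involution_trace => //; apply: contra_neq u0 => u1.
    by apply: phi_inj; rewrite u1.
  have : \sum_(u : 'Z_2 * 'Z_2) (-1 : R) = - 4.
    by rewrite sumr_const card_prod !card_ord -[(_ * _)%N]/4%N mulNrn.
  rewrite (bigD1 (0 : 'Z_2 * 'Z_2)) //=; lra.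
have ST : S^T = S.
  rewrite /S linear_sum; apply: eq_bigr => u _ /=.
  exact: SO3_involution_sym.
have SS : S *m S = S *+ 4.
  rewrite {1}/S mulmx_suml (eq_bigr (fun=> S)) => [|u _].
    by rewrite sumr_const card_prod !card_ord.
  rewrite /S mulmx_sumr [RHS](reindex_inj (addrI u)).
  by apply: eq_bigr => w _; rewrite phiD.
have S0 : S = 0.
  by apply: mxtrace_mul_tr_eq0; rewrite ST SS linearMn /= trS mul0rn.
apply: axial_eq0 => //.
have : S *m axial X = axial X *+ 4.
  rewrite /S mulmx_suml (eq_bigr (fun=> axial X)) => [|u _].
    by rewrite sumr_const card_prod !card_ord.
  by apply: Ad_axial => //; exact: HX.
rewrite S0 mul0mx => /esym/eqP; rewrite -scaler_nat scaler_eq0 pnatr_eq0 /=.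
by move/eqP.
Qed.
End Rotations.

(** * The deformation complex *)

Section FrameAlgebra.
Variables (R : realType) (V : lmodType R).

(** Meant for [T k i j = d_k d_i a_j], where the right-hand side is the Laplacian of [a_l] minus
    [d_l (div a)]. *)
Lemma J_left_contract (T : 'I_8 -> 'I_8 -> 'I_8 -> V) l :
  (forall k i j, T k i j = T i k j) ->
  \sum_(b < 8) \sum_(k < 8) J R b k l *: (\sum_(i < 8) \sum_(j < 8) J R b i j *: T k i j)
  = \sum_(k < 8) T k k l - \sum_(i < 8) T l i i.
Proof.
move=> Tsym.
pose Q k i j : R := \sum_(b < 8) J R b k l * J R b i j.
have -> : \sum_(b < 8) \sum_(k < 8) J R b k l *: (\sum_(i < 8) \sum_(j < 8) J R b i j *: T k i j)
  = \sum_(k < 8) \sum_(i < 8) \sum_(j < 8) Q k i j *: T k i j.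
  rewrite exchange_big; apply: eq_bigr => k _ /=.
  under eq_bigr do rewrite scaler_sumr.
  rewrite exchange_big; apply: eq_bigr => i _ /=.
  under eq_bigr do rewrite scaler_sumr.
  rewrite exchange_big; apply: eq_bigr => j _ /=.
  by rewrite /Q scaler_suml; apply: eq_bigr => b _; rewrite scalerA.
set S := \sum_(k < 8) _.
(* By the symmetry of [T], only the part of [Q] symmetric in [k] and [i] counts; adding the two
   expressions of [S] brings in the relation [J_left]. *)
have S2 : S = \sum_(k < 8) \sum_(i < 8) \sum_(j < 8) Q i k j *: T k i j.
  rewrite /S exchange_big; apply: eq_bigr => k _; apply: eq_bigr => i _.
  by apply: eq_bigr => j _; rewrite Tsym.
have delta (I : 'I_8) (F : 'I_8 -> V) : \sum_(i < 8) (I == i)%:R *: F i = F I.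
  rewrite (bigD1 I) //= eqxx scale1r big1 ?addr0 // => i iI.
  by rewrite eq_sym (negbTE iI) scale0r.
have delta' (I : 'I_8) (F : 'I_8 -> V) : \sum_(i < 8) (i == I)%:R *: F i = F I.
  by rewrite -[RHS]delta; apply: eq_bigr => i _; rewrite eq_sym.
have : S + S = (\sum_(k < 8) T k k l - \sum_(i < 8) T l i i) *+ 2.
  rewrite {2}S2 /S -big_split /=.
  transitivity (\sum_(k < 8) (2 *: T k k l - (k == l)%:R *: (\sum_(i < 8) T k i i) - T k l k)).
    apply: eq_bigr => k _; rewrite -big_split /=.
    transitivity (\sum_(i < 8) (2 *: ((k == i)%:R *: T k i l) - (k == l)%:R *: T k i i
                                - (i == l)%:R *: T k i k)).
      apply: eq_bigr => i _; rewrite -big_split /=.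
      transitivity (\sum_(j < 8) (2 *: ((k == i)%:R *: ((l == j)%:R *: T k i j))
         - (k == l)%:R *: ((i == j)%:R *: T k i j) - (i == l)%:R *: ((k == j)%:R *: T k i j))).
        apply: eq_bigr => j _; rewrite -scalerDl !scalerA -!scalerBl; congr (_ *: _).
        rewrite -mulrA -(J_left R i j k l) /Q.
        by move: (\sum_(b < 8) _) (\sum_(b < 8) _) => x y; ring.
      by rewrite !sumrB -!scaler_sumr !delta.
    by rewrite !sumrB -!scaler_sumr delta delta'.
  rewrite !sumrB -scaler_sumr delta' scaler_nat mulrnBl -!addrA; congr (_ + _).
  rewrite mulr2n opprD; congr (_ + (_ - _)); apply: eq_bigr => k _.
  by rewrite Tsym.
rewrite -mulr2n => /eqP; rewrite -subr_eq0 -mulrnBl -scaler_nat scaler_eq0 pnatr_eq0 /=.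
by rewrite subr_eq0 => /eqP.
Qed.

(** Meant for a Hessian [T]: distinct frame indices decouple, and equal ones produce its trace, the
    Laplacian. *)
Lemma J_right_contract (T : 'I_8 -> 'I_8 -> V) (b c : 'I_8) : (0 < b)%N ->
  (forall k m, T k m = T m k) ->
  \sum_(k < 8) \sum_(l < 8) \sum_(m < 8) (J R b k l * J R c m l) *: T k m
  = (b == c)%:R *: \sum_(k < 8) T k k.
Proof.
move=> b0 Tsym.
pose Q k m : R := \sum_(l < 8) J R b k l * J R c m l.
have -> : \sum_(k < 8) \sum_(l < 8) \sum_(m < 8) (J R b k l * J R c m l) *: T k m
  = \sum_(k < 8) \sum_(m < 8) Q k m *: T k m.
  apply: eq_bigr => k _; rewrite exchange_big; apply: eq_bigr => m _ /=.
  by rewrite /Q scaler_suml.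
set S := \sum_(k < 8) _.
have S2 : S = \sum_(k < 8) \sum_(m < 8) Q m k *: T k m.
  by rewrite /S exchange_big; apply: eq_bigr => k _; apply: eq_bigr => m _; rewrite Tsym.
have : S + S = ((b == c)%:R *: \sum_(k < 8) T k k) *+ 2.
  rewrite {2}S2 /S -big_split /= scaler_sumr -sumrMnl; apply: eq_bigr => k _.
  rewrite -big_split (bigD1 k) //= big1 ?addr0 => [|m mk].
    by rewrite -scalerDl J_right // eqxx mulr1 -scalerA scaler_nat.
  by rewrite -scalerDl J_right // (eq_sym k) (negbTE mk) !mulr0 scale0r.
rewrite -mulr2n => /eqP; rewrite -subr_eq0 -mulrnBl -scaler_nat scaler_eq0 pnatr_eq0 /=.
by rewrite subr_eq0 => /eqP.
Qed.
End FrameAlgebra.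

Section AdLinear.
Variable R : realType.
Implicit Types (A B X : 'M[R]_3).

Lemma Ad_is_linear A : linear (Ad A).
Proof. by move=> k X Y; rewrite /Ad mulmxDr mulmxDl -scalemxAr -scalemxAl. Qed.
HB.instance Definition _ A := GRing.isLinear.Build R 'M[R]_3 'M[R]_3 _ (Ad A) (Ad_is_linear A).

Lemma Ad_sum (I : Type) (r : seq I) (P : pred I) A (F : I -> 'M[R]_3) :
  Ad A (\sum_(k <- r | P k) F k) = \sum_(k <- r | P k) Ad A (F k).
Proof. exact: linear_sum. Qed.

Lemma AdM A B X : SO3 A -> SO3 B -> Ad (A *m B) X = Ad A (Ad B X).
Proof.
move=> AS BS; have ABS : SO3 (A *m B).
  case: AS BS => [AT dA] [BT dB]; split; last by rewrite det_mulmx dA dB mulr1.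
  by rewrite trmx_mul mulmxA -(mulmxA A) BT mulmx1.
by rewrite /Ad !SO3_inv // trmx_mul !mulmxA.
Qed.

Lemma Ad1 X : Ad 1%:M X = X.
Proof. by rewrite /Ad invmx1 mulmx1 mul1mx. Qed.

Lemma so3D X Y : so3 X -> so3 Y -> so3 (X + Y).
Proof. by move=> Xs Ys; rewrite /so3 /= linearD /= Xs Ys opprD. Qed.

Lemma so3Z (k : R) X : so3 X -> so3 (k *: X).
Proof. by move=> Xs; rewrite /so3 /= linearZ /= Xs scalerN. Qed.

Lemma so3_0 : so3 (0 : 'M[R]_3).
Proof. by rewrite /so3 /= linear0 oppr0. Qed.

Lemma so3_sum (I : Type) (r : seq I) (P : pred I) (F : I -> 'M[R]_3) :
  (forall k, P k -> so3 (F k)) -> so3 (\sum_(k <- r | P k) F k).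
Proof. by move=> Fs; elim/big_ind : _ => //; [exact: so3_0|exact: so3D]. Qed.

Lemma so3_partial (f : 'rV[R]_8 -> 'M[R]_3) i x : smooth f -> (forall y, so3 (f y)) ->
  so3 (partial i f x).
Proof.
move=> sf fs; rewrite /so3 /=.
have df y : differentiable f y by exact: smooth_differentiable.
rewrite -(@partial_linear R 3 3 3 3 trmx f i x (df x)).
rewrite (_ : (fun y => (f y)^T) = (fun y => (-1) *: f y)); last first.
  by apply/funext => y; rewrite scaleN1r; exact: fs.
by rewrite partialZ // scaleN1r.
Qed.

Lemma so3_symmetrizes (f : 'rV[R]_8 -> 'M[R]_3) J x : (forall y, so3 (f y)) ->
  so3 (symmetrizes J f x).
Proof.
by move=> fs; elim: J x => [|j J IH] x /=; [exact: fs|apply: so3D; exact: IH].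
Qed.
End AdLinear.

(** * Consequences of the injectivity of the Laplacian *)

Section PoissonEquivariance.
Variables (R : realType) (J : seq 'I_8).
Local Notation E := 'rV[R]_8.
Implicit Types (u f : E -> 'M[R]_3).

(** Used to reduce identities between tame functions to identities between their Laplacians. *)
Lemma tame_eq u v : tame J u -> tame J v -> laplacian u = laplacian v -> u = v.
Proof.
move=> tu tv uv; have tv' := tameZ (-1) tv; have td := tameD tu tv'.
have su : smooth u by case: tu.
have sv : smooth v by case: tv.
have ld : laplacian (fun x => u x + -1 *: v x) = (fun=> 0).
  apply/funext => x; rewrite (laplacianD x su (smoothZ (-1) sv)) (laplacianZ (-1) x sv).
  by rewrite uv scaleN1r subrr.
apply/funext => x; apply/eqP; rewrite -subr_eq0; apply/eqP.
by have := congr1 (fun h => h x) (tame_mx_harmonic td ld); rewrite scaleN1r.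
Qed.

Lemma tame_so3 u : tame J u -> (forall x, so3 (laplacian u x)) -> forall x, so3 (u x).
Proof.
move=> tu lu x; have su : smooth u by case: tu.
have e : (fun y => (u y)^T) = (fun y => (-1) *: u y).
  apply: tame_eq; [exact: (@tame_linear R 3 3 3 3 trmx)|exact: tameZ|].
  apply/funext => y; rewrite (@laplacian_linear R 3 3 3 3 trmx _ y su) (laplacianZ (-1) y su) scaleN1r.
  exact: lu.
by have := congr1 (fun h => h x) e; rewrite /= scaleN1r.
Qed.

(** The Laplacian commutes with [g] and with the linear map [Ad A], and both operations preserve
    tameness. In use, [c] is the sign by which [g] acts on a [dx_S]. *)
Lemma tame_equivariant u (g : E -> E) (s : 'I_8 -> R) (c : R) A :
  signed_affine g s -> tame J u ->
  (forall x, c *: laplacian u (g x) = Ad A (laplacian u x)) ->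
  forall x, c *: u (g x) = Ad A (u x).
Proof.
move=> gs tu lu x; have su : smooth u by case: tu.
have e : (fun y => c *: u (g y)) = (fun y => Ad A (u y)).
  apply: tame_eq; [apply: tameZ; exact: tame_signed_affine gs tu|exact: tame_linear|].
  apply/funext => y; rewrite (laplacian_linear (Ad A) y su) (laplacianZ c y (smooth_signed_affine gs su)).
  by rewrite (laplacian_signed_affine y gs su) lu.
exact: (congr1 (fun h => h x) e).
Qed.

Lemma partial_equivariant u (g : E -> E) (s : 'I_8 -> R) (c : R) A i :
  signed_affine g s -> smooth u ->
  (forall x, c *: u (g x) = Ad A (u x)) ->
  forall x, (c * s i) *: partial i u (g x) = Ad A (partial i u x).
Proof.
move=> gs su ug x; have du y : differentiable u y by exact: smooth_differentiable.
rewrite -(partial_linear (Ad A) i (du x)).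
have <- : (fun y => c *: u (g y)) = (fun y => Ad A (u y)) by apply/funext => y; exact: ug.
rewrite partialZ; last exact: (smooth_differentiable x (smooth_signed_affine gs su)).
by rewrite (partial_signed_affine i gs (du _)) scalerA.
Qed.
End PoissonEquivariance.

(** * Sections of the adjoint bundle, and irreducibility *)

Section Sections.
Variables (R : realType) (rho : ('rV[R]_8 -> 'rV[R]_8) -> 'M[R]_3).
Local Notation E := 'rV[R]_8.
Local Notation e_ i := (delta_mx 0 i : 'rV[R]_8).
Hypothesis rho_rep : representation rho.
Hypothesis rho_image : klein_four (image_of rho).
Hypothesis rho_generated :
  generated (fun A B : 'M[R]_3 => A *m B) 1%:M
    [set rho (tau 4); rho (tau 5); rho (tau 8)] = image_of rho.
Local Notation J458 := [:: idx 4; idx 5; idx 8].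

Lemma image_SO3 : image_of rho `<=` @SO3 R.
Proof. by move=> _ [g pg <-]; apply: rho_rep.1. Qed.

Lemma rho_tau_involution k : (1 <= k <= 8)%N -> rho (tau k) *m rho (tau k) = 1%:M.
Proof.
move=> k8; apply: (klein_four_involution image_SO3 rho_image).
by exists (tau k) => //; exact: pi1orb_tau.
Qed.

Lemma fixed_by_image X : so3 X ->
  (forall k, k \in [:: 4; 5; 8]%N -> Ad (rho (tau k)) X = X) -> X = 0.
Proof.
move=> Xs Xk; apply: (klein_four_fixed_so3 image_SO3 rho_image Xs) => A HA.
(* Membership in [SO3] is carried through the induction because the composition law [AdM] and the
   formula for the inverse rely on it. *)
suff [] : SO3 A /\ Ad A X = X by [].
move: HA; rewrite -{1}rho_generated; elim=> {A} [A AS||A B _ [AS AX] _ [BS BX]|A B _ [AS AX] AB BA].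
- have HA : image_of rho A by rewrite -rho_generated; exact: generated_mem.
  split; first exact: image_SO3.
  by case: AS => [[->|->]|->]; apply: Xk.
- split; last exact: Ad1.
  by split; rewrite ?trmx1 ?mulmx1 ?det1.
- split; last by rewrite AdM // BX AX.
  case: AS BS => [AT dA] [BT dB]; split; last by rewrite det_mulmx dA dB mulr1.
  by rewrite trmx_mul mulmxA -(mulmxA A) BT mulmx1.
- have BE : B = A^T.
    by rewrite -(SO3_inv AS) -[RHS]mulmx1 -AB mulmxA mulVmx ?mul1mx // SO3_unit.
  have BS : SO3 B.
    case: AS => AT dA; split; last by rewrite BE det_tr.
    by rewrite BE trmxK mulmx1C.
  split=> //; rewrite -[in LHS]AX -AdM // BA; exact: Ad1.
Qed.

Lemma idx_surj (i : 'I_8) : exists2 k, (1 <= k <= 8)%N & idx k = i.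
Proof.
exists i.+1; first by rewrite /= ltn_ord.
by rewrite /idx /= inord_val.
Qed.

(** Translation by [e_4], [e_5] or [e_8] leaves the symmetrization invariant, yet by equivariance it
    also acts as [Ad (rho (tau k))]. The symmetrization is therefore fixed by generators of the
    image and vanishes. *)
Lemma tame_of_equivariant (f : E -> 'M[R]_3) : smooth f -> (forall x, so3 (f x)) ->
  (forall k x, (1 <= k <= 8)%N -> f (x + e_ (idx k)) = Ad (rho (tau k)) (f x)) ->
  tame J458 f.
Proof.
move=> sf fs fk.
have pf : periodic2 f.
  move=> i x; have [k k8 <-] := idx_surj i.
  have -> : 2 *: e_ (idx k) = e_ (idx k) + e_ (idx k) by rewrite scaler_nat mulr2n.
  have kS : SO3 (rho (tau k)) by apply: rho_rep.1; exact: pi1orb_tau.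
  by rewrite addrA !fk // -AdM // rho_tau_involution // Ad1.
split=> // x; apply: fixed_by_image; first exact: so3_symmetrizes.
move=> k k458; have k8 : (1 <= k <= 8)%N by move: k458; rewrite !inE => /or3P[]/eqP->.
rewrite -symmetrizes_linear.
have <- : (fun y => f (y + e_ (idx k))) = (fun y => Ad (rho (tau k)) (f y)).
  by apply/funext => y; exact: fk.
rewrite symmetrizes_shift symmetrizes_shift_mem //.
by move: k458; rewrite !inE => /or3P[]/eqP->; rewrite eqxx ?orbT.
Qed.

Lemma tau_signed_affine k : signed_affine (@tau R k) (fun=> 1).
Proof.
split=> [i|]; first by rewrite expr1n.
by exists (e_ (idx k)) => x i; rewrite /tau mxE mul1r.
Qed.

Lemma section_tame n (w : Defs.form R 'M[R]_3) S : Ad_sections rho n w ->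
  tame J458 (fun x => w x S).
Proof.
case=> sw _ ws wg; apply: tame_of_equivariant => [|x|k x k8]; [exact: sw|exact: ws|].
have := wg _ (pi1orb_tau R k8) x S.
by rewrite (pullback_signed_affine _ _ _ (tau_signed_affine k)) big1 // scale1r.
Qed.

Lemma section_equivariant n (w : Defs.form R 'M[R]_3) g s (S : {set 'I_8}) x : Ad_sections rho n w ->
  pi1orb g -> signed_affine g s ->
  (\prod_(i in S) s i) *: w (g x) S = Ad (rho g) (w x S).
Proof.
by move=> [_ _ _ wg] pg gs; rewrite -(pullback_signed_affine _ _ _ gs) wg.
Qed.

Lemma Ad_sectionsI n (w : Defs.form R 'M[R]_3) : smooth_form w ->
  (forall x, has_degree n (w x)) -> (forall x (S : {set 'I_8}), #|S| = n -> so3 (w x S)) ->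
  (forall g s, pi1orb g -> signed_affine g s -> forall x (S : {set 'I_8}), #|S| = n ->
     (\prod_(i in S) s i) *: w (g x) S = Ad (rho g) (w x S)) ->
  Ad_sections rho n w.
Proof.
move=> sw wn ws wg; split=> // [x S|g pg x S].
  have [/eqP/ws//|Sn] := boolP (#|S| == n); rewrite wn //; exact: so3_0.
have [s gs] := signed_affine_pi1orb pg; rewrite (pullback_signed_affine _ _ _ gs).
have [/eqP Sn|Sn] := boolP (#|S| == n); first exact: wg.
by rewrite !wn // scaler0 linear0.
Qed.

Lemma section_poisson n (w : Defs.form R 'M[R]_3) : Ad_sections rho n w ->
  exists W : Defs.form R 'M[R]_3, Ad_sections rho n W /\
    forall S, laplacian (fun x => W x S) = (fun x => w x S).
Proof.
move=> wS; have [sw wn ws wg] := wS.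
have /choice[W WP] : forall S, exists u : E -> 'M[R]_3, tame J458 u /\ laplacian u = (fun x => w x S).
  by move=> S; apply: tame_mx_poisson; exact: section_tame wS.
have WE S : (fun x => [ffun S => W S x] S) = W S by apply/funext => x; rewrite ffunE.
exists (fun x => [ffun S => W S x]); split; last by move=> S; rewrite WE; case: (WP S).
apply: Ad_sectionsI => [S|x S Sn|x S _|g s pg gs x S _].
- by rewrite WE; case: (WP S) => -[].
(* Coefficients outside degree [n] solve the equation with right-hand side zero, so they vanish by
   injectivity. *)
- rewrite ffunE; have [tW lW] := WP S.
  have w0 : laplacian (W S) = (fun=> 0) by rewrite lW; apply/funext => y; exact: wn.
  exact: (congr1 (fun h => h x) (tame_mx_harmonic tW w0)).
- rewrite ffunE; have [tW lW] := WP S; apply: (tame_so3 tW) => y.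
  by rewrite lW; exact: ws.
- rewrite !ffunE; have [tW lW] := WP S; apply: (tame_equivariant gs tW) => y.
  by rewrite lW; exact: section_equivariant wS pg gs.
Qed.

Lemma tame_flat (u : E -> 'M[R]_3) : tame J458 u ->
  (forall i x, partial i u x = 0) -> u = (fun=> 0).
Proof.
move=> tu du; apply: (tame_mx_harmonic tu); apply/funext => x.
rewrite /laplacian big1 // => i _; rewrite (_ : partial i u = (fun=> 0)) ?partial_cst //.
by apply/funext => y; exact: du.
Qed.

Lemma section_irreducible : irreducible rho.
Proof.
move=> w [wS dw]; exists (fun _ => 0) => //.
apply/funext => x; apply/ffunP => S; rewrite /zero_map ffunE; apply/esym.
have [_ wn _ _] := wS.
have [S0|S0] := boolP (#|S| == 0%N); last exact: wn.
move: S0; rewrite cards_eq0 => /eqP ->.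
have u0 := tame_flat (section_tame finset.set0 wS) _.
apply: (congr1 (fun h => h x) (u0 _)) => i y.
by rewrite -ext_d_function [ext_d w]dw ffunE.
Qed.
End Sections.

(** * Infinitesimal rigidity and vanishing of obstructions *)

Section Rigidity.
Variables (R : realType) (rho : ('rV[R]_8 -> 'rV[R]_8) -> 'M[R]_3).
Local Notation E := 'rV[R]_8.
Local Notation e_ i := (delta_mx 0 i : 'rV[R]_8).
Hypothesis rho_rep : representation rho.
Hypothesis rho_image : klein_four (image_of rho).
Hypothesis rho_generated :
  generated (fun A B : 'M[R]_3 => A *m B) 1%:M
    [set rho (tau 4); rho (tau 5); rho (tau 8)] = image_of rho.
Local Notation J458 := [:: idx 4; idx 5; idx 8].

Lemma partial_J_sum (a : 'I_8 -> E -> 'M[R]_3) (b k : 'I_8) x : (forall j, smooth (a j)) ->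
  partial k (fun y => \sum_(i < 8) \sum_(j < 8) J R b i j *: partial i (a j) y) x =
  \sum_(i < 8) \sum_(j < 8) J R b i j *: partial k (partial i (a j)) x.
Proof.
move=> sa; have sij i j : smooth (fun y => J R b i j *: partial i (a j) y).
  by apply: smoothZ; exact: smooth_partial.
rewrite partial_sum; last by move=> i _; apply: smooth_sum => j _; exact: sij.
apply: eq_bigr => i _; rewrite partial_sum; last by move=> j _; exact: sij.
by apply: eq_bigr => j _; rewrite partialZ //; exact: smooth_partial_differentiable.
Qed.

(* Weitzenboeck formula for the Dirac-type operator [a |-> (d^* a, pi27 (d a))]. *)
Lemma laplacian_of_frame_closed (w : Defs.form R 'M[R]_3) l x : smooth_form w ->
  (forall b y, frame_coord b (ext_d w y) = 0) ->
  laplacian (fun y => w y [set l]%SET) x =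
  partial l (fun y => \sum_(j < 8) partial j (fun z => w z [set j]%SET) y) x.
Proof.
move=> sw w0; pose a j := fun y => w y [set j]%SET.
have sa j : smooth (a j) by exact: sw.
rewrite [RHS]partial_sum; last by move=> j _; exact: smooth_partial.
pose T k i j := partial k (partial i (a j)) x.
have Tsym k i j : T k i j = T i k j by exact: partialC_mx.
have := J_left_contract (T := T) l Tsym; rewrite big1 => [|b _]; last first.
  rewrite big1 // => k _; rewrite /T -partial_J_sum //.
  have -> : (fun y => \sum_(i < 8) \sum_(j < 8) J R b i j *: partial i (a j) y) = (fun=> 0).
    by apply/funext => y; rewrite -frame_coord_ext_d w0.
  by rewrite partial_cst scaler0.
by move=> /esym/eqP; rewrite subr_eq0 => /eqP.
Qed.

Definition divergence_form (w : Defs.form R 'M[R]_3) : Defs.form R 'M[R]_3 := fun y =>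
  [ffun S : {set 'I_8} => if S == finset.set0 then
     \sum_(j < 8) partial j (fun z => w z [set j]%SET) y else 0].

Lemma divergence_section (w : Defs.form R 'M[R]_3) : Ad_sections rho 1 w ->
  Ad_sections rho 0 (divergence_form w).
Proof.
move=> wS; have [sw wn ws wg] := wS; apply: Ad_sectionsI => [S|x S S0|x S _|g s pg gs x S /eqP].
- have [S0|S0] := eqVneq S finset.set0.
    rewrite (_ : (fun y => _) = (fun y => \sum_(j < 8) partial j (fun z => w z [set j]%SET) y)).
      by apply: smooth_sum => j _; apply: smooth_partial; exact: sw.
    by apply/funext => y; rewrite ffunE S0 eqxx.
  rewrite (_ : (fun y => _) = (fun=> 0)); first exact: smooth_cst.
  by apply/funext => y; rewrite ffunE (negbTE S0).
- by rewrite ffunE; case: eqP => // SE; rewrite SE cards0 in S0.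
- rewrite ffunE; case: eqP => _; last exact: so3_0.
  by apply: so3_sum => j _; apply: so3_partial => // y; exact: ws.
- rewrite cards_eq0 => /eqP ->.
  have -> : \prod_(i in finset.set0) s i = 1 by exact: big_set0.
  rewrite scale1r !ffunE eqxx Ad_sum.
  apply: eq_bigr => j _.
  have e := fun y => section_equivariant [set j]%SET y wS pg gs.
  apply: etrans _ (partial_equivariant j gs (sw _) e x); rewrite big_set1 -expr2.
  by case: gs => -> _; rewrite scale1r.
Qed.

Lemma section_rigid : infinitesimally_rigid rho.
Proof.
move=> w [wS dw]; have [sw wn ws wg] := wS.
have w0 b y : frame_coord b (ext_d w y) = 0.
  rewrite -frame_coord_pi27_mx -[pi27_mx _]/(pi27_d_theta w y) dw.
  by rewrite /frame_coord big1 // => p _; rewrite /two_form ffunE scaler0.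
have [W [WS lW]] := section_poisson rho_rep rho_image rho_generated (divergence_section wS).
exists W => //; apply/funext => x; apply/ffunP => S.
have [sW Wn _ _] := WS.
have [/cards1P[l ->]|S1] := boolP (#|S| == 1%N); last first.
  by rewrite wn // (ext_d_degree x Wn).
rewrite /d_theta ext_d_function.
have tW := section_tame rho_rep rho_image rho_generated finset.set0 WS.
have tw := section_tame rho_rep rho_image rho_generated [set l]%SET wS.
suff e : partial l (fun y => W y finset.set0) = (fun y => w y [set l]%SET).
  exact: (congr1 (fun h => h x) e).
(* Both sides have Laplacian [d_l (div w)]: the left one by the choice of [W], the right one by the
   Weitzenboeck formula. *)
apply: (tame_eq (tame_partial l tW) tw); apply/funext => y.
rewrite -partial_laplacian // lW laplacian_of_frame_closed //.
congr (partial l _ y); apply/funext => z; by rewrite ffunE eqxx.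
Qed.

(** On [Lambda27] the sum of [J_b(k,l) <W, J_b>] over [b] is [4 W_kl]. Writing the divergence
    through frame coordinates lets the Clifford relation act on it directly. *)
Definition divergence_two_form (W : Defs.form R 'M[R]_3) : Defs.form R 'M[R]_3 := fun y =>
  [ffun S : {set 'I_8} => \sum_(l < 8 | S == [set l]%SET)
     \sum_(k < 8) \sum_(b < 8) J R b k l *: partial k (fun z => frame_coord b (W z)) y].

Lemma divergence_two_formE W l y : divergence_two_form W y [set l]%SET =
  \sum_(k < 8) \sum_(b < 8) J R b k l *: partial k (fun z => frame_coord b (W z)) y.
Proof.
rewrite ffunE (big_pred1 l) // => i /=; apply/eqP/eqP => [|-> //].
by move/setP/(_ l); rewrite !inE eqxx => /esym/eqP.
Qed.

Lemma smooth_frame_coord (W : Defs.form R 'M[R]_3) b : smooth_form W ->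
  smooth (fun z => frame_coord b (W z)).
Proof. by move=> sW; apply: smooth_sum => p _; apply: smoothZ; exact: sW. Qed.

Lemma laplacian_frame_coord (W : Defs.form R 'M[R]_3) b x : smooth_form W ->
  laplacian (fun z => frame_coord b (W z)) x =
  \sum_(p : 'I_8 * 'I_8 | (p.1 < p.2)%N) J R b p.1 p.2 *: laplacian (fun z => two_form (W z) p) x.
Proof.
move=> sW; apply: (@laplacian_sum _ _ _ _ _ (fun p : 'I_8 * 'I_8 => J R b p.1 p.2)
  (fun (p : 'I_8 * 'I_8) z => two_form (W z) p)) => p _.
exact: sW.
Qed.

Lemma divergence_two_form_smooth W : smooth_form W -> smooth_form (divergence_two_form W).
Proof.
move=> sW S; rewrite /divergence_two_form; under eq_fun do rewrite ffunE.
apply: smooth_sum => l _; apply: smooth_sum => k _; apply: smooth_sum => b _.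
by apply: smoothZ; apply: smooth_partial; exact: smooth_frame_coord.
Qed.

Lemma divergence_two_form_degree W x : has_degree 1 (divergence_two_form W x).
Proof.
move=> S S1; rewrite ffunE big_pred0 // => l; apply/negP => /eqP SE.
by rewrite SE cards1 in S1.
Qed.

(** The terms coupling [b] to another frame index cancel because the Hessian of each frame
    coordinate is symmetric. *)
Lemma frame_coord_d_divergence (W : Defs.form R 'M[R]_3) (b : 'I_8) x : smooth_form W -> (0 < b)%N ->
  frame_coord b (ext_d (divergence_two_form W) x) =
  laplacian (fun z => frame_coord b (W z)) x.
Proof.
move=> sW b0; pose psi c := fun z => frame_coord c (W z).
have spsi c : smooth (psi c) by exact: smooth_frame_coord.
rewrite frame_coord_ext_d.
transitivity (\sum_(c < 8) \sum_(k < 8) \sum_(l < 8) \sum_(m < 8)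
   (J R b k l * J R c m l) *: partial k (partial m (psi c)) x).
  rewrite [RHS]exchange_big; apply: eq_bigr => k _ /=.
  rewrite [RHS]exchange_big; apply: eq_bigr => l _ /=.
  have -> : (fun y => divergence_two_form W y [set l]%SET) =
     (fun y => \sum_(m < 8) \sum_(c < 8) J R c m l *: partial m (psi c) y).
    by apply/funext => y; rewrite divergence_two_formE.
  have sc m c : smooth (fun y => J R c m l *: partial m (psi c) y).
    by apply: smoothZ; exact: smooth_partial.
  rewrite partial_sum; last by move=> m _; apply: smooth_sum => c _; exact: sc.
  rewrite scaler_sumr [RHS]exchange_big; apply: eq_bigr => m _ /=.
  rewrite partial_sum; last by move=> c _; exact: sc.
  rewrite scaler_sumr; apply: eq_bigr => c _.
  rewrite partialZ; last exact: (smooth_partial_differentiable m x (spsi c)).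
  by rewrite scalerA.
have Tsym c k m : partial k (partial m (psi c)) x = partial m (partial k (psi c)) x.
  exact: (partialC_mx k m x (spsi c)).
rewrite (eq_bigr (fun c => (b == c)%:R *: laplacian (psi c) x)); last first.
  move=> c _.
  exact: (@J_right_contract R _ (fun k m => partial k (partial m (psi c)) x) b c b0 (Tsym c)).
rewrite (bigD1 b) //= eqxx scale1r big1 ?addr0 // => c cb.
by rewrite eq_sym (negbTE cb) scale0r.
Qed.

(** Treating the sum over [b] as [4 W_kl] spares computing how [g] acts on each [J_b]. Equivariance
    of [W] speaks of pairs [k < l]; skewness extends it to all pairs, as the divergence requires. *)
Lemma frame_two_form_equivariant (W : Defs.form R 'M[R]_3) n g s k l y : Ad_sections rho n W ->
  (forall z, Lambda27_mx (W z)) -> pi1orb g -> signed_affine g s ->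
  (s k * s l) *: (\sum_(b < 8) J R b k l *: frame_coord b (W (g y))) =
  Ad (rho g) (\sum_(b < 8) J R b k l *: frame_coord b (W y)).
Proof.
move=> WS WL pg gs; pose F k l z := \sum_(b < 8) J R b k l *: frame_coord b (W z).
have FW (p : 'I_8 * 'I_8) z : (p.1 < p.2)%N -> F p.1 p.2 z = (4 : R) *: two_form (W z) p.
  move=> lp; have [_ /(_ p lp) ->] := (Lambda27_mxP _).1 (WL z).
  by rewrite scalerA mulfV ?pnatr_eq0 // scale1r.
have key (p : 'I_8 * 'I_8) z : (p.1 < p.2)%N -> (s p.1 * s p.2) *: F p.1 p.2 (g z) = Ad (rho g) (F p.1 p.2 z).
  move=> lp; have e := section_equivariant [set p.1; p.2]%SET z WS pg gs.
  have -> : Ad (rho g) (F p.1 p.2 z) = (4 : R) *: Ad (rho g) (two_form (W z) p).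
    by rewrite FW //; exact: linearZ.
  rewrite FW // -[Ad _ (two_form _ _)]e -/(two_form _ _).
  rewrite big_setU1 /= ?big_set1; last by rewrite inE -(inj_eq val_inj) neq_ltn lp.
  by rewrite !scalerA mulrC.
rewrite -/(F k l (g y)) -/(F k l y); case: (ltngtP k l) => [kl|lk|/val_inj ->].
- exact: (key (k, l)).
- have Fs z : F k l z = (-1) *: F l k z.
    rewrite /F scaler_sumr; apply: eq_bigr => b _.
    by rewrite (J_skew _ b k) scaleN1r scaleNr.
  have -> : Ad (rho g) (F k l y) = (-1) *: Ad (rho g) (F l k y) by rewrite Fs; exact: linearZ.
  by rewrite Fs -(key (l, k) y lk) /= !scalerA mulrC (mulrC (s k)).
- have F0 z : F l l z = 0 by rewrite /F big1 // => b _; rewrite J_diag scale0r.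
  by rewrite !F0 scaler0 linear0.
Qed.

Lemma divergence_two_form_section (W : Defs.form R 'M[R]_3) : Ad_sections rho 2 W ->
  (forall z, Lambda27_mx (W z)) -> Ad_sections rho 1 (divergence_two_form W).
Proof.
move=> WS WL; have [sW Wn Ws Wg] := WS.
have psi_so3 b y : so3 (frame_coord b (W y)) by apply: so3_sum => p _; apply: so3Z; exact: Ws.
apply: Ad_sectionsI => [|x|x S _|g s pg gs x S /eqP/cards1P[l ->]].
- exact: divergence_two_form_smooth.
- exact: divergence_two_form_degree.
- rewrite ffunE; apply: so3_sum => l _; apply: so3_sum => k _; apply: so3_sum => b _.
  by apply: so3Z; apply: so3_partial => //; exact: smooth_frame_coord.
- pose F k z := \sum_(b < 8) J R b k l *: frame_coord b (W z).
  have sJ k b : smooth (fun z => J R b k l *: frame_coord b (W z)).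
    by apply: smoothZ; exact: smooth_frame_coord.
  have sF k : smooth (F k) by apply: smooth_sum => b _; exact: sJ.
  have DE z : divergence_two_form W z [set l]%SET = \sum_(k < 8) partial k (F k) z.
    rewrite divergence_two_formE; apply: eq_bigr => k _.
    rewrite partial_sum; last by move=> b _; exact: sJ.
    apply: eq_bigr => b _; rewrite partialZ //.
    exact: (smooth_differentiable z (smooth_frame_coord b sW)).
  have -> : \prod_(i in [set l]%SET) s i = s l by exact: big_set1.
  apply: etrans (congr1 (fun v => s l *: v) (DE (g x))) _.
  apply: etrans _ (esym (congr1 (Ad (rho g)) (DE x))).
  rewrite Ad_sum scaler_sumr; apply: eq_bigr => k _.
  have e y := frame_two_form_equivariant k l y WS WL pg gs.
  apply: etrans _ (partial_equivariant k gs (sF k) e x).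
  congr (_ *: _); rewrite mulrAC -expr2.
  by case: gs => -> _; rewrite mul1r.
Qed.

Lemma section_unobstructed : unobstructed rho.
Proof.
move=> w [[wS wL] _]; have [sw wn ws wg] := wS.
have [W [WS lW]] := section_poisson rho_rep rho_image rho_generated wS.
have [sW Wn Ws Wg] := WS.
have lpsi b x : laplacian (fun z => frame_coord b (W z)) x = frame_coord b (w x).
  rewrite laplacian_frame_coord //; apply: eq_bigr => p _.
  by rewrite [X in _ *: X x](lW [set p.1; p.2]%SET).
have spsi b : smooth (fun z => frame_coord b (W z)) by exact: smooth_frame_coord.
have tpsi b : tame J458 (fun z => frame_coord b (W z)).
  apply: tame_sum => p _; apply: tameZ.
  exact: (section_tame rho_rep rho_image rho_generated _ WS).
(* [W] was found coefficient by coefficient, so it is not in [Lambda27] by construction. Both sides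
   of its frame expansion are tame with the same Laplacian, hence equal. *)
have WL x : Lambda27_mx (W x).
  apply/Lambda27_mxP; split=> // p lp.
  have e : (fun z => two_form (W z) p) =
      (fun z => 4^-1 *: \sum_(b < 8) J R b p.1 p.2 *: frame_coord b (W z)).
    apply: (@tame_eq _ J458).
    - exact: (section_tame rho_rep rho_image rho_generated _ WS).
    - by apply: tameZ; apply: tame_sum => b _; exact: tameZ.
    apply/funext => z; rewrite [LHS](congr1 (fun h => h z) (lW [set p.1; p.2]%SET)).
    have [_ /(_ p lp) wf] := (Lambda27_mxP _).1 (wL z).
    apply: etrans wf _; rewrite laplacianZ; last by apply: smooth_sum => b _; exact: smoothZ.
    congr (_ *: _); rewrite laplacian_sum; last by move=> b _; exact: spsi.
    by apply: eq_bigr => b _; rewrite lpsi.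
  exact: (congr1 (fun h => h x) e).
exists (divergence_two_form W); first exact: divergence_two_form_section.
apply/funext => x; apply: pi27_mx_eq => // b.
have [b0|] := boolP (0 < b)%N; first by rewrite frame_coord_d_divergence // lpsi.
rewrite -eqn0Ngt => /eqP b0; have -> : b = ord0 by exact: val_inj.
by rewrite !frame_coord0.
Qed.
End Rigidity.

Theorem proposition7p14 (R : realType)
  (rho : ('rV[R]_8 -> 'rV[R]_8) -> 'M[R]_3)
  (rho_rep : representation rho)
  (rho_image : klein_four (image_of rho))
  (rho_tau1 : rho (tau 1) = 1%:M)
  (rho_tau2 : rho (tau 2) = 1%:M)
  (rho_tau3 : rho (tau 3) = 1%:M)
  (rho_tau7 : rho (tau 7) = 1%:M)
  (rho_tau56 : rho (tau 5) = rho (tau 6))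
  (rho_alpha : rho (@alpha R) = 1%:M)
  (rho_beta : rho (@beta R) = 1%:M)
  (rho_gamma_delta : rho (@gamma R) <> 1%:M \/ rho (@delta R) <> 1%:M)
  (rho_generated :
    generated (fun A B : 'M[R]_3 => A *m B) 1%:M
      [set rho (tau 4); rho (tau 5); rho (tau 8)] = image_of rho) :
  [/\ irreducible rho, infinitesimally_rigid rho & unobstructed rho].
Proof.
split; [exact: section_irreducible|exact: section_rigid|exact: section_unobstructed].
Qed.
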